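(* The $\epsilon$-SPE threshold problem for mean-payoff games is $\mathbf{NP}$-hard, even when restricted to instances with $\epsilon=0$ (i.e. the SPE threshold problem is $\mathbf{NP}$-hard).
   Context: A mean-payoff game is $G=(\Pi,V,(V_i)_{i\in\Pi},E,\mu)$ with finite player set $\Pi$, finite directed graph $(V,E)$ in which every vertex has an outgoing edge, partition $(V_i)$ of $V$ ($V_i$ = vertices controlled by player $i$), and reward functions $r_j:E\to\mathbb{Q}$ with $\mu_j(\rho)=\liminf_n\frac1n\sum_{k=0}^{n-1}r_j(\rho_k\rho_{k+1})$ for every play (infinite path) $\rho$. A strategy for player $i$ from $v_0$ maps each history (finite path) $hv$ from $v_0$ with $v\in V_i$ to a successor of $v$; a complete profile $\bar\sigma$ has outcome $\langle\bar\sigma\rangle$; for a history $hv$, $\bar\sigma_{\|hv}$ is the profile from $v$ with $\sigma_{j\|hv}(h')=\sigma_j(hh')$; $-i=\Pi\setminus\{i\}$. For $\epsilon\ge0$, $\bar\sigma$ from $v_0$ is an $\epsilon$-SPE if for every history $hv$ from $v_0$, every player $i$ and every strategy $\sigma'_i$ from $v$, $\mu_i(\langle\bar\sigma_{-i\|hv},\sigma'_i\rangle)\le\mu_i(\langle\bar\sigma_{\|hv}\rangle)+\epsilon$. The $\epsilon$-SPE threshold problem: given a rational $\epsilon\ge0$, a mean-payoff game $G$ with initial vertex $v_0$, and $\bar x,\bar y\in\mathbb{Q}^\Pi$, decide whether there is an $\epsilon$-SPE $\bar\sigma$ from $v_0$ with $\bar x\le\mu(\langle\bar\sigma\rangle)\le\bar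 y$ componentwise. *)

(* Defs.v *)
From HB Require Import structures.
From mathcomp Require Import all_boot all_order all_algebra.
From mathcomp Require Import all_classical all_reals.
From mathcomp Require Import ereal topology normedtype sequences Rstruct Rstruct_topology.
Set Implicit Arguments. Unset Strict Implicit. Unset Printing Implicit Defensive.
Import Order.TTheory GRing.Theory Num.Theory.
Local Open Scope ring_scope.

Inductive move := MoveL | MoveR | Stay.

(* States are 'I_(nQ.+1); the start state is ord0, the halting state ord_max. *)
Record TM := mkTM {
  nQ : nat;
  delta : 'I_nQ.+1 -> option bool -> 'I_nQ.+1 * option bool * move }.

(* configuration: state, tape left of head (reversed), symbol under head,
   tape right of head *)
Record config (M : TM) := mkConfig {
  cstate : 'I_(nQ M).+1;
  cleft : seq (option bool);
  chead : option bool;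
  cright : seq (option bool) }.

Definition tm_step (M : TM) (c : config M) : config M :=
  if cstate c == ord_max then c else
  let: (q', w, m) := delta (cstate c) (chead c) in
  match m with
  | Stay => mkConfig q' (cleft c) w (cright c)
  | MoveL => match cleft c with
             | [::] => mkConfig q' [::] None (w :: cright c)
             | a :: l => mkConfig q' l a (w :: cright c)
             end
  | MoveR => match cright c with
             | [::] => mkConfig q' (w :: cleft c) None [::]
             | a :: r => mkConfig q' (w :: cleft c) a r
             end
  end.

Definition tm_init (M : TM) (x : seq bool) : config M :=
  match x with
  | [::] => mkConfig (ord0 : 'I_(nQ M).+1) [::] None [::]
  | b :: r => mkConfig (ord0 : 'I_(nQ M).+1) [::] (Some b) (map Some r)
  end.

Definition tm_run (M : TM) (x : seq bool) (t : nat) : config M :=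
  iter t (@tm_step M) (tm_init M x).

Fixpoint read_bits (s : seq (option bool)) : seq bool :=
  match s with
  | Some b :: r => b :: read_bits r
  | _ => [::]
  end.

Definition tm_output (M : TM) (c : config M) : seq bool :=
  read_bits (chead c :: cright c).

Definition poly_time_computable (f : seq bool -> seq bool) : Prop :=
  exists (M : TM) (k : nat), forall x : seq bool,
    exists t : nat, (t <= k * (size x) ^ k + k)%N /\
      cstate (tm_run M x t) = ord_max /\ tm_output (tm_run M x t) = f x.

Definition poly_time_decidable (P : seq bool -> bool) : Prop :=
  poly_time_computable (fun x => [:: P x]).

Definition language := seq bool -> Prop.

Definition pair_words (x u : seq bool) : seq bool :=
  flatten [seq [:: true; b] | b <- x] ++ false :: u.

Definition in_NP (L : language) : Prop :=
  exists (V : seq bool -> bool) (k : nat), poly_time_decidable V /\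
    forall x, L x <-> exists u : seq bool,
      (size u <= k * (size x) ^ k + k)%N /\ V (pair_words x u).

Definition NP_hard (L : language) : Prop :=
  forall L' : language, in_NP L' ->
    exists f, poly_time_computable f /\ forall x, L' x <-> L (f x).

(* self-delimiting binary code of a natural number (LSB first) *)
Fixpoint bits_of_nat_aux (fuel n : nat) : seq bool :=
  match fuel with
  | 0 => [::]
  | fuel'.+1 => if n == 0%N then [::] else odd n :: bits_of_nat_aux fuel' n./2
  end.
Definition enc_nat (n : nat) : seq bool :=
  flatten [seq [:: true; b] | b <- bits_of_nat_aux n n] ++ [:: false].
Definition enc_int (z : int) : seq bool :=
  match z with Posz n => false :: enc_nat n | Negz n => true :: enc_nat n end.
Definition enc_rat (q : rat) : seq bool := enc_int (numq q) ++ enc_int (denq q).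
Definition enc_seq (T : Type) (e : T -> seq bool) (s : seq T) : seq bool :=
  flatten [seq true :: e a | a <- s] ++ [:: false].

(* An instance: vertices are 0..nV-1, players are 0..nP-1,
   owner`_v = player controlling v, edges = list of edges (u,v),
   rew`_e = list of the nP rewards (r_0(e),...,r_(nP-1)(e)) of the e-th edge,
   v0 = initial vertex, thresholds xs, ys, and epsilon. *)
Record instance := mkInstance {
  i_eps : rat;
  i_nP : nat;
  i_nV : nat;
  i_owner : seq nat;
  i_edges : seq (nat * nat);
  i_rew : seq (seq rat);
  i_v0 : nat;
  i_x : seq rat;
  i_y : seq rat }.

Definition wf_instance (I : instance) : bool :=
  [&& 0 <= i_eps I,
      size (i_owner I) == i_nV I,
      all (fun p => (p < i_nP I)%N) (i_owner I),
      all (fun e => (e.1 < i_nV I)%N && (e.2 < i_nV I)%N) (i_edges I),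
      uniq (i_edges I),
      all (fun v => has (fun e => e.1 == v) (i_edges I)) (iota 0 (i_nV I)),
      size (i_rew I) == size (i_edges I),
      all (fun r => size r == i_nP I) (i_rew I),
      (i_v0 I < i_nV I)%N,
      size (i_x I) == i_nP I &
      size (i_y I) == i_nP I].

Definition enc_instance (I : instance) : seq bool :=
  enc_rat (i_eps I) ++ enc_nat (i_nP I) ++ enc_nat (i_nV I)
  ++ enc_seq enc_nat (i_owner I)
  ++ enc_seq (fun e => enc_nat e.1 ++ enc_nat e.2) (i_edges I)
  ++ enc_seq (enc_seq enc_rat) (i_rew I)
  ++ enc_nat (i_v0 I) ++ enc_seq enc_rat (i_x I) ++ enc_seq enc_rat (i_y I).

Section Game.
Variable I : instance.

Definition own (v : nat) : nat := nth 0%N (i_owner I) v.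
Definition is_edge (u v : nat) : bool := (u, v) \in i_edges I.
Definition reward (j : nat) (u v : nat) : rat :=
  nth 0 (nth [::] (i_rew I) (index (u, v) (i_edges I))) j.

Definition is_hist (v : nat) (s : seq nat) : bool :=
  match s with [::] => false | a :: t => (a == v) && path is_edge a t end.

Fixpoint hist_of (next : seq nat -> nat) (v : nat) (k : nat) : seq nat :=
  match k with
  | 0 => [:: v]
  | k'.+1 => let h := hist_of next v k' in rcons h (next h)
  end.
Definition play_of (next : seq nat -> nat) (v : nat) : nat -> nat :=
  fun k => last v (hist_of next v k).

Definition mean_payoff (j : nat) (rho : nat -> nat) : \bar Rdefinitions.R :=
  limn_einf (fun n : nat =>
    (((n%:R : Rdefinitions.R)^-1) * \sum_(k < n) ratr (reward j (rho k) (rho k.+1)))%:E).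

Definition valid_strategy (i : nat) (v : nat) (tau : seq nat -> nat) : Prop :=
  forall s, is_hist v s -> own (last v s) = i -> is_edge (last v s) (tau s).

Definition profile := nat -> seq nat -> nat.

Definition valid_profile (v : nat) (sigma : profile) : Prop :=
  forall i, (i < i_nP I)%N -> valid_strategy i v (sigma i).

Definition profile_next (sigma : profile) : seq nat -> nat :=
  fun h => sigma (own (last 0%N h)) h.

(* the residual profile sigma_{|hv}, with hv = s *)
Definition residual_next (sigma : profile) (s : seq nat) : seq nat -> nat :=
  fun h' => sigma (own (last 0%N h')) (take (size s).-1 s ++ h').

Definition deviation_next (sigma : profile) (s : seq nat) (i : nat)
    (tau : seq nat -> nat) : seq nat -> nat :=
  fun h' => if own (last 0%N h') == i then tau h'
            else residual_next sigma s h'.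

Definition is_eps_SPE (eps : rat) (sigma : profile) : Prop :=
  forall s, is_hist (i_v0 I) s ->
  forall i, (i < i_nP I)%N ->
  forall tau, valid_strategy i (last 0%N s) tau ->
    (mean_payoff i (play_of (deviation_next sigma s i tau) (last 0%N s))
     <= mean_payoff i (play_of (residual_next sigma s) (last 0%N s))
        + (ratr eps)%:E)%E.

Definition threshold_yes : Prop :=
  exists sigma : profile,
    valid_profile (i_v0 I) sigma /\ is_eps_SPE (i_eps I) sigma /\
    forall j, (j < i_nP I)%N ->
      ((ratr (nth 0 (i_x I) j))%:E
         <= mean_payoff j (play_of (profile_next sigma) (i_v0 I))
       <= (ratr (nth 0 (i_y I) j))%:E)%E.

End Game.

Definition eps_SPE_threshold_problem : language :=
  fun w => exists I, wf_instance I /\ enc_instance I = w /\ threshold_yes I.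

Definition SPE_threshold_problem : language :=
  fun w => exists I, wf_instance I /\ i_eps I = 0 /\ enc_instance I = w
                     /\ threshold_yes I.

(* Main.v *)
Require Import Defs.
From HB Require Import structures.
From mathcomp Require Import all_boot all_order all_algebra.
From mathcomp Require Import all_classical all_reals.
From mathcomp Require Import ereal topology normedtype sequences Rstruct Rstruct_topology.
From mathcomp Require Import zify.
Set Implicit Arguments. Unset Strict Implicit. Unset Printing Implicit Defensive.
Import Order.TTheory GRing.Theory Num.Theory.

(* A verifier is turned into a tiling problem and the tiling problem into a game.

   Tiling: the rows of the tableau of the verifier are written one after the
   other, so that cell [h] of row [t + 1] lies [W] positions after cell [h] of
   row [t].  Tiles are windows of three letters; consecutive tiles must overlap
   and a tile determines the letter [W] positions further.  The first row is
   forced, except for the cells of the witness, and no tile shows a rejecting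
   halting head.

   Game: every tile at every cell is a vertex and a player of its own.  A play
   runs cyclically through all cells, choosing one tile per cell, and each
   player can leave for a sink in which he gets 1.  Staying gives 1 too unless a
   tile incompatible with his own is visited with positive frequency.  The start
   player must get 1, so the sink is never entered; hence every tile that is
   visited sees its incompatible tiles only with density 0, and some round of
   the play is a tiling.  Conversely the positional profile that follows a
   tiling and leaves from every other tile is subgame perfect, because a player
   who does not get the maximal payoff 1 does not control any vertex of the play.

   The game is printed by a program over finitely many stacks whose loops run
   over polynomially bounded registers; such programs run in polynomial time on
   a single-tape machine. *)

(** A mean payoff ignores every set of times of density 0, so a single conflict between tiles cannot
    be punished. This is why the play is cyclic: finitely many players tolerate conflicts of density
    0 only, finitely many such sets cannot together meet every round, and one clean round is enough.

    A reward sees one edge and cannot compare vertices that lie [W] steps apart. The memory is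
    supplied by the players: the owner of the earlier tile judges the later one, which is why tiles
    at different cells need different owners.

    The first row is imposed by owners of vertices that no play reaches. They never move, but the
    thresholds demand payoff 1 for them, so they judge the first row like any visited tile.

    The machine and its polynomial bounds are fixed for each language in NP. The tile set is
    therefore a constant of the printing program, and the only quantities that have to be computed
    are lengths that depend polynomially on the size of the input; these are kept in unary. *)

(** * Machine configurations as a head on a two-way infinite tape *)

Definition tape := int -> option bool.
Definition tset (f : tape) (p : int) (w : option bool) : tape :=
  fun z => if z == p then w else f z.
Definition mvz (m : move) : int :=
  match m with MoveL => (-1)%R | MoveR => 1%R | Stay => 0%R end.

(** The [None] default of [nth] extends both half-tapes by blanks, so lists that differ only in
    trailing blanks describe the same tape. *)
Definition cell M (c : config M) (z : int) : option bool :=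
  match z with
  | Posz 0 => chead c
  | Posz n.+1 => nth None (cright c) n
  | Negz n => nth None (cleft c) n
  end.

Definition represents M (c : config M) q (p : int) (f : tape) : Prop :=
  cstate c = q /\ forall z, cell c z = f (p + z)%R.

Lemma represents_step M (c : config M) q p f :
  represents c q p f -> q != ord_max ->
  let: (q', w, m) := delta q (f p) in
  represents (tm_step c) q' (p + mvz m)%R (tset f p w).
Proof.
case=> <- {q} H hq.
have hh : chead c = f p by rewrite -(addr0 p) -H.
rewrite /tm_step (negPf hq) -hh; case: (delta _ _) => [[q' w] m].
have tsetE z z' : (z == z')%R = false -> tset f z' w z = f z by rewrite /tset => ->.
have tset1 z z' : (z == z')%R -> tset f z' w z = w by rewrite /tset => ->.
case: m; rewrite /represents /=.
- case E: (cleft c) => [|a l]; split=> // -[[|n]|n] /=.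
  + rewrite tsetE; last lia.
    by have := H (Negz 0); rewrite /= E /= => ->; congr f; lia.
  + case: n => [|n] /=; first by rewrite tset1 //; lia.
    rewrite tsetE; last lia.
    by have := H (Posz n.+1); rewrite /= => ->; congr f; lia.
  + rewrite nth_nil tsetE; last lia.
    by have := H (Negz n.+1); rewrite /= E /= => ->; congr f; lia.
  + rewrite tsetE; last lia.
    by have := H (Negz 0); rewrite /= E /= => ->; congr f; lia.
  + case: n => [|n] /=; first by rewrite tset1 //; lia.
    rewrite tsetE; last lia.
    by have := H (Posz n.+1); rewrite /= => ->; congr f; lia.
  + rewrite tsetE; last lia.
    by have := H (Negz n.+1); rewrite /= E /= => ->; congr f; lia.
- case E: (cright c) => [|a l]; split=> // -[[|n]|n] /=.
  + rewrite tsetE; last lia.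
    by have := H (Posz 1); rewrite /= E /= => ->; congr f; lia.
  + rewrite nth_nil tsetE; last lia.
    by have := H (Posz n.+2); rewrite /= E /= ?nth_nil => ->; congr f; lia.
  + case: n => [|n] /=; first by rewrite tset1 //; lia.
    rewrite tsetE; last lia.
    by have := H (Negz n); rewrite /= => ->; congr f; lia.
  + rewrite tsetE; last lia.
    by have := H (Posz 1); rewrite /= E /= => ->; congr f; lia.
  + rewrite tsetE; last lia.
    by have := H (Posz n.+2); rewrite /= E /= => ->; congr f; lia.
  + case: n => [|n] /=; first by rewrite tset1 //; lia.
    rewrite tsetE; last lia.
    by have := H (Negz n); rewrite /= => ->; congr f; lia.
- split=> // -[[|n]|n] /=.
  + by rewrite tset1 //; lia.
  + rewrite tsetE; last lia.
    by have := H (Posz n.+1); rewrite /= => ->; congr f; lia.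
  + rewrite tsetE; last lia.
    by have := H (Negz n); rewrite /= => ->; congr f; lia.
Qed.

Lemma represents_init M x :
  represents (tm_init M x) ord0 0%R
    (fun z => match z with Posz n => nth None (map Some x) n | Negz _ => None end).
Proof.
split; first by case: x.
by move=> z; rewrite add0r; case: x z => [|b x] [[|n]|n] //=; rewrite nth_nil.
Qed.

(** * Structured tape programs *)

Inductive tprog :=
  | TMove of move
  | TWrite of option bool
  | TSeq of tprog & tprog
  | TIf of tprog & tprog & tprog
  | TWhile of tprog.

HB.instance Definition _ := gen_eqMixin tprog.

(* A control state is the stack of programs that remain to be run. *)
Definition tstep (k : seq tprog) (s : option bool) : seq tprog * option bool * move :=
  match k with
  | [::] => ([::], s, Stay)
  | TMove m :: k' => (k', s, m)
  | TWrite w :: k' => (k', w, Stay)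
  | TSeq p q :: k' => (p :: q :: k', s, Stay)
  | TIf pN pF pT :: k' =>
      ((match s with None => pN | Some false => pF | Some true => pT end) :: k', s, Stay)
  | TWhile p :: k' => (if s is Some _ then p :: k else k', s, Stay)
  end.

Definition tconf := (seq tprog * (int * tape))%type.

Definition tconf_step (c : tconf) : tconf :=
  let: (k, (p, f)) := c in
  let: (k', w, m) := tstep k (f p) in (k', ((p + mvz m)%R, tset f p w)).

(** Quantifying over all continuations [k] is what lets runs be composed; [n] is an upper bound, so
    costs can be rounded up. *)
Definition texec (t : tprog) (c : int * tape) (n : nat) (c' : int * tape) : Prop :=
  exists2 m, m <= n & forall k, iter m tconf_step (t :: k, c) = (k, c').

Lemma tset_id f p : tset f p (f p) = f.
Proof. by apply/funext => z; rewrite /tset; case: eqP => // ->. Qed.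

Lemma texec_le t c n n' c' : texec t c n c' -> n <= n' -> texec t c n' c'.
Proof. by case=> m le H le'; exists m => //; apply: leq_trans le le'. Qed.

Lemma texec_move m p f : texec (TMove m) (p, f) 1 ((p + mvz m)%R, f).
Proof. by exists 1 => // k; rewrite /= tset_id. Qed.

Lemma texec_write w p f : texec (TWrite w) (p, f) 1 (p, tset f p w).
Proof. by exists 1 => // k; rewrite /= addr0. Qed.

Lemma texec_seq t1 t2 c n1 c1 n2 c2 :
  texec t1 c n1 c1 -> texec t2 c1 n2 c2 -> texec (TSeq t1 t2) c (n1 + n2).+1 c2.
Proof.
case=> m1 le1 H1 [m2 le2 H2]; exists (m2 + m1).+1; first lia.
by move=> k; case: c H1 => p f H1; rewrite iterSr /= tset_id addr0 iterD H1 H2.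
Qed.

Lemma texec_if pN pF pT p f n c' :
  texec (match f p with None => pN | Some false => pF | Some true => pT end)
    (p, f) n c' ->
  texec (TIf pN pF pT) (p, f) n.+1 c'.
Proof.
case=> m le H; exists m.+1; first lia.
by move=> k; rewrite iterSr /= tset_id addr0 H.
Qed.

Lemma texec_while_stop t p f : f p = None -> texec (TWhile t) (p, f) 1 (p, f).
Proof. by move=> E; exists 1 => // k; rewrite /= tset_id addr0 E. Qed.

Lemma texec_while_step t p f n c1 n' c2 : f p <> None ->
  texec t (p, f) n c1 -> texec (TWhile t) c1 n' c2 ->
  texec (TWhile t) (p, f) (n + n').+1 c2.
Proof.
move=> E [m1 le1 H1] [m2 le2 H2]; exists (m2 + m1).+1; first lia.
move=> k; rewrite iterSr /= tset_id addr0.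
by case Ef: (f p) E => [b|] // _; rewrite iterD H1 H2.
Qed.

(** The stacks that can occur before [k] is uncovered. A loop body runs on top of [t :: k], which is
    listed already, so finitely many stacks suffice; they become the states of the machine. *)
Fixpoint residuals (t : tprog) (k : seq tprog) : seq (seq tprog) :=
  (t :: k) :: match t with
  | TMove _ | TWrite _ => [::]
  | TSeq p q => residuals p (q :: k) ++ residuals q k
  | TIf pN pF pT => residuals pN k ++ residuals pF k ++ residuals pT k
  | TWhile p => residuals p (t :: k)
  end.

Lemma residuals_head t k : t :: k \in residuals t k.
Proof. by case: t => *; rewrite inE eqxx. Qed.

Lemma residuals_closed t k l s : l \in residuals t k ->
  ((tstep l s).1.1 \in residuals t k) || ((tstep l s).1.1 == k).
Proof.
elim: t k => [m|w|p IHp q IHq|pN IHN pF IHF pT IHT|p IHp] k.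
- by rewrite inE => /eqP -> /=; rewrite eqxx orbT.
- by rewrite inE => /eqP -> /=; rewrite eqxx orbT.
- rewrite [residuals _ _]/= inE mem_cat => /predU1P[->|/orP[/IHp|/IHq]] /=.
  + by rewrite inE mem_cat residuals_head orbT.
  + rewrite inE mem_cat => /orP[->|/eqP ->]; first by rewrite orbT.
    by rewrite residuals_head !orbT.
  + by rewrite inE mem_cat => /orP[->|->]; rewrite ?orbT.
- rewrite [residuals _ _]/= inE !mem_cat => /predU1P[->|/or3P[/IHN|/IHF|/IHT]] /=.
  + by case: {IHN IHF IHT} s => [[]|]; rewrite inE !mem_cat residuals_head !orbT.
  + by rewrite inE !mem_cat => /orP[->|->]; rewrite ?orbT.
  + by rewrite inE !mem_cat => /orP[->|->]; rewrite ?orbT.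
  + by rewrite inE !mem_cat => /orP[->|->]; rewrite ?orbT.
- rewrite [residuals _ _]/= inE => /predU1P[->|/IHp] /=.
  + by case: {IHp} s => [b|] /=; rewrite inE ?residuals_head ?eqxx !orbT.
  + by rewrite inE => /orP[->|->]; rewrite ?orbT.
Qed.

Lemma residuals_nonnil t k : [::] \notin residuals t k.
Proof.
elim: t k => [m|w|p IHp q IHq|pN IHN pF IHF pT IHT|p IHp] k //=.
- by rewrite inE mem_cat negb_or negb_or IHp IHq.
- by rewrite inE !mem_cat !negb_or IHN IHF IHT.
- by rewrite inE negb_or IHp.
Qed.

Section Compile.
Variable t : tprog.

(** [[:: t]] has to come first and [[::]] last, because the start state is [ord0] and the halting
    state is [ord_max]. *)
Definition ctl_states := rcons (residuals t [::]) [::].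
Definition ctl_max := size (residuals t [::]).

Definition tm_of : TM := mkTM (fun (i : 'I_ctl_max.+1) s =>
  let: (k, w, m) := tstep (nth [::] ctl_states i) s in
  (inord (index k ctl_states) : 'I_ctl_max.+1, w, m)).

Definition ctl_state (k : seq tprog) : 'I_(nQ tm_of).+1 := inord (index k ctl_states).

Lemma index_ctl k : k \in ctl_states -> index k ctl_states < ctl_max.+1.
Proof. by rewrite -index_mem size_rcons. Qed.

Lemma ctl_closed k s : k \in ctl_states -> (tstep k s).1.1 \in ctl_states.
Proof.
rewrite mem_rcons inE => /predU1P[->|/(@residuals_closed _ _ _ s)].
  by rewrite mem_rcons inE eqxx.
by rewrite mem_rcons inE orbC.
Qed.

Lemma ctl_state_max k : k \in ctl_states -> (ctl_state k == ord_max) = (k == [::]).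
Proof.
move=> kin; rewrite -val_eqE /= inordK ?index_ctl //.
rewrite /ctl_states -cats1 index_cat.
move: kin; rewrite mem_rcons inE => /predU1P[->|kin].
  by rewrite (negPf (residuals_nonnil _ _)) /= eqxx addn0 !eqxx.
rewrite kin; case: eqP => [E|_]; last by case: eqP kin => // ->; rewrite (negPf (residuals_nonnil _ _)).
by move: kin; rewrite -index_mem E ltnn.
Qed.

Lemma tm_of_run (c : config tm_of) k p f n k' p' f' :
  k \in ctl_states -> represents c (ctl_state k) p f ->
  iter n tconf_step (k, (p, f)) = (k', (p', f')) ->
  represents (iter n (@tm_step tm_of) c) (ctl_state k') p' f'.
Proof.
elim: n c k p f => [|n IHn] c k p f kin Hc; first by case=> <- <- <-.
rewrite !iterSr [tconf_step _]/=.
case E: (tstep k (f p)) => [[k1 w] m] /IHn; apply.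
  by have := ctl_closed (f p) kin; rewrite E.
(* The empty stack idles in place exactly as a halted machine does. *)
case: (eqVneq k [::]) E => [k0|kn0] E.
  move: E; rewrite k0 => -[<- <- <-]; rewrite /= addr0 tset_id -k0.
  have /eqP Emax : ctl_state k == ord_max by rewrite ctl_state_max // k0.
  by rewrite /tm_step; case: (Hc) => -> _; rewrite Emax eqxx -Emax.
have := represents_step Hc; rewrite ctl_state_max // => /(_ kn0).
by rewrite /= inordK ?index_ctl // nth_index // E.
Qed.

Lemma tm_of_exec (c : config tm_of) p f n p' f' :
  represents c ord0 p f -> texec t (p, f) n (p', f') ->
  exists2 m, m <= n & represents (iter m (@tm_step tm_of) c) ord_max p' f'.
Proof.
move=> Hc [m le H]; exists m => //.
have tin : [:: t] \in ctl_states by rewrite mem_rcons inE residuals_head.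
have E0 : ctl_state [:: t] = ord0.
  apply: val_inj; rewrite /= inordK ?index_ctl //.
  by rewrite /ctl_states; case: (t) => *; rewrite /= eqxx.
have /eqP Em : ctl_state [::] == ord_max.
  by rewrite ctl_state_max // mem_rcons inE.
by rewrite -Em; apply: tm_of_run (H _) => //; rewrite E0.
Qed.

End Compile.

(** The range includes [n = size w]: the blank after [w] is what stops [read_bits]. *)
Lemma represents_output M (c : config M) q p f w :
  represents c q p f ->
  (forall n, n <= size w -> f (p + Posz n)%R = nth None (map Some w) n) ->
  tm_output c = w.
Proof.
case=> _ H Hf; rewrite /tm_output.
have Hn n : n <= size w -> nth None (chead c :: cright c) n = nth None (map Some w) n.
  by move=> le; rewrite -Hf // -H; case: n le.
elim: w (chead c :: cright c) Hn {H Hf} => [|b w IHw] [|a s] Hn //=.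
- by have := Hn 0 isT; rewrite /= => ->.
- by have := Hn 0 isT.
- have := Hn 0 isT; rewrite /= => ->; congr cons; apply: IHw => n le.
  exact: (Hn n.+1).
Qed.

(** * Polynomially bounded functions *)

(** The base [n.+1] is positive, so exponents can always be raised; this makes closure under sums
    and products immediate. *)
Definition poly_bounded (g : nat -> nat) : Prop :=
  exists c e, forall n, g n <= c * n.+1 ^ e.

Lemma poly_bounded_le g h : (forall n, g n <= h n) -> poly_bounded h -> poly_bounded g.
Proof. by move=> le [c [e H]]; exists c, e => n; apply: leq_trans (le n) (H n). Qed.

Lemma poly_bounded_const c : poly_bounded (fun=> c).
Proof. by exists c, 0 => n; rewrite expn0 muln1. Qed.

Lemma poly_bounded_id : poly_bounded id.
Proof. by exists 1, 1 => n; rewrite mul1n expn1. Qed.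

Lemma poly_boundedD g h :
  poly_bounded g -> poly_bounded h -> poly_bounded (fun n => g n + h n).
Proof.
case=> c [e Hg] [c' [e' Hh]]; exists (c + c'), (e + e') => n.
rewrite mulnDl; apply: leq_add.
  by apply: leq_trans (Hg n) _; rewrite leq_mul2l leq_pexp2l ?leq_addr ?orbT.
by apply: leq_trans (Hh n) _; rewrite leq_mul2l leq_pexp2l ?leq_addl ?orbT.
Qed.

Lemma poly_boundedM g h :
  poly_bounded g -> poly_bounded h -> poly_bounded (fun n => g n * h n).
Proof.
case=> c [e Hg] [c' [e' Hh]]; exists (c * c'), (e + e') => n.
by rewrite expnD mulnACA leq_mul.
Qed.

Lemma poly_boundedX g k : poly_bounded g -> poly_bounded (fun n => g n ^ k).
Proof.
move=> Hg; elim: k => [|k IHk]; first exact: poly_bounded_const.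
apply: poly_bounded_le (poly_boundedM Hg IHk) => n.
by rewrite expnS.
Qed.

(** For positive [n], [n.+1 <= 2 * n] costs a factor [2 ^ e]; for [n = 0] the summand [k] is
    enough. *)
Lemma poly_boundedP g : poly_bounded g -> exists k, forall n, g n <= k * n ^ k + k.
Proof.
case=> c [e H]; exists (c * 2 ^ e + e) => n; apply: leq_trans (H n) _.
have e1 : 1 <= 2 ^ e by rewrite expn_gt0.
case: n => [|n]; first by rewrite exp1n muln1 -[X in X <= _]muln1; nia.
apply: leq_trans (leq_addr _ _).
have le1 : n.+2 ^ e <= (2 * n.+1) ^ e by case: (e) => // e'; rewrite leq_exp2r //; lia.
rewrite expnMn in le1.
apply: (@leq_trans (c * 2 ^ e * n.+1 ^ e)); first by rewrite -mulnA leq_mul2l le1 orbT.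
apply: leq_mul; first exact: leq_addr.
by rewrite leq_pexp2l // leq_addl.
Qed.

(** * A register language *)

Definition regs := nat -> seq bool.
Definition upd (s : regs) (r : nat) (l : seq bool) : regs :=
  fun r' => if r' == r then l else s r'.

Lemma upd_eq s r l : upd s r l r = l.
Proof. by rewrite /upd eqxx. Qed.
Lemma upd_neq s r l r' : r' != r -> upd s r l r' = s r'.
Proof. by rewrite /upd => /negPf ->. Qed.
Lemma upd_upd s r l l' : upd (upd s r l) r l' = upd s r l'.
Proof. by apply/funext => i; rewrite /upd; case: eqP. Qed.
Lemma upd_id s r : upd s r (s r) = s.
Proof. by apply/funext => i; rewrite /upd; case: eqP => // ->. Qed.
Lemma updC s r r' l l' : r != r' -> upd (upd s r l) r' l' = upd (upd s r' l') r l.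
Proof.
move=> /negPf ne; apply/funext => i; rewrite /upd.
by case: (eqVneq i r') => // ->; rewrite eq_sym ne.
Qed.

Inductive prog :=
  | Skip
  | Push of nat & bool
  | Case of nat & prog & prog & prog
  | Seq of prog & prog
  | For of nat & prog & prog.

Fixpoint chain (step : bool -> regs -> regs -> Prop) (l : seq bool) (s s' : regs) :=
  if l is b :: l' then exists2 s1, step b s s1 & chain step l' s1 s' else s' = s.

(* Registers are stacks.  [For] runs over a snapshot of its register, and [B]
   bounds the number of iterations of every loop. *)
Fixpoint exec (B : nat) (p : prog) (s s' : regs) : Prop :=
  match p with
  | Skip => s' = s
  | Push r b => s' = upd s r (b :: s r)
  | Case r pE pF pT =>
      match s r with
      | [::] => exec B pE s s'
      | b :: l => exec B (if b then pT else pF) (upd s r l) s'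
      end
  | Seq p1 p2 => exists2 s1, exec B p1 s s1 & exec B p2 s1 s'
  | For r pF pT =>
      size (s r) <= B /\
      chain (fun b => if b then exec B pT else exec B pF) (s r) s s'
  end.

(** This number bounds both the running time, in units of [op_cost], and the growth of the
    registers. For [For], the three loops of [comp] spend 6 units per iteration besides the body, a
    seventh absorbs lower-order terms, and 5 covers the ends of the loops and the sequencing. *)
Fixpoint ops (p : prog) (B : nat) : nat :=
  match p with
  | Skip | Push _ _ => 1
  | Case _ pE pF pT => (ops pE B + ops pF B + ops pT B).+2
  | Seq p1 p2 => (ops p1 B + ops p2 B).+1
  | For _ pF pT => B * (ops pF B + ops pT B + 7) + 5
  end.

Fixpoint max_reg (p : prog) : nat :=
  match p with
  | Skip => 0
  | Push r _ => r
  | Case r pE pF pT => maxn r (maxn (max_reg pE) (maxn (max_reg pF) (max_reg pT)))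
  | Seq p1 p2 => maxn (max_reg p1) (max_reg p2)
  | For r pF pT => maxn r (maxn (max_reg pF) (max_reg pT))
  end.

Fixpoint nesting (p : prog) : nat :=
  match p with
  | Skip | Push _ _ => 0
  | Case _ pE pF pT => maxn (nesting pE) (maxn (nesting pF) (nesting pT))
  | Seq p1 p2 => maxn (nesting p1) (nesting p2)
  | For _ pF pT => (maxn (nesting pF) (nesting pT)).+1
  end.

Lemma ops_poly p Bf : poly_bounded Bf -> poly_bounded (fun n => ops p (Bf n)).
Proof.
move=> HB; elim: p => [|r b|r pE IHE pF IHF pT IHT|p IHp q IHq|r pF IHF pT IHT] /=.
- exact: poly_bounded_const.
- exact: poly_bounded_const.
- apply: poly_bounded_le (poly_boundedD (poly_boundedD (poly_boundedD IHE IHF) IHT)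
    (poly_bounded_const 2)) => n; lia.
- apply: poly_bounded_le (poly_boundedD (poly_boundedD IHp IHq)
    (poly_bounded_const 1)) => n; lia.
- exact: (poly_boundedD (poly_boundedM HB (poly_boundedD (poly_boundedD IHF IHT)
    (poly_bounded_const 7))) (poly_bounded_const 5)).
Qed.

Lemma chain_mono (st1 st2 : bool -> regs -> regs -> Prop) l s s' :
  (forall b s s', st1 b s s' -> st2 b s s') -> chain st1 l s s' -> chain st2 l s s'.
Proof.
move=> H; elim: l s => [|b l IHl] s //= [s1 H1 H2].
by exists s1; [apply: H | apply: IHl].
Qed.

(** Loop counters live above the registers of the program; whatever they hold, they neither disturb
    a run nor are disturbed by it. *)
Lemma exec_frame B p h l s s' : max_reg p < h ->
  exec B p s s' -> s' h = s h /\ exec B p (upd s h l) (upd s' h l).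
Proof.
elim: p s s' => [|r b|r pE IHE pF IHF pT IHT|p IHp q IHq|r pF IHF pT IHT] s s' /=.
- by move=> _ ->.
- move=> lt ->; split; first by rewrite upd_neq // gtn_eqF.
  by rewrite [upd s h l r]upd_neq ?ltn_eqF // updC // ltn_eqF.
- rewrite !gtn_max => /and4P[ltr ltE ltF ltT].
  rewrite [upd s h l r]upd_neq ?ltn_eqF //.
  case: (s r) => [|b l0]; first exact: IHE.
  have -> : upd (upd s h l) r l0 = upd (upd s r l0) h l by rewrite updC // gtn_eqF.
  have E : upd s r l0 h = s h by rewrite upd_neq // gtn_eqF.
  by case: b => [/(IHT _ _ ltT)|/(IHF _ _ ltF)]; rewrite E.
- rewrite gtn_max => /andP[ltp ltq] [s1 /(IHp _ _ ltp)[E1 H1] /(IHq _ _ ltq)[E2 H2]].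
  by split; [rewrite E2 | exists (upd s1 h l)].
- rewrite !gtn_max => /and3P[ltr ltF ltT] [le H].
  rewrite [upd s h l r]upd_neq ?ltn_eqF //.
  move: (s r) le H => l1; elim: l1 s => [|b l0 IHl] s le /=; first by move=> ->.
  case=> s1 H1 /IHl[|E2 [_ H2]]; first by apply: leq_trans le => /=.
  have [E1 H1'] : s1 h = s h /\
     (if b then exec B pT else exec B pF) (upd s h l) (upd s1 h l).
    by case: b {le} H1 => [/(IHT _ _ ltT)|/(IHF _ _ ltF)].
  by split; [rewrite E2 | split=> //; exists (upd s1 h l)].
Qed.

(** * Compiling the register language to tape programs *)

Section Layout.
Variable K : nat.

(* Register 0 occupies the cells 0, 1, ...; registers 1 .. K are interleaved on
   the negative cells with stride K.  Level 0 of a register is a permanently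
   blank cell, level j.+1 holds the j-th entry counted from the bottom. *)
Definition pos (r j : nat) : int :=
  if r is r'.+1 then (- Posz (r' + K * j).+1)%R else (Posz j - 1)%R.

Definition home : int := (-1)%R.

Definition lev (l : seq bool) (j : nat) : option bool :=
  if j is j'.+1 then nth None (map Some (rev l)) j' else None.

Definition Rep (s : regs) (f : tape) : Prop :=
  forall r, r <= K -> forall j, f (pos r j) = lev (s r) j.

(** Level 0 is excluded because [pos 0 0] and [pos 1 0] are the same cell -1. Sharing it is
    harmless, as it stays blank. *)
Lemma pos_inj r j r' j' : r <= K -> r' <= K -> 0 < j ->
  pos r j = pos r' j' -> r = r' /\ j = j'.
Proof.
case: r r' => [|r] [|r'] leK leK' j0 /= E.
- by split; lia.
- lia.
- have : r + K * j = 0 by lia.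
  nia.
- have {}E : j * K + r = j' * K + r' by lia.
  have lt1 : r < K by lia. have lt2 : r' < K by lia.
  have K0 : 0 < K by lia.
  have Ej : j = j'.
    by move/(congr1 (divn^~ K)): E; rewrite !divnMDl // !divn_small // !addn0.
  by split=> //; lia.
Qed.

Lemma lev_cons b l j : lev (b :: l) j = if j == (size l).+1 then Some b else lev l j.
Proof.
case: j => [|j] //=; rewrite rev_cons map_rcons nth_rcons size_map size_rev eqSS.
case: ltngtP => // lt; by rewrite nth_default // size_map size_rev ltnW.
Qed.

Lemma lev_some l j : 0 < j <= size l -> lev l j <> None.
Proof.
case: j => [|j] //= lt; rewrite (nth_map false) // size_rev //.
Qed.

Lemma lev_none l j : size l < j -> lev l j = None.
Proof. by case: j => [|j] //= lt; rewrite nth_default // size_map size_rev. Qed.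

Lemma Rep_tset s f r l j w : Rep s f -> r <= K -> 0 < j ->
  (forall j', lev l j' = if j' == j then w else lev (s r) j') ->
  Rep (upd s r l) (tset f (pos r j) w).
Proof.
move=> Hf leK j0 Hl r' leK' j'; rewrite /tset /upd.
case: eqP => [E|NE].
  by have [<- <-] := pos_inj leK leK' j0 (esym E); rewrite eqxx Hl eqxx.
rewrite Hf //; case: (r' =P r) => [E|//]; rewrite {}E in NE *.
by rewrite Hl; case: eqP NE => // -> [].
Qed.

Definition moves (m : move) (n : nat) : tprog := iter n (TSeq (TMove m)) (TMove Stay).
Arguments moves : simpl never.

Lemma moves_exec m n p f :
  texec (moves m n) (p, f) (2 * n + 1) ((p + mvz m * Posz n)%R, f).
Proof.
elim: n p => [|n IHn] p.
  by rewrite mulr0; apply: texec_move.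
have -> : (p + mvz m * Posz n.+1 = p + mvz m + mvz m * Posz n)%R.
  by case: m {IHn} => /=; lia.
by apply: texec_le (texec_seq (texec_move m p f) (IHn _)) _; lia.
Qed.

Definition outw r := if r is 0 then moves MoveR 1 else moves MoveL K.
Definition inw r := if r is 0 then moves MoveL 1 else moves MoveR K.
Definition to_wall r := if r is r'.+1 then moves MoveL r' else moves MoveL 0.
Definition to_home r := if r is r'.+1 then moves MoveR r' else moves MoveR 0.

Lemma outw_exec r j f : texec (outw r) (pos r j, f) (2 * K + 3) (pos r j.+1, f).
Proof.
case: r => [|r] /=.
  have -> : (Posz j.+1 - 1 = Posz j - 1 + mvz MoveR * Posz 1)%R by rewrite /=; lia.
  by apply: texec_le (moves_exec _ _ _ _) _; lia.
have -> : (- Posz (r + K * j.+1).+1 = - Posz (r + K * j).+1 + mvz MoveL * Posz K)%R.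
  by rewrite /= mulnS; lia.
by apply: texec_le (moves_exec _ _ _ _) _; lia.
Qed.

Lemma inw_exec r j f : texec (inw r) (pos r j.+1, f) (2 * K + 3) (pos r j, f).
Proof.
case: r => [|r] /=.
  have -> : (Posz j - 1 = Posz j.+1 - 1 + mvz MoveL * Posz 1)%R by rewrite /=; lia.
  by apply: texec_le (moves_exec _ _ _ _) _; lia.
have -> : (- Posz (r + K * j).+1 = - Posz (r + K * j.+1).+1 + mvz MoveR * Posz K)%R.
  by rewrite /= mulnS; lia.
by apply: texec_le (moves_exec _ _ _ _) _; lia.
Qed.

Lemma to_wall_exec r f : r <= K -> texec (to_wall r) (home, f) (2 * K + 3) (pos r 0, f).
Proof.
case: r => [|r] le /=.
  have -> : (Posz 0 - 1 = home + mvz MoveL * Posz 0)%R by [].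
  by apply: texec_le (moves_exec _ _ _ _) _; lia.
have -> : (- Posz (r + K * 0).+1 = home + mvz MoveL * Posz r)%R.
  by rewrite /home /= muln0; lia.
by apply: texec_le (moves_exec _ _ _ _) _; lia.
Qed.

Lemma to_home_exec r f : r <= K -> texec (to_home r) (pos r 0, f) (2 * K + 3) (home, f).
Proof.
case: r => [|r] le /=.
  have -> : (home = Posz 0 - 1 + mvz MoveR * Posz 0)%R by [].
  by apply: texec_le (moves_exec _ _ _ _) _; lia.
have -> : (home = - Posz (r + K * 0).+1 + mvz MoveR * Posz r)%R.
  by rewrite /home /= muln0; lia.
by apply: texec_le (moves_exec _ _ _ _) _; lia.
Qed.

Lemma while_out_exec r f j i :
  (forall i', i' < i -> f (pos r (j + i')) <> None) -> f (pos r (j + i)) = None ->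
  texec (TWhile (outw r)) (pos r j, f) (i * (2 * K + 4) + 1) (pos r (j + i), f).
Proof.
elim: i j => [|i IHi] j Hs Hn.
  by rewrite addn0 in Hn *; apply: texec_while_stop.
apply: texec_le (texec_while_step _ (outw_exec _ _ _) _) _.
- by rewrite -(addn0 j); apply: Hs.
- by rewrite -addSnnS; apply: IHi => [i' lt|]; rewrite addSnnS //; apply: Hs.
- nia.
Qed.

Lemma while_in_exec r f j :
  (forall j', 0 < j' <= j -> f (pos r j') <> None) -> f (pos r 0) = None ->
  texec (TWhile (inw r)) (pos r j, f) (j * (2 * K + 4) + 1) (pos r 0, f).
Proof.
move=> Hs Hn; elim: j Hs => [|j IHj] Hs; first exact: texec_while_stop.
apply: texec_le (texec_while_step _ (inw_exec _ _ _) (IHj _)) _.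
- by apply: Hs; rewrite ltnS leqnn.
- by move=> j' /andP[j0 le]; apply: Hs; rewrite j0 ltnW.
- nia.
Qed.

Definition op_cost (S : nat) : nat := (2 * K + 5) * (2 * S + 8).

(** Level 0 is itself blank, so a step outwards precedes the loop. The loop stops at the first free
    level, and a step inwards returns to the top entry, or to level 0 if the register is empty. *)
Definition to_top r :=
  TSeq (to_wall r) (TSeq (outw r) (TSeq (TWhile (outw r)) (inw r))).
Definition tdrop r :=
  TSeq (TWrite None) (TSeq (inw r) (TSeq (TWhile (inw r)) (to_home r))).
Definition tpush r b :=
  TSeq (to_wall r) (TSeq (outw r) (TSeq (TWhile (outw r))
    (TSeq (TWrite (Some b)) (TSeq (TWhile (inw r)) (to_home r))))).

Lemma while_out_rep s f r : Rep s f -> r <= K ->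
  texec (TWhile (outw r)) (pos r 1, f) (size (s r) * (2 * K + 4) + 1)
    (pos r (size (s r)).+1, f).
Proof.
move=> Hf leK; apply: while_out_exec => [i lt|]; rewrite Hf //.
  by apply: lev_some; rewrite add1n.
by apply: lev_none; rewrite add1n.
Qed.

Lemma while_in_rep s f r : Rep s f -> r <= K ->
  texec (TWhile (inw r)) (pos r (size (s r)), f) (size (s r) * (2 * K + 4) + 1)
    (pos r 0, f).
Proof.
move=> Hf leK; apply: while_in_exec => [j lt|]; rewrite Hf //; exact: lev_some.
Qed.

Lemma to_top_exec s f r : Rep s f -> r <= K ->
  texec (to_top r) (home, f) ((2 * K + 5) * (size (s r) + 4)) (pos r (size (s r)), f).
Proof.
move=> Hf leK.
apply: texec_le (texec_seq (to_wall_exec _ leK) (texec_seq (outw_exec _ _ _)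
  (texec_seq (while_out_rep Hf leK) (inw_exec _ _ _)))) _.
nia.
Qed.

Lemma tdrop_exec s f r b l : Rep s f -> r <= K -> s r = b :: l ->
  exists2 f', Rep (upd s r l) f' &
  texec (tdrop r) (pos r (size (s r)), f) ((2 * K + 5) * (size l + 4)) (home, f').
Proof.
move=> Hf leK E.
have Hf' : Rep (upd s r l) (tset f (pos r (size l).+1) None).
  apply: Rep_tset => // j; rewrite E lev_cons; case: eqP => // ->.
  exact: lev_none.
exists (tset f (pos r (size l).+1) None) => //; rewrite E.
have W := while_in_rep Hf' leK; rewrite upd_eq in W.
apply: texec_le (texec_seq (texec_write _ _ _) (texec_seq (inw_exec _ _ _)
  (texec_seq W (to_home_exec _ leK)))) _.
nia.
Qed.

(** Every routine starts and ends at [home], so routines can be sequenced without knowing how long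
    the registers are. *)
Definition sim (t : tprog) (s s' : regs) (n : nat) : Prop :=
  forall f, Rep s f -> exists2 f', Rep s' f' & texec t (home, f) n (home, f').

Lemma sim_le t s s' n n' : sim t s s' n -> n <= n' -> sim t s s' n'.
Proof. by move=> H le f /H[f' Hf' E]; exists f' => //; apply: texec_le le. Qed.

Lemma sim_seq t t' s s1 s' n n' :
  sim t s s1 n -> sim t' s1 s' n' -> sim (TSeq t t') s s' (n + n').+1.
Proof.
move=> H H' f /H[f1 /H'[f2 R2 E2] E1]; exists f2 => //; exact: texec_seq E1 E2.
Qed.

Lemma sim_skip s : sim (TMove Stay) s s 1.
Proof. by move=> f Hf; exists f => //; apply: texec_move. Qed.

Lemma sim_push s r b S : r <= K -> size (s r) < S ->
  sim (tpush r b) s (upd s r (b :: s r)) (op_cost S).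
Proof.
move=> leK ltS f Hf; pose f' := tset f (pos r (size (s r)).+1) (Some b).
have Hf' : Rep (upd s r (b :: s r)) f'.
  by apply: Rep_tset => // j; rewrite lev_cons.
exists f' => //.
have W := while_in_rep Hf' leK; rewrite upd_eq /= in W.
apply: texec_le (texec_seq (to_wall_exec _ leK) (texec_seq (outw_exec _ _ _)
  (texec_seq (while_out_rep Hf leK) (texec_seq (texec_write _ _ _)
  (texec_seq W (to_home_exec _ leK)))))) _.
rewrite /op_cost; nia.
Qed.

Definition tcase r tE tF tT :=
  TSeq (to_top r) (TIf (TSeq (to_home r) tE) (TSeq (tdrop r) tF) (TSeq (tdrop r) tT)).

Lemma sim_case_nil s s' r tE tF tT S n : r <= K -> s r = [::] ->
  sim tE s s' n -> sim (tcase r tE tF tT) s s' (op_cost S + n).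
Proof.
move=> leK E H f Hf; have [f' Hf' Ef] := H f Hf; exists f' => //.
have T := to_top_exec Hf leK; rewrite E /= in T.
have X : texec (TIf (TSeq (to_home r) tE) (TSeq (tdrop r) tF) (TSeq (tdrop r) tT))
    (pos r 0, f) (2 * K + 3 + n).+2 (home, f').
  apply: texec_if; rewrite Hf //=; apply: texec_seq Ef; exact: to_home_exec.
apply: texec_le (texec_seq T X) _.
rewrite /op_cost; nia.
Qed.

Lemma sim_case_cons s s' r tE tF tT S n b l : r <= K -> s r = b :: l -> size l < S ->
  sim (if b then tT else tF) (upd s r l) s' n ->
  sim (tcase r tE tF tT) s s' (op_cost S + n).
Proof.
move=> leK E ltS H f Hf; have [f1 Hf1 Ef1] := tdrop_exec Hf leK E.
have [f' Hf' Ef] := H f1 Hf1; exists f' => //.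
have T := to_top_exec Hf leK.
have X : texec (TIf (TSeq (to_home r) tE) (TSeq (tdrop r) tF) (TSeq (tdrop r) tT))
    (pos r (size (s r)), f) ((2 * K + 5) * (size l + 4) + n).+2 (home, f').
  apply: texec_if; rewrite Hf // {1}E lev_cons {1}E eqxx.
  by case: b Ef {E H} => Ef; apply: texec_seq Ef1 Ef.
apply: texec_le (texec_seq T X) _.
rewrite E /op_cost /=; nia.
Qed.

(** The loop consumes its register: each round pops the top entry before running the body, and an
    empty register puts the head on the blank of level 0, which ends the loop. *)
Definition tloop r tF tT :=
  TSeq (to_top r) (TSeq (TWhile (TIf (TMove Stay)
    (TSeq (tdrop r) (TSeq tF (to_top r))) (TSeq (tdrop r) (TSeq tT (to_top r)))))
    (to_home r)).

(** While the body runs, [r] holds the rest of the loop; hence the body is required to work for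
    every content [l'] of [r] and to leave it in place. *)
Lemma sim_loop step r tF tT S n l s s' : r <= K -> size l <= S ->
  (forall b s1 s2 l', step b s1 s2 -> size l' <= size l ->
     sim (if b then tT else tF) (upd s1 r l') (upd s2 r l') n) ->
  chain step l s s' ->
  sim (tloop r tF tT) (upd s r l) (upd s' r [::]) (op_cost S * (size l).+1 + size l * n).
Proof.
move=> leK leS Hb Hc.
suff W f : Rep (upd s r l) f -> exists2 f', Rep (upd s' r [::]) f' &
  texec (TWhile (TIf (TMove Stay)
    (TSeq (tdrop r) (TSeq tF (to_top r))) (TSeq (tdrop r) (TSeq tT (to_top r)))))
    (pos r (size l), f) (op_cost S * size l + size l * n + 1) (pos r 0, f').
  move=> f Hf; have [f' Hf' Ef] := W f Hf; exists f' => //.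
  have T := to_top_exec Hf leK; rewrite upd_eq in T.
  apply: texec_le (texec_seq T (texec_seq Ef (to_home_exec _ leK))) _.
  rewrite /op_cost; nia.
elim: l s f leS Hb Hc => [|b l IHl] s f leS Hb Hc Hf.
  exists f; first by move: Hc => /= ->.
  by apply: texec_le (texec_while_stop _ _) _; rewrite ?Hf ?upd_eq //; lia.
case: Hc => s1 H1 Hc.
have [|f1 Hf1 E1] := @tdrop_exec (upd s r (b :: l)) f r b l Hf leK; first by rewrite upd_eq.
rewrite upd_upd in Hf1; rewrite upd_eq in E1.
have [f2 Hf2 E2] := Hb b s s1 l H1 (leqnSn _) f1 Hf1.
have [|f' Hf' E'] := IHl s1 f2 (ltnW leS) _ Hc Hf2.
  by move=> b' s2 s3 l' Hst le; apply: Hb => //; apply: leqW.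
exists f' => //.
have T := to_top_exec Hf2 leK; rewrite upd_eq in T.
have Fb : f (pos r (size (b :: l))) = Some b by rewrite Hf // upd_eq lev_cons eqxx.
have X : texec (TIf (TMove Stay) (TSeq (tdrop r) (TSeq tF (to_top r)))
   (TSeq (tdrop r) (TSeq tT (to_top r)))) (pos r (size (b :: l)), f)
   ((2 * K + 5) * (size l + 4) + (n + (2 * K + 5) * (size l + 4)).+1).+2
   (pos r (size l), f2).
  apply: texec_if; rewrite Fb.
  by case: b E1 E2 {Fb Hf H1 Hb IHl leS} => E1 E2; apply: texec_seq E1 (texec_seq E2 T).
apply: texec_le (texec_while_step _ X E') _; first by rewrite Fb.
move: leS; rewrite /op_cost /=; nia.
Qed.

Variable R : nat.

Definition tmp := R.+1.
Definition hidden d := (R.+2 + d)%N.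

(* The loop counter of a [For] at nesting depth d is kept in a copy, [hidden d],
   of the register it ranges over; [tmp] is only used for making the copy. *)
Fixpoint comp (d : nat) (p : prog) : tprog :=
  match p with
  | Skip => TMove Stay
  | Push r b => tpush r b
  | Case r pE pF pT => tcase r (comp d pE) (comp d pF) (comp d pT)
  | Seq p1 p2 => TSeq (comp d p1) (comp d p2)
  | For r pF pT =>
      TSeq (tloop r (tpush tmp false) (tpush tmp true))
     (TSeq (tloop tmp (TSeq (tpush r false) (tpush (hidden d) false))
                      (TSeq (tpush r true) (tpush (hidden d) true)))
           (tloop (hidden d) (comp d.+1 pF) (comp d.+1 pT)))
  end.

Definition sizes (s : regs) (m : nat) : Prop := forall r, size (s r) <= m.

Lemma sizes_upd s m r l : sizes s m -> size l <= m -> sizes (upd s r l) m.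
Proof. by move=> Hs le i; rewrite /upd; case: eqP. Qed.

Lemma sizes_le s m m' : sizes s m -> m <= m' -> sizes s m'.
Proof. by move=> H le r; apply: leq_trans (H r) le. Qed.

Lemma exec_sizes B p s s' m : exec B p s s' -> sizes s m -> sizes s' (m + ops p B).
Proof.
elim: p s s' m => [|r b|r pE IHE pF IHF pT IHT|p IHp q IHq|r pF IHF pT IHT] s s' m /=.
- by move=> -> /sizes_le; apply; lia.
- move=> -> H; apply: sizes_upd; first by apply: sizes_le H _; lia.
  by rewrite /= addn1 ltnS.
- case E: (s r) => [|b l] H Hs.
    by apply: sizes_le (IHE _ _ _ H Hs) _; lia.
  have {}Hs : sizes (upd s r l) m.
    by apply: sizes_upd => //; have := Hs r; rewrite E => /ltnW.
  case: b H {E} => H; first by apply: sizes_le (IHT _ _ _ H Hs) _; lia.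
  by apply: sizes_le (IHF _ _ _ H Hs) _; lia.
- case=> s1 H1 H2 Hs.
  by apply: sizes_le (IHq _ _ _ H2 (IHp _ _ _ H1 Hs)) _; lia.
- case=> le Hc Hs.
  have : sizes s' (m + size (s r) * (ops pF B + ops pT B)).
    move: (s r) Hs Hc {le} => l1; elim: l1 s m => [|b l IHl] s m Hs /=; first by move=> ->; rewrite addn0.
    case=> s1 H1 Hc.
    have {}H1 : sizes s1 (m + (ops pF B + ops pT B)).
      case: b H1 => [/IHT|/IHF] /(_ m Hs) H; apply: sizes_le H _; lia.
    by apply: sizes_le (IHl _ _ H1 Hc) _; lia.
  move/sizes_le; apply; nia.
Qed.

Lemma chain_push_copy l s r r' S : r != r' ->
  size l + size (s r) <= S -> size l + size (s r') <= S ->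
  chain (fun b s1 s2 => [/\ size (s1 r) < S, size (s1 r') < S &
           s2 = upd (upd s1 r (b :: s1 r)) r' (b :: s1 r')]) l s
    (upd (upd s r (rev l ++ s r)) r' (rev l ++ s r')).
Proof.
move=> ne; elim: l s => [|b l IHl] s /= leS leS'; first by rewrite !upd_id.
eexists; first by split; [lia | lia | reflexivity].
set s1 := upd _ r' _; have := IHl s1.
have -> : s1 r = b :: s r by rewrite /s1 upd_neq // upd_eq.
have -> : s1 r' = b :: s r' by rewrite /s1 upd_eq.
suff -> : forall a a', upd (upd s1 r a) r' a' = upd (upd s r a) r' a'.
  by rewrite !rev_cons !cat_rcons; apply; rewrite /=; lia.
by move=> a a'; rewrite /s1 [upd (upd (upd _ _ _) _ _) r _]updC 1?eq_sym // !upd_upd.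
Qed.

Lemma chain_push l s r S : size l + size (s r) <= S ->
  chain (fun b s1 s2 => size (s1 r) < S /\ s2 = upd s1 r (b :: s1 r)) l s
    (upd s r (rev l ++ s r)).
Proof.
elim: l s => [|b l IHl] s /= leS; first by rewrite upd_id.
eexists; first by split; [lia | reflexivity].
have := IHl (upd s r (b :: s r)).
by rewrite upd_eq upd_upd rev_cons cat_rcons; apply; rewrite /=; lia.
Qed.

(** Each step of the chain is decorated with what the induction of [comp_sim] needs at intermediate
    states: a size budget that still suffices for one body, and empty scratch registers. *)
Lemma chain_exec_inv B pF pT d l s s' m S :
  max_reg pF <= R -> max_reg pT <= R ->
  chain (fun b => if b then exec B pT else exec B pF) l s s' ->
  sizes s m -> m + size l * (ops pF B + ops pT B) <= S ->
  s tmp = [::] -> (forall i, d <= i -> s (hidden i) = [::]) ->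
  [/\ chain (fun b s1 s2 => [/\ exec B (if b then pT else pF) s1 s2,
         exists m1, [/\ m <= m1, sizes s1 m1 & m1 + (ops pF B + ops pT B) <= S],
         s1 tmp = [::] & forall i, d <= i -> s1 (hidden i) = [::]]) l s s',
      s' tmp = [::] & forall i, d <= i -> s' (hidden i) = [::]].
Proof.
move=> leF leT Hc Hs leS Ht Hh.
have fr i b s1 s2 : R < i ->
    (if b then exec B pT else exec B pF) s1 s2 -> s2 i = s1 i.
  move=> lt; have ltF := leq_ltn_trans leF lt; have ltT := leq_ltn_trans leT lt.
  by case: b => H; [have [-> _] := exec_frame [::] ltT H | have [-> _] := exec_frame [::] ltF H].
suff : forall k, m <= k -> sizes s k -> k + size l * (ops pF B + ops pT B) <= S ->
  [/\ chain (fun b s1 s2 => [/\ exec B (if b then pT else pF) s1 s2,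
         exists m1, [/\ m <= m1, sizes s1 m1 & m1 + (ops pF B + ops pT B) <= S],
         s1 tmp = [::] & forall i, d <= i -> s1 (hidden i) = [::]]) l s s',
      s' tmp = [::] & forall i, d <= i -> s' (hidden i) = [::]].
  by move=> H; apply: (H m).
elim: l s Hc Ht Hh {Hs leS} => [|b l IHl] s /=; first by move=> ->.
case=> s1 H1 Hc Ht Hh k lek Hs leS.
have [|||||Hc' Ht' Hh'] := IHl s1 Hc _ _ (k + (ops pF B + ops pT B)).
- by rewrite -Ht; apply: fr H1; rewrite /tmp.
- by move=> i le; rewrite -(Hh i le); apply: fr H1; rewrite /hidden; lia.
- lia.
- by case: b H1 => /exec_sizes /(_ Hs) H1; apply: sizes_le H1 _; lia.
- lia.
split=> //; exists s1 => //; split=> //; first by case: b H1.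
exists k; split=> //; lia.
Qed.

Lemma op_cost_gt0 S : 0 < op_cost S.
Proof. by rewrite /op_cost; lia. Qed.

Lemma comp_sim B p d s s' m S :
  max_reg p <= R -> R.+1 + d + nesting p <= K -> exec B p s s' ->
  sizes s m -> m + ops p B <= S ->
  s tmp = [::] -> (forall i, d <= i -> s (hidden i) = [::]) ->
  sim (comp d p) s s' (ops p B * op_cost S).
Proof.
have X0 := op_cost_gt0 S; have X40 : 40 <= op_cost S by rewrite /op_cost; nia.
elim: p d s s' m => [|r b|r pE IHE pF IHF pT IHT|p IHp q IHq|r pF IHF pT IHT]
  d s s' m /= leR leK.
- by move=> -> _ _ _ _; apply: sim_le (@sim_skip _) _; rewrite mul1n.
- move=> -> Hs leS _ _; rewrite mul1n; apply: sim_push; first lia.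
  by have := Hs r; lia.
- move: leR leK; rewrite !geq_max => /and4P[ler leE leF leT] leK.
  have [leKE leKF leKT] : [/\ R.+1 + d + nesting pE <= K, R.+1 + d + nesting pF <= K &
    R.+1 + d + nesting pT <= K] by split; lia.
  case E: (s r) => [|b l] H Hs leS Ht Hh.
    apply: sim_le (sim_case_nil _ _ S _ E (IHE d s s' m _ _ H Hs _ Ht Hh)) _ => //; try lia.
  have ltl : size l < m by have := Hs r; rewrite E.
  have Hs' : sizes (upd s r l) m by apply: sizes_upd => //; apply: ltnW.
  have Ht' : upd s r l tmp = [::] by rewrite upd_neq // /tmp; lia.
  have Hh' i : d <= i -> upd s r l (hidden i) = [::].
    by move=> le; rewrite upd_neq ?Hh // /hidden; lia.
  have ler' : r <= K by lia.
  have ltS : size l < S by lia.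
  have Hb : sim (if b then comp d pT else comp d pF) (upd s r l) s'
     ((ops pF B + ops pT B) * op_cost S).
    case: b H {E} => H.
      by apply: sim_le (IHT d _ s' m _ _ H Hs' _ Ht' Hh') _ => //; [lia | rewrite leq_mul //; lia].
    by apply: sim_le (IHF d _ s' m _ _ H Hs' _ Ht' Hh') _ => //; [lia | rewrite leq_mul //; lia].
  apply: sim_le (@sim_case_cons _ _ _ (comp d pE) _ _ _ _ _ _ ler' E ltS Hb) _.
  by rewrite -mulSn leq_mul //; lia.
- move: leR leK; rewrite !geq_max => /andP[lep leq] leK [s1 H1 H2] Hs leS Ht Hh.
  have fr i : R < i -> s1 i = s i.
    by move=> lt; have [-> _] := exec_frame [::] (leq_ltn_trans lep lt) H1.
  have S1 : sim (comp d p) s s1 (ops p B * op_cost S).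
    by apply: (IHp d s s1 m) => //; lia.
  have S2 : sim (comp d q) s1 s' (ops q B * op_cost S).
    apply: (IHq d s1 s' (m + ops p B)) => //; try lia.
    - exact: exec_sizes H1 Hs.
    - by rewrite fr.
    - by move=> i le; rewrite fr ?Hh // /hidden; lia.
  by apply: sim_le (sim_seq S1 S2) _; rewrite mulSn mulnDl; lia.
move: leR leK; rewrite !geq_max => /and3P[ler leF leT] leK [leB Hc] Hs leS Ht Hh.
set l := s r in leB Hc.
have lem : size l <= m by apply: Hs.
have ler' : r <= K by lia.
have tmpK : tmp <= K by rewrite /tmp; lia.
have hidK : hidden d <= K by rewrite /hidden; lia.
have rh : r != hidden d by rewrite /hidden; lia.
have th : tmp != hidden d by rewrite /hidden /tmp; lia.
have rt : r != tmp by rewrite /tmp; lia.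
have lS : size l < S by lia.
(* Emptying [r] into [tmp] reverses the list and emptying [tmp] reverses it back, so [r] is restored
   and the counter presents the bits in the order of [chain]. *)
have L1 : sim (tloop r (tpush tmp false) (tpush tmp true)) s
    (upd (upd s r [::]) tmp (rev l)) (op_cost S * (size l).+1 + size l * op_cost S).
  have Hc1 := @chain_push l s tmp S; rewrite Ht addn0 cats0 in Hc1.
  rewrite -{1}(upd_id s r) updC //.
  apply: sim_loop (Hc1 (ltnW lS)) => //; first exact: ltnW.
  move=> b s1 s2 l' [lt ->] _.
  have lt' : size (upd s1 r l' tmp) < S by rewrite upd_neq // eq_sym.
  have := @sim_push (upd s1 r l') tmp b S tmpK lt'.
  by rewrite [upd s1 r l' tmp]upd_neq 1?eq_sym // updC //; case: b.
have L2 : sim (tloop tmp (TSeq (tpush r false) (tpush (hidden d) false))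
                      (TSeq (tpush r true) (tpush (hidden d) true)))
    (upd (upd s r [::]) tmp (rev l)) (upd s (hidden d) l)
    (op_cost S * (size l).+1 + size l * (2 * op_cost S).+1).
  have Hc2 := @chain_push_copy (rev l) (upd s r [::]) r (hidden d) S rh.
  rewrite upd_eq [upd s r _ _]upd_neq 1?eq_sym // Hh // !cats0 revK upd_upd size_rev in Hc2.
  rewrite upd_id !addn0 in Hc2.
  have -> : upd s (hidden d) l = upd (upd s (hidden d) l) tmp [::].
    have Eh : upd s (hidden d) l tmp = [::] by rewrite upd_neq.
    by rewrite -[in RHS]Eh upd_id.
  rewrite -(size_rev l).
  apply: sim_loop (Hc2 (ltnW lS) (ltnW lS)) => //; first by rewrite size_rev ltnW.
  move=> b s1 s2 l' [lt1 lt2 ->] _.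
  have lt1' : size (upd s1 tmp l' r) < S by rewrite upd_neq.
  have P1 := @sim_push (upd s1 tmp l') r b S ler' lt1'.
  set s3 := upd _ r _ in P1.
  have E3 : s3 (hidden d) = s1 (hidden d).
    by rewrite /s3 !upd_neq // 1?eq_sym.
  have lt2' : size (s3 (hidden d)) < S by rewrite E3.
  have P2 := @sim_push s3 (hidden d) b S hidK lt2'.
  have -> : upd (upd (upd s1 r (b :: s1 r)) (hidden d) (b :: s1 (hidden d))) tmp l' =
     upd s3 (hidden d) (b :: s3 (hidden d)).
    rewrite E3 /s3 [upd s1 tmp l' r]upd_neq //; apply/funext => i; rewrite /upd.
    by case: (eqVneq i tmp) => // ->; rewrite (negPf th) eq_sym (negPf rt).
  have PP := sim_seq P1 P2; apply: sim_le (_ : sim _ _ _ (op_cost S + op_cost S).+1) _.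
    by case: b @s3 PP {P1 P2 E3 lt1' lt2'}.
  lia.
have leS' : m + size l * (ops pF B + ops pT B) <= S by nia.
have [Hc3 Ht' Hh'] := chain_exec_inv leF leT Hc Hs leS' Ht Hh.
have L3 : sim (tloop (hidden d) (comp d.+1 pF) (comp d.+1 pT)) (upd s (hidden d) l) s'
    (op_cost S * (size l).+1 + size l * ((ops pF B + ops pT B) * op_cost S)).
  have -> : s' = upd s' (hidden d) [::] by rewrite -(Hh' d) // upd_id.
  apply: sim_loop Hc3 => //; first exact: ltnW.
  move=> b s1 s2 l' [H1 [m1 [lem1 Hm1 leS1]] Ht1 Hh1] lel.
  have Hu : sizes (upd s1 (hidden d) l') m1 by apply: sizes_upd => //; lia.
  have Htu : upd s1 (hidden d) l' tmp = [::] by rewrite upd_neq.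
  have Hhu i : d < i -> upd s1 (hidden d) l' (hidden i) = [::].
    by move=> lt; rewrite upd_neq ?Hh1 ?(ltnW lt) // /hidden; lia.
  (* [exec_frame] applies at [hidden d]: the body can run while the rest of the loop is stored
     there. *)
  have lt : R < hidden d by rewrite /hidden; lia.
  case: b H1 => H1.
    have [_ H1'] := exec_frame l' (leq_ltn_trans leT lt) H1.
    by apply: sim_le (IHT d.+1 _ _ m1 _ _ H1' Hu _ Htu Hhu) _ => //; [lia|lia|rewrite leq_mul //; lia].
  have [_ H1'] := exec_frame l' (leq_ltn_trans leF lt) H1.
  by apply: sim_le (IHF d.+1 _ _ m1 _ _ H1' Hu _ Htu Hhu) _ => //; [lia|lia|rewrite leq_mul //; lia].
apply: sim_le (sim_seq L1 (sim_seq L2 L3)) _.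
move: (op_cost S) (ops pF B + ops pT B) X40 (size l) leB => X c X40' n leB; clear -X40' leB.
have h1 : n * (c * X) <= B * (c * X) by rewrite leq_mul.
have h2 : n * X <= B * X by rewrite leq_mul.
have h3 : n <= n * X by rewrite leq_pmulr //; lia.
lia.
Qed.

End Layout.

(** The bottom of register 0 is at cell 0. With [rev], the initial tape of the machine is already a
    legal layout and the final layout is already an output. *)
Definition input_regs (x : seq bool) : regs := upd (fun=> [::]) 0 (rev x).

Theorem reg_program_poly_time (p : prog) (f : seq bool -> seq bool) (Bf : nat -> nat) :
  poly_bounded Bf ->
  (forall x, exists2 s, exec (Bf (size x)) p (input_regs x) s & s 0 = rev (f x)) ->
  poly_time_computable f.
Proof.
move=> HB Hf; pose R := max_reg p; pose K := R.+1 + nesting p.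
(* The head starts, and has to end, on cell 0, the right neighbour of [home]. *)
pose t := TSeq (TMove MoveL) (TSeq (comp K R 0 p) (TMove MoveR)).
pose T n := ops p (Bf n) * op_cost K (n + ops p (Bf n)) + 4.
have [k Hk] : exists k, forall n, T n <= k * n ^ k + k.
  apply: poly_boundedP.
  have Ho := ops_poly p HB.
  apply: poly_boundedD (poly_bounded_const _); apply: poly_boundedM => //.
  rewrite /op_cost; apply: poly_boundedM (poly_bounded_const _) _.
  apply: poly_boundedD (poly_bounded_const _).
  apply: poly_boundedM (poly_bounded_const _) _.
  exact: poly_boundedD poly_bounded_id Ho.
exists (tm_of t), k => x; have [s Hs Es] := Hf x.
have Hin := represents_init (tm_of t) x.
set f0 := fun z : int => _ in Hin.
have R0 : Rep K (input_regs x) f0.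
  move=> [|r] leK j.
    rewrite /input_regs upd_eq; case: j => [|j] //.
    have -> : pos K 0 j.+1 = Posz j by rewrite /pos; lia.
    by rewrite /f0 /lev revK.
  by rewrite /input_regs upd_neq // /f0 /pos -NegzE; case: j => [|j] //=; rewrite nth_nil.
have Hsz : sizes (input_regs x) (size x).
  by move=> r; rewrite /input_regs /upd; case: eqP; rewrite ?size_rev.
have [|||f1 R1 E1] := @comp_sim K R (Bf (size x)) p 0 _ s (size x) _ (leqnn _) _ Hs Hsz (leqnn _) _ _ f0 R0.
- by rewrite /K addn0.
- by rewrite /input_regs upd_neq.
- by [].
have [n len Hn] := tm_of_exec Hin (texec_seq (texec_move MoveL 0%R f0)
  (texec_seq E1 (texec_move MoveR home f1))).
exists n; split.
  by apply: leq_trans len (leq_trans _ (Hk _)); rewrite /T; lia.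
split; first by case: Hn.
apply: represents_output Hn _ => n' _.
have := R1 0 isT n'.+1; rewrite Es /= revK => <-.
by congr f1; rewrite /home /=; lia.
Qed.

(** * Programs that print *)

(* Register 0 is the output, written with its end on top. *)
Definition emits (B : nat) (p : prog) (s : regs) (w : seq bool) (s' : regs) : Prop :=
  forall o, exec B p (upd s 0 o) (upd s' 0 (rev w ++ o)).

Definition seqs (ps : seq prog) : prog := foldr Seq Skip ps.
Definition outs (w : seq bool) : prog := seqs [seq Push 0 b | b <- w].
Definition Repeat r p := For r p p.

Section Emits.
Variable B : nat.
Implicit Types (p : prog) (s : regs).

Lemma emits_skip s : emits B Skip s [::] s.
Proof. by move=> o. Qed.

Lemma emits_seq p q s w s1 w' s' :
  emits B p s w s1 -> emits B q s1 w' s' -> emits B (Seq p q) s (w ++ w') s'.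
Proof. by move=> H H' o; exists (upd s1 0 (rev w ++ o)) => //; rewrite rev_cat -catA. Qed.

Lemma emits_push r b s : r != 0 -> emits B (Push r b) s [::] (upd s r (b :: s r)).
Proof. by move=> r0 o /=; rewrite [upd s 0 o r]upd_neq // updC // eq_sym. Qed.

Lemma emits_outs w s : emits B (outs w) s w s.
Proof.
elim: w => [|b w IHw]; first exact: emits_skip.
rewrite -cat1s; apply: emits_seq IHw => o.
by rewrite /= upd_upd upd_eq.
Qed.

Lemma emits_seqs (T : eqType) (l : seq T) (p : T -> prog) w s :
  (forall a, a \in l -> emits B (p a) s (w a) s) ->
  emits B (seqs [seq p a | a <- l]) s (flatten [seq w a | a <- l]) s.
Proof.
elim: l => [|a l IHl] H; first exact: emits_skip.
apply: (@emits_seq _ _ _ _ s); first by apply: H; rewrite inE eqxx.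
by apply: IHl => a' a'l; apply: H; rewrite inE a'l orbT.
Qed.

Lemma emits_for_state r pF pT (st : nat -> regs) w :
  r != 0 -> size (st 0 r) <= B ->
  (forall k, k < size (st 0 r) ->
     emits B (if nth false (st 0 r) k then pT else pF) (st k) (w k) (st k.+1)) ->
  emits B (For r pF pT) (st 0) (flatten [seq w k | k <- iota 0 (size (st 0 r))])
    (st (size (st 0 r))).
Proof.
move=> r0 leB H o; split; first by rewrite upd_neq.
rewrite [upd (st 0) 0 o r]upd_neq //.
move: (st 0 r) {leB} H => l H.
suff G : forall k, (forall i, i < size l ->
      emits B (if nth false l i then pT else pF) (st (k + i)) (w (k + i)) (st (k + i).+1)) ->
    chain (fun b => if b then exec B pT else exec B pF) l (upd (st k) 0 o)
      (upd (st (k + size l)) 0 (rev (flatten [seq w k | k <- iota k (size l)]) ++ o)).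
  exact: (G 0).
elim: l {H} o => [|b l IHl] o k H /=; first by rewrite addn0.
exists (upd (st k.+1) 0 (rev (w k) ++ o)).
  by have := H 0 isT o; rewrite /= addn0; case: b {H}.
rewrite -addSnnS rev_cat -catA; apply: IHl => i lt.
by rewrite addSnnS; apply: (H i.+1).
Qed.

Lemma emits_for r pF pT s wF wT : r != 0 -> size (s r) <= B ->
  emits B pF s wF s -> emits B pT s wT s ->
  emits B (For r pF pT) s (flatten [seq if b then wT else wF | b <- s r]) s.
Proof.
move=> r0 leB HF HT.
have -> : [seq if b then wT else wF | b <- s r] =
    [seq if nth false (s r) k then wT else wF | k <- iota 0 (size (s r))].
  by rewrite -{1}(mkseq_nth false (s r)) /mkseq -map_comp.
have := @emits_for_state r pF pT (fun=> s)
  (fun k => if nth false (s r) k then wT else wF) r0 leB.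
by apply=> k _; case: (nth _ _ _).
Qed.

Lemma emits_repeat r p s w : r != 0 -> size (s r) <= B -> emits B p s w s ->
  emits B (Repeat r p) s (flatten (nseq (size (s r)) w)) s.
Proof.
move=> r0 leB H; have := emits_for r0 leB H H.
by rewrite (_ : map _ _ = nseq (size (s r)) w) //; elim: (s r) => //= b l ->; case: b.
Qed.

(** * Unary counters *)

Definition adds p (d c : nat) s : Prop := forall m,
  emits B p (upd s d (nseq m true)) [::] (upd s d (nseq (m + c) true)).

Lemma adds_push d s : d != 0 -> adds (Push d true) d 1 s.
Proof.
move=> d0 m; have := @emits_push d true (upd s d (nseq m true)) d0.
by rewrite upd_eq upd_upd addn1.
Qed.

Lemma adds_skip d s : adds Skip d 0 s.
Proof. by move=> m; rewrite addn0; apply: emits_skip. Qed.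

Lemma adds_seq p q d c c' s : adds p d c s -> adds q d c' s -> adds (Seq p q) d (c + c') s.
Proof. by move=> H H' m; rewrite -[[::]]cats0 addnA; apply: emits_seq (H _) (H' _). Qed.

Lemma adds_repeat r p d c s : r != 0 -> r != d -> size (s r) <= B ->
  adds p d c s -> adds (Repeat r p) d (size (s r) * c) s.
Proof.
move=> r0 rd leB H m.
have E : upd s d (nseq (m + 0 * c) true) r = s r by rewrite upd_neq.
have := @emits_for_state r p p (fun k => upd s d (nseq (m + k * c) true)) (fun=> [::]) r0.
rewrite E mul0n addn0 => /(_ leB).
have -> : flatten [seq [::] | _ <- iota 0 (size (s r))] = [::] :> seq bool.
  by elim: (iota _ _).
apply=> k _; rewrite if_same mulSnr addnA; exact: H.
Qed.

Lemma adds_iter n p d c s : adds p d c s -> adds (iter n (Seq p) Skip) d (n * c) s.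
Proof.
move=> H; elim: n => [|n IHn]; first exact: adds_skip.
by rewrite mulSn; apply: adds_seq.
Qed.

(** [k] nested loops around [k] pushes, then [k] more pushes: the shape [k * n ^ k + k] in which the
    complexity classes state their bounds. *)
Definition poly_add r k d : prog :=
  Seq (iter k (Repeat r) (iter k (Seq (Push d true)) Skip)) (iter k (Seq (Push d true)) Skip).

Lemma poly_add_adds r k d s : r != 0 -> d != 0 -> r != d -> size (s r) <= B ->
  adds (poly_add r k d) d (k * size (s r) ^ k + k) s.
Proof.
move=> r0 d0 rd leB; have Hk : adds (iter k (Seq (Push d true)) Skip) d k s.
  by rewrite -{2}(muln1 k); apply: adds_iter; apply: adds_push.
apply: adds_seq => //; elim: {1 4}k => [|j IHj]; first by rewrite muln1.
by rewrite iterS expnS mulnCA; apply: adds_repeat.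
Qed.

Lemma adds_emits p d c s : s d = [::] -> adds p d c s ->
  emits B p s [::] (upd s d (nseq c true)).
Proof. by move=> E /(_ 0); rewrite add0n -[nseq 0 true]/[::] -{1}E upd_id. Qed.

(** * Binary counters *)

Fixpoint binc (l : seq bool) : seq bool :=
  match l with
  | [::] => [:: true]
  | false :: l' => true :: l'
  | true :: l' => false :: binc l'
  end.

Definition rB := 1.
Definition rT := 2.
Definition rC := 3.

Definition clear r : prog := Repeat r (Case r Skip Skip Skip).

(* The carry is alive as long as [rC] is empty. *)
Definition inc : prog :=
  Seq (For rB
        (Case rC (Seq (Push rT true) (Push rC true))
           (Seq (Push rC true) (Push rT false)) (Seq (Push rC true) (Push rT false)))
        (Case rC (Push rT false)
           (Seq (Push rC true) (Push rT true)) (Seq (Push rC true) (Push rT true))))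
 (Seq (Case rC (Push rT true) Skip Skip)
 (Seq (clear rB)
 (Seq (For rT (Push rB false) (Push rB true)) (clear rT)))).

Lemma exec_clear r s : size (s r) <= B -> exec B (clear r) s (upd s r [::]).
Proof.
move=> leB; split=> //.
(* The list driving the loop may be replaced by any one at least as long, since [Case] does nothing
   on an empty register; this is what the induction needs. *)
have : size (s r) <= size (s r) by [].
move: {2 3}(s r) => l; elim: l s {leB} => [|b l IHl] s /=.
  by rewrite leqn0 => /nilP E; rewrite -E upd_id.
case E: (s r) => [|b' l'] /=.
  move=> _; exists s; first by case: b; rewrite E.
  by apply: IHl; rewrite E.
move=> le; exists (upd s r l'); first by case: b; rewrite E; case: b' {E}.
by have := IHl (upd s r l'); rewrite upd_upd upd_eq; apply.
Qed.

Lemma exec_move r r' s : r != r' -> size (s r) <= B ->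
  exec B (For r (Push r' false) (Push r' true)) s (upd s r' (rev (s r) ++ s r')).
Proof.
move=> ne leB; split=> //; have := @chain_push (s r) s r' _ (leqnn _).
by apply: chain_mono => b s1 s2 [_ ->]; case: b.
Qed.

(** Ripple-carry addition of [c], with the carry that is left over: unlike [binc] it visits all
    bits, as the first loop of [inc] does. *)
Fixpoint bincc (c : bool) (l : seq bool) : seq bool * bool :=
  if l is x :: l' then
    let: (o, c') := bincc (c && x) l' in (c (+) x :: o, c')
  else ([::], c).

Lemma bincE l : binc l = (bincc true l).1 ++ nseq (bincc true l).2 true.
Proof.
have F l' : bincc false l' = (l', false).
  by elim: l' => //= x l' ->.
elim: l => [|[] l IHl] //=; first by rewrite IHl; case: (bincc true l).
by rewrite F /= cats0.
Qed.

Lemma exec_inc s : s rT = [::] -> s rC = [::] -> size (s rB) < B ->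
  exec B inc s (upd s rB (binc (s rB))).
Proof.
move=> ET EC ltB; set l := s rB in ltB *.
(* The states inside the loops: [a] is the reversed output so far and [c] tells whether the carry is
   alive. *)
pose mk a c := upd (upd s rT a) rC (nseq (~~ c) true).
have mkC a c : mk a c rC = nseq (~~ c) true by rewrite /mk upd_eq.
have mkT a c : mk a c rT = a by rewrite /mk upd_neq // upd_eq.
have mkB a c : mk a c rB = l by rewrite /mk !upd_neq.
have updT a c a' : upd (mk a c) rT a' = mk a' c.
  by rewrite /mk updC // upd_upd.
have updCc a c c' : upd (mk a c) rC (nseq (~~ c') true) = mk a c'.
  by rewrite /mk upd_upd.
have mk0 : mk [::] true = s.
  apply/funext => i; rewrite /mk /upd; case: eqP => [->|_]; first by rewrite EC.
  by case: eqP => // ->; rewrite ET.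
clearbody mk.
have L1 : exec B (For rB
        (Case rC (Seq (Push rT true) (Push rC true))
           (Seq (Push rC true) (Push rT false)) (Seq (Push rC true) (Push rT false)))
        (Case rC (Push rT false)
           (Seq (Push rC true) (Push rT true)) (Seq (Push rC true) (Push rT true))))
   s (mk (rev (bincc true l).1) (bincc true l).2).
  split; first exact: ltnW.
  set step := fun b : bool => _.
  suff G l' c a : chain step l' (mk a c) (mk (rev (bincc c l').1 ++ a) (bincc c l').2).
    by have := G l true [::]; rewrite mk0 cats0.
  elim: l' c a => [|x l' IHl] c a //.
  rewrite [bincc _ _]/=; case E: (bincc (c && x) l') => [o c'].
  exists (mk ((c (+) x) :: a) (c && x)); last first.
    by have := IHl (c && x) ((c (+) x) :: a); rewrite E /= rev_cons cat_rcons.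
  rewrite /step; case: c {E} => /=.
    case: x => /=; rewrite mkC /= ?mkT ?updT //.
    exists (mk (true :: a) true) => //.
    by rewrite mkC -(updCc _ true false).
  have H y : exec B (Seq (Push rC true) (Push rT y)) (upd (mk a false) rC [::])
     (mk (y :: a) false).
    rewrite (updCc _ _ true); exists (mk a false); first by rewrite /= mkC -(updCc _ true false).
    by rewrite /= mkT updT.
  by case: x; rewrite /= mkC /=; apply: H.
set r1 := (bincc true l).1 in L1; set c1 := (bincc true l).2 in L1.
have El : binc l = r1 ++ nseq c1 true by rewrite bincE.
exists (mk (rev r1) c1) => //; exists (mk (rev (binc l)) true).
  rewrite /= mkC El; case: c1 {L1 El} => /=; first by rewrite mkT updT rev_cat.
  by rewrite (updCc _ _ true) cats0.
exists (upd (mk (rev (binc l)) true) rB [::]).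
  by apply: exec_clear; rewrite mkB ltnW.
have szB : size (binc l) <= B.
  apply: leq_trans ltB; rewrite El size_cat.
  have -> : size r1 = size l.
    by rewrite /r1; elim: (l) true => //= x l' IHl c; case: bincc (IHl (c && x)) => o c' /= ->.
  by case: c1 {L1 El}; rewrite /= ?addn1 ?addn0.
exists (upd (mk (rev (binc l)) true) rB (binc l)).
  have := @exec_move rT rB (upd (mk (rev (binc l)) true) rB [::]) isT.
  by rewrite !upd_eq upd_upd upd_neq // mkT size_rev revK cats0; apply.
have := @exec_clear rT (upd (mk (rev (binc l)) true) rB (binc l)).
rewrite upd_neq // mkT size_rev => /(_ szB).
by rewrite updC // updT mk0.
Qed.

Lemma emits_inc s : s rT = [::] -> s rC = [::] -> size (s rB) < B ->
  emits B inc s [::] (upd s rB (binc (s rB))).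
Proof.
move=> ET EC lt o; have := @exec_inc (upd s 0 o).
by rewrite !upd_neq // updC //; apply.
Qed.

Definition bits n := bits_of_nat_aux n n.

Lemma bits_fuel f n : n <= f -> bits_of_nat_aux f n = bits n.
Proof.
rewrite /bits.
suff H m f1 f2 : m <= f1 -> m <= f2 -> bits_of_nat_aux f1 m = bits_of_nat_aux f2 m.
  by move=> le; apply: H.
elim: f1 f2 m => [|f1 IHf] [|f2] m //=; try by rewrite leqn0 => /eqP ->.
  by move=> _; rewrite leqn0 => /eqP ->.
move=> le1 le2; case: eqP => // /eqP m0; congr cons; apply: IHf; lia.
Qed.

Lemma bitsE n : 0 < n -> bits n = odd n :: bits n./2.
Proof. by case: n => // n _; rewrite /bits [LHS]/= bits_fuel //; lia. Qed.

Lemma bitsS n : bits n.+1 = binc (bits n).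
Proof.
elim/ltn_ind: n => n IHn; rewrite bitsE //.
case: n IHn => [|n] IHn //; rewrite [in RHS]bitsE //= negbK.
rewrite uphalf_half; case E: (odd n) => //=.
by rewrite -IHn //; lia.
Qed.

Lemma size_bits n : size (bits n) <= n.
Proof.
elim/ltn_ind: n => -[|n] IHn //.
rewrite bitsE // -[size _]/(size (bits n.+1./2)).+1.
by have := IHn n.+1./2; lia.
Qed.

Definition clean s := [/\ s rB = [::], s rT = [::] & s rC = [::]].

(** All numbers of the instance are linear in unary registers with constant coefficients; a
    coefficient is expressed by repeating the register in [rs]. *)
Definition num c rs : prog :=
  Seq (iter c (Seq inc) Skip)
 (Seq (seqs [seq Repeat r inc | r <- rs])
 (Seq (For rB (outs [:: true; false]) (outs [:: true; true]))
 (Seq (outs [:: false]) (clear rB)))).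

Lemma emits_num c rs s : clean s -> all (fun r => rC < r) rs ->
  c + sumn [seq size (s r) | r <- rs] <= B ->
  emits B (num c rs) s (enc_nat (c + sumn [seq size (s r) | r <- rs])) s.
Proof.
case=> EB ET EC Hrs leB.
pose st v := upd s rB (bits v).
have stE v r : r != rB -> st v r = s r by move=> ne; rewrite /st upd_neq.
have Hinc v : v < B -> emits B inc (st v) [::] (st v.+1).
  move=> lt; have := @emits_inc (st v); rewrite (stE _ rT) // (stE _ rC) // ET EC.
  rewrite /st upd_eq upd_upd -bitsS.
  by apply=> //; apply: leq_ltn_trans (size_bits _) lt.
have st0 : s = st 0 by rewrite /st -[bits 0]/[::] -EB upd_id.
have H1 : emits B (iter c (Seq inc) Skip) s [::] (st c).
  suff G k v : v + k <= B -> emits B (iter k (Seq inc) Skip) (st v) [::] (st (v + k)).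
    by rewrite {1}st0; apply: (G c 0); lia.
  elim: k v => [|k IHk] v le; first by rewrite addn0; apply: emits_skip.
  rewrite -[[::]]cats0; apply: emits_seq; first by apply: Hinc; lia.
  by rewrite -addSnnS; apply: IHk; lia.
set v := c + _ in leB *.
have H2 : emits B (seqs [seq Repeat r inc | r <- rs]) (st c) [::] (st v).
  rewrite /v in leB *; elim: rs c Hrs leB {H1 v} => [|r rs IHr] c /=.
    by rewrite addn0 => *; apply: emits_skip.
  case/andP=> rr Hrs leB; rewrite -[[::]]cats0 addnA.
  apply: emits_seq (IHr (c + size (s r)) Hrs _); last by rewrite -addnA.
  have Er k : st (c + k) r = s r by rewrite stE //; move: rr; rewrite /rC /rB; lia.
  have := @emits_for_state r inc inc (fun k => st (c + k)) (fun=> [::]).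
  rewrite Er addn0; have -> : flatten [seq [::] | _ <- iota 0 (size (s r))] = [::] :> seq bool.
    by elim: (iota _ _).
  apply=> [||k lt]; [by move: rr; rewrite /rC; lia | lia |].
  by rewrite if_same addnS; apply: Hinc; lia.
rewrite -[enc_nat v]cat0s -[X in _ ++ X]cat0s.
apply: emits_seq H1 (emits_seq H2 _).
have sz : size (st v rB) <= B by rewrite /st upd_eq; apply: leq_trans (size_bits v) leB.
have := emits_for (r := rB) isT sz (emits_outs [:: true; false] _) (emits_outs [:: true; true] _).
rewrite {2}/st upd_eq /enc_nat.
have -> : [seq if b then [:: true; true] else [:: true; false] | b <- bits v] =
   [seq [:: true; b] | b <- bits v] by apply: eq_map => -[].
move=> H3; apply: emits_seq H3 _; rewrite -[[:: false]]cats0.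
apply: emits_seq (emits_outs _ _) _ => o.
have := @exec_clear rB (upd (st v) 0 o); rewrite upd_neq // => /(_ sz).
have E : upd (st v) rB [::] = s by rewrite /st upd_upd -EB upd_id.
by rewrite [upd (upd _ 0 _) rB _]updC // E.
Qed.

End Emits.

(** * Mean payoffs of 0/1 rewards *)

Lemma sum1_ord n : \sum_(k < n) 1 = n.
Proof. by rewrite sum1_card card_ord. Qed.

Section ZeroOne.
Local Notation R := Rdefinitions.R.
Variables (b : nat -> bool) (u : nat -> rat).
Hypothesis uE : forall k, u k = ((b k)%:R)%R.

Definition mean_inf (u : nat -> rat) : \bar R :=
  limn_einf (fun n : nat => (((n%:R : R)^-1) * \sum_(k < n) ratr (u k))%R%:E).

Local Notation cnt n := (\sum_(k < n) b k).

Lemma sum_ratr_bool n : (\sum_(k < n) ratr (u k) = (cnt n)%:R :> R)%R.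
Proof. by rewrite natr_sum; apply: eq_bigr => k _; rewrite uE ratr_nat. Qed.

Lemma cnt_le n : cnt n <= n.
Proof.
rewrite -[X in _ <= X]sum1_ord; apply: leq_sum => k _; exact: leq_b1.
Qed.

Lemma mean_infE : mean_inf u =
  ereal_sup (range (einfs (fun n : nat => (((n%:R : R)^-1) * (cnt n)%:R)%R%:E))).
Proof.
rewrite /mean_inf limn_einf_lim; apply/cvg_lim => //.
rewrite (_ : (fun n : nat => _) = (fun n : nat => (((n%:R : R)^-1) * (cnt n)%:R)%R%:E)).
  exact: cvg_einfs_sup.
by apply/funext => n; rewrite sum_ratr_bool.
Qed.

Lemma mean_inf_le1 : (mean_inf u <= 1)%E.
Proof.
rewrite mean_infE; apply/ereal_supP => _ [n _ <-].
apply: ge_ereal_inf; eexists; first by exists n => //=.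
rewrite lee_fin; case: n => [|n]; first by rewrite big_ord0 mulr0.
by rewrite ler_pdivrMl ?ltr0n // mulr1 ler_nat cnt_le.
Qed.

Lemma mean_inf_ge0 : (0 <= mean_inf u)%E.
Proof.
rewrite mean_infE; apply: le_ereal_sup_tmp; eexists; first by exists 0.
apply/ereal_infP => _ [n _ <-]; rewrite lee_fin mulr_ge0 ?invr_ge0 ?ler0n //.
Qed.

Lemma mean_inf_all : (forall k, b k) -> (1 <= mean_inf u)%E.
Proof.
move=> H; rewrite mean_infE; apply: le_ereal_sup_tmp; eexists; first by exists 1.
apply/ereal_infP => _ [n n1 <-]; rewrite lee_fin.
have -> : cnt n = n.
  rewrite -[RHS]sum1_ord; apply: eq_bigr => k _; by rewrite H.
by rewrite mulVf // pnatr_eq0; case: n n1.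
Qed.

(* The density of the zero rewards is 0, stated in natural numbers. *)
Definition sparse (bad : nat -> bool) : Prop :=
  forall q, exists n0, forall n, n0 <= n -> q * (\sum_(k < n) bad k) <= n.

(** A lower limit of at least 1 exceeds [1 - 1 / q.+1], so on a tail of the means the zeros make up
    less than the fraction [1 / q.+1]. *)
Lemma mean_inf_sparse : (1 <= mean_inf u)%E -> sparse (fun k => ~~ b k).
Proof.
rewrite mean_infE => H q.
case: q => [|q]; first by exists 0 => n _; rewrite mul0n.
have : ((1 - q.+1%:R^-1)%R%:E < ereal_sup (range (einfs (fun n : nat => (((n%:R : R)^-1) * (cnt n)%:R)%R%:E))))%E.
  by apply: lt_le_trans H; rewrite lte_fin ltrBlDr ltrDl invr_gt0 ltr0n.
case/ereal_sup_gt => _ [n0 _ <-] lt; exists n0.+1 => n ltn.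
have {}lt : ((1 - q.+1%:R^-1)%R%:E < ((n%:R : R)^-1 * (cnt n)%:R)%R%:E)%E.
  apply: lt_le_trans lt _; apply: ge_ereal_inf; eexists; first by exists n => //=; apply: ltnW.
  by [].
rewrite lte_fin in lt.
have E : \sum_(k < n) ~~ b k + cnt n = n.
  rewrite -[RHS]sum1_ord -big_split; apply: eq_bigr => k _ /=.
  by case: (b k).
have n1 : (0 < n%:R :> R)%R by rewrite ltr0n; case: n ltn {lt E}.
have q1 : (0 < q.+1%:R :> R)%R by rewrite ltr0n.
rewrite -(ler_nat R) natrM.
have {}E : ((\sum_(k < n) ~~ b k)%:R + (cnt n)%:R = n%:R :> R)%R by rewrite -natrD E.
set x := ((\sum_(k < n) ~~ b k)%:R)%R in E *; set y := ((cnt n)%:R)%R in E lt.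
have Ey : (n%:R^-1 * y = 1 - n%:R^-1 * x)%R.
  have -> : y = (n%:R - x)%R by rewrite -E addrAC subrr add0r.
  by rewrite mulrBr mulVf // gt_eqF.
move: lt; rewrite Ey ltrD2l ltrN2 ltr_pdivrMl // ltr_pdivlMr // mulrC.
exact: ltW.
Qed.

End ZeroOne.

(** The prefix adds at most [k0] bad times. Taking [2 * q] for the shifted sequence leaves half of
    [n] to pay for them once [n] exceeds [2 * q * k0]. *)
Lemma sparse_shift bad k0 : sparse (fun k => bad (k0 + k)) -> sparse bad.
Proof.
move=> H q; have [n0 Hn] := H (2 * q); exists (n0 + k0 + 2 * q * k0) => n le.
have le1 : n0 <= n by lia.
have := Hn n le1.
have : \sum_(k < n) bad k <= k0 + \sum_(k < n) bad (k0 + k).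
  have le2 : \sum_(k < n) bad k <= \sum_(k < k0 + n) bad k.
    by rewrite addnC big_split_ord /= leq_addr.
  apply: leq_trans le2 _; rewrite big_split_ord /= leq_add2r.
  by rewrite -[X in _ <= X]sum1_ord; apply: leq_sum => i _; apply: leq_b1.
nia.
Qed.

Lemma sparse_or a b : sparse a -> sparse b -> sparse (fun k => a k || b k).
Proof.
move=> Ha Hb q; have [n1 H1] := Ha (2 * q); have [n2 H2] := Hb (2 * q).
exists (n1 + n2) => n le; have := H1 n _; have := H2 n _.
have : \sum_(k < n) (a k || b k) <= \sum_(k < n) a k + \sum_(k < n) b k.
  by rewrite -big_split; apply: leq_sum => k _ /=; case: (a k); case: (b k).
move=> h1 h2 h3; have {}h2 := h2 ltac:(lia); have {}h3 := h3 ltac:(lia).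
nia.
Qed.

Lemma sparse_has (T : eqType) (l : seq T) (bad : T -> nat -> bool) :
  (forall i, i \in l -> sparse (bad i)) -> sparse (fun k => has (bad^~ k) l).
Proof.
elim: l => [|i l IHl] H.
  by move=> q; exists 0 => n _; rewrite big1 ?muln0.
apply: sparse_or; first by apply: H; rewrite inE eqxx.
by apply: IHl => j jl; apply: H; rewrite inE jl orbT.
Qed.

(** Otherwise each block of length [P] contains a bad time, which gives density at least [1 / P] and
    contradicts sparsity at [q = P.+1]. *)
Lemma sparse_gap bad P : sparse bad -> exists m, forall t, t < P -> ~~ bad (m * P + t).
Proof.
move=> Hs; apply: contrapT => /forallNP Hm.
have [n0 Hn] := Hs P.+1.
have C M : M <= \sum_(k < M * P) bad k.
  elim: M => [|M IHM] //.
  rewrite mulSnr big_split_ord /= -addn1; apply: leq_add => //.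
  have /existsNP[t /not_implyP[lt /negP]] := Hm M; rewrite negbK => Ht.
  by rewrite (bigD1 (Ordinal lt)) //= Ht.
have P0 : 0 < P.
  by case: (posnP P) => // E; case: (Hm 0) => t; rewrite E.
have := Hn (n0.+1 * P); have := C n0.+1.
move: (\sum_(k < _) _) => S h1 h2.
have {}h2 := h2 ltac:(nia); nia.
Qed.

(** * The game of a tiling problem *)

Section TilingGame.
Variables (d : nat) (H V : nat -> nat -> bool) (ws : seq nat) (Np : nat).
Local Notation W := (size ws).

(** The forced tiles form a row above the tiled cells. The first row proper is tiled like the
    others, and [V] against [ws] restricts it only as far as desired, which leaves room for a
    guessed witness. *)
Definition tiling (c : nat -> nat) : Prop :=
  [/\ forall h, h <= Np -> c h < d,
      forall h, h < Np -> H (c h) (c h.+1) &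
      forall h, h <= Np -> V (if h < W then nth 0 ws h else c (h - W)) (c h)].

(* Vertex 0 is the start, vertex 1 the sink, and [vtx g a] stands for tile [a]
   at cell [g]; cell [W + h] is the [h]-th cell to be tiled and the first [W]
   cells carry the forced tiles [ws].  Every vertex is its own player. *)
Definition vtx g a := (g * d + a).+2.
Definition grp v := v.-2 %/ d.
Definition til v := v.-2 %% d.
Definition n_items := (W + Np.+1) * d.
Definition n_vertices := 2 + n_items.

Definition h_pairs := [seq p <- [seq (a, b) | a <- iota 0 d, b <- iota 0 d] | H p.1 p.2].

Definition g_edges : seq (nat * nat) :=
  (1, 1) :: [seq (v, 1) | v <- iota 2 n_items]
  ++ [seq (0, vtx W a) | a <- iota 0 d]
  ++ [seq (vtx (W + h) p.1, vtx (W + h).+1 p.2) | h <- iota 0 Np, p <- h_pairs]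
  ++ [seq (vtx (W + Np) a, 0) | a <- iota 0 d].

(* The reward of player [j] depends only on the target [v] of an edge: the
   start player loses in the sink, a tile player loses when an incompatible
   tile is visited [W] cells further. *)
Definition rw (j v : nat) : bool :=
  if v == 1 then j != 0
  else if (v < 2) || (j < 2) then true
  else if grp v == grp j + W then V (til j) (til v) else true.

(** The players whose threshold is 1. The vertices of the cells below [W] have no incoming edge, so
    their owners influence the outcome through these thresholds alone. *)
Definition forced (j : nat) : bool :=
  (j == 0) || [&& 1 < j, grp j < W & til j == nth 0 ws (grp j)].

Definition g_instance : instance :=
  mkInstance 0%R n_vertices n_vertices (iota 0 n_vertices) g_edges
    [seq [seq ((rw j e.2)%:R)%R | j <- iota 0 n_vertices] | e <- g_edges]
    0 [seq ((forced j)%:R)%R | j <- iota 0 n_vertices] (nseq n_vertices 1%R).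

Hypothesis d0 : 0 < d.
Hypothesis ws_lt : all (fun a => a < d) ws.

Lemma grp_vtx g a : a < d -> grp (vtx g a) = g.
Proof. by move=> lt; rewrite /grp /vtx /= divnMDl // divn_small // addn0. Qed.

Lemma til_vtx g a : a < d -> til (vtx g a) = a.
Proof. by move=> lt; rewrite /til /vtx /= modnMDl modn_small. Qed.

Lemma vtx_lt g a : a < d -> g < W + Np.+1 -> vtx g a < n_vertices.
Proof. by move=> lta ltg; rewrite /vtx /n_vertices /n_items; nia. Qed.

Inductive edge : nat -> nat -> Prop :=
  | EdgeSink : edge 1 1
  | EdgeExit v : 1 < v < n_vertices -> edge v 1
  | EdgeStart a : a < d -> edge 0 (vtx W a)
  | EdgeNext h a b : h < Np -> a < d -> b < d -> H a b ->
      edge (vtx (W + h) a) (vtx (W + h).+1 b)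
  | EdgeWrap a : a < d -> edge (vtx (W + Np) a) 0.

Lemma mem_h_pairs a b : ((a, b) \in h_pairs) = [&& a < d, b < d & H a b].
Proof.
rewrite mem_filter /= andbC; case: (H a b); rewrite ?andbT ?andbF //.
apply/allpairsP/andP => [[[a' b'] /= [ia ib [-> ->]]]|[la lb]].
  by move: ia ib; rewrite !mem_iota.
by exists (a, b); rewrite !mem_iota.
Qed.

Lemma edgeP u v : reflect (edge u v) (is_edge g_instance u v).
Proof.
apply: (iffP idP); rewrite /is_edge /= inE !mem_cat.
  case/or3P=> [/eqP[-> ->]|/mapP[x]|].
  - exact: EdgeSink.
  - by rewrite mem_iota => lt [-> ->]; apply: EdgeExit.
  case/or3P=> [/mapP[a]|/allpairsP[[h [a b]] /= []]|/mapP[a]].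
  - by rewrite mem_iota => lt [-> ->]; apply: EdgeStart.
  - rewrite mem_h_pairs mem_iota => lth /and3P[la lb hab] [-> ->].
    exact: EdgeNext.
  - by rewrite mem_iota => lt [-> ->]; apply: EdgeWrap.
case=> [|x lt|a lt|h a b lh la lb hab|a lt].
- by rewrite eqxx.
- by rewrite map_f ?orbT // mem_iota.
- by rewrite (map_f (fun a => (0, vtx W a))) ?orbT // mem_iota.
- apply/orP; right; apply/or4P; apply: Or43.
  apply/allpairsP; exists (h, (a, b)); rewrite /= mem_h_pairs mem_iota.
  by rewrite lh la lb hab.
- by rewrite (map_f (fun a => (vtx (W + Np) a, 0))) ?orbT // mem_iota.
Qed.

Lemma edge_lt u v : edge u v -> (u < n_vertices) && (v < n_vertices).
Proof.
case=> [|x /andP[_ ->]|a lt|h a b lh la lb _|a lt] //.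
- by rewrite vtx_lt //; lia.
- by rewrite !vtx_lt //; lia.
- by rewrite vtx_lt //; lia.
Qed.

Lemma uniq_g_edges : uniq g_edges.
Proof.
have inj_vtx g a g' a' :
    a < d -> a' < d -> g * d + a = g' * d + a' -> g = g' /\ a = a'.
  move=> la la' E; have {}E : vtx g a = vtx g' a' by rewrite /vtx E.
  by split; [rewrite -(grp_vtx g la) E grp_vtx | rewrite -(til_vtx g la) E til_vtx].
have cl : uniq [seq (vtx (W + h) p.1, vtx (W + h).+1 p.2) | h <- iota 0 Np, p <- h_pairs].
  apply: allpairs_uniq; rewrite ?iota_uniq //.
    apply: filter_uniq; apply: allpairs_uniq; rewrite ?iota_uniq //.
    by move=> [a b] [a' b'] _ _ /= [-> ->].
  move=> [h [a b]] [h' [a' b']] /allpairsP[[h1 [a1 b1]] /= [_ + E]].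
  case: E => -> -> ->; rewrite mem_h_pairs => /and3P[la lb _].
  move=> /allpairsP[[h2 [a2 b2]] /= [_ + E]].
  case: E => -> -> ->; rewrite mem_h_pairs => /and3P[la' lb' _].
  case=> /inj_vtx-/(_ la la')[E1 ->] /inj_vtx-/(_ lb lb')[_ ->].
  by have -> : h1 = h2 by lia.
have u1 : uniq [seq (v, 1) | v <- iota 2 n_items].
  by rewrite map_inj_uniq ?iota_uniq // => a b [].
have u2 : uniq [seq (0, vtx W a) | a <- iota 0 d].
  by rewrite map_inj_uniq ?iota_uniq // => a b [] /addnI.
have u3 : uniq [seq (vtx (W + Np) a, 0) | a <- iota 0 d].
  by rewrite map_inj_uniq ?iota_uniq // => a b [] /addnI.
rewrite /g_edges cons_uniq !cat_uniq u1 u2 cl u3 /= !mem_cat andbT.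
apply/and4P; split.
- apply/negP => /or4P[/mapP[x]|/mapP[x]|/allpairsP[[h [a b]] /= []]|/mapP[x]].
  + by rewrite mem_iota => /andP[lt _] [E]; rewrite -E in lt.
  + by [].
  + by [].
  + by [].
- apply/hasPn => e; rewrite !mem_cat => /or3P[/mapP[x]|/allpairsP[[h [a b]] /= []]|/mapP[x]].
  + move=> _ ->; apply/negP => /mapP[y]; by rewrite mem_iota => + [E _]; rewrite -E.
  + by move=> _ _ ->; apply/negP => /mapP[y _ []].
  + by move=> _ ->; apply/negP => /mapP[y _ []].
- apply/hasPn => e; rewrite !mem_cat => /orP[/allpairsP[[h [a b]] /= []]|/mapP[x]].
  + by move=> _ _ ->; apply/negP => /mapP[y _ []].
  + by move=> _ ->; apply/negP => /mapP[y _ []].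
- apply/hasPn => e /mapP[x _ ->]; apply/negP => /allpairsP[[h [a b]] /= []].
  by [].
Qed.

Lemma g_instance_wf : wf_instance g_instance.
Proof.
rewrite /wf_instance.
cbn [i_eps i_nP i_nV i_owner i_edges i_rew i_v0 i_x i_y g_instance].
rewrite lexx !size_map size_nseq !size_iota !eqxx !andTb !andbT.
apply/and5P; split => //.
- by apply/allP => p; rewrite mem_iota.
- by apply/allP => -[u v] uv; apply: edge_lt; apply/edgeP.
- exact: uniq_g_edges.
- apply/allP => v; rewrite mem_iota leq0n add0n => lt; apply/hasP.
  case: v lt => [|[|v]] lt.
  + by exists (0, vtx W 0) => //; apply/(edgeP 0 (vtx W 0)); apply: EdgeStart.
  + by exists (1, 1) => //; apply/(edgeP 1 1); apply: EdgeSink.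
  + by exists (v.+2, 1) => //; apply/(edgeP v.+2 1); apply: EdgeExit.
- by apply/allP => r /mapP[e _ ->]; rewrite size_map size_iota.
Qed.

(** [reward] defaults to 0 off the edge list and beyond the last player; the first two conjuncts
    reproduce these defaults, so [rewardE] needs no side condition. *)
Definition rbit (j u v : nat) : bool :=
  [&& is_edge g_instance u v, j < n_vertices & rw j v].

Lemma rewardE j u v : reward g_instance j u v = ((rbit j u v)%:R)%R.
Proof.
rewrite /reward /rbit; case: (boolP (is_edge _ _ _)) => [e|ne].
  have lt : index (u, v) g_edges < size g_edges by rewrite index_mem.
  rewrite (nth_map (0, 0)) // nth_index //.
  rewrite andTb; case: (ltnP j n_vertices) => lj; rewrite ?andTb ?andFb.
    by rewrite (nth_map 0) ?size_iota // nth_iota.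
  by rewrite nth_default // size_map size_iota.
by rewrite [nth [::] _ _]nth_default ?nth_nil // size_map leqNgt index_mem.
Qed.

Lemma own_id v : v < n_vertices -> own g_instance v = v.
Proof. by move=> lt; rewrite /own -[i_owner _]/(iota 0 n_vertices) nth_iota. Qed.

Lemma mean_payoffE j rho : mean_payoff g_instance j rho =
  mean_inf (fun k => reward g_instance j (rho k) (rho k.+1)).
Proof. by []. Qed.

Lemma payoff_le1 j rho : (mean_payoff g_instance j rho <= 1)%E.
Proof. by rewrite mean_payoffE; apply: (@mean_inf_le1 (fun k => rbit j (rho k) (rho k.+1))) => k; apply: rewardE. Qed.

Lemma payoff_ge0 j rho : (0 <= mean_payoff g_instance j rho)%E.
Proof. by rewrite mean_payoffE; apply: (@mean_inf_ge0 (fun k => rbit j (rho k) (rho k.+1))) => k; apply: rewardE. Qed.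

Lemma payoff_ge1 j (rho : nat -> nat) : (forall k, rbit j (rho k) (rho k.+1)) ->
  (1 <= mean_payoff g_instance j rho)%E.
Proof. by rewrite mean_payoffE => Hr; apply: (@mean_inf_all (fun k => rbit j (rho k) (rho k.+1))) Hr => k; apply: rewardE. Qed.

Lemma payoff_sparse j (rho : nat -> nat) : (1 <= mean_payoff g_instance j rho)%E ->
  sparse (fun k => ~~ rbit j (rho k) (rho k.+1)).
Proof. by rewrite mean_payoffE => Hr; apply: (@mean_inf_sparse (fun k => rbit j (rho k) (rho k.+1))) Hr => k; apply: rewardE. Qed.

Lemma hist_last_lt v s : v < n_vertices -> is_hist g_instance v s -> last v s < n_vertices.
Proof.
case: s => // a s lt /= /andP[/eqP -> {a}].
elim: s v lt => //= b s IHs v lt /andP[/edgeP/edge_lt/andP[_ ltb]]; exact: IHs.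
Qed.

Lemma hist_of_rcons next v k : exists h, hist_of next v k = rcons h (play_of next v k).
Proof.
rewrite /play_of; case: k => [|k] /=; first by exists [::].
by exists (hist_of next v k); rewrite last_rcons.
Qed.

Lemma last_hist_of next v k x : last x (hist_of next v k) = play_of next v k.
Proof. by have [h ->] := hist_of_rcons next v k; rewrite last_rcons. Qed.

Lemma size_hist_of next v k : size (hist_of next v k) = k.+1.
Proof. by elim: k => //= k IHk; rewrite size_rcons IHk. Qed.

Lemma play_ofS next v k : play_of next v k.+1 = next (hist_of next v k).
Proof. by rewrite /play_of /= last_rcons. Qed.

Lemma is_hist_rcons v s x : is_hist g_instance v s ->
  is_hist g_instance v (rcons s x) = is_edge g_instance (last v s) x.
Proof. by case: s => //= a s /andP[/eqP -> ps]; rewrite eqxx rcons_path ps. Qed.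

Lemma hist_of_is_hist next v k :
  (forall k, is_hist g_instance v (hist_of next v k) ->
     is_edge g_instance (play_of next v k) (next (hist_of next v k))) ->
  is_hist g_instance v (hist_of next v k).
Proof.
move=> Hn; elim: k => [|k IHk] /=; first by rewrite eqxx.
by rewrite is_hist_rcons // last_hist_of; apply: Hn.
Qed.

(** * From tilings to equilibria *)

Section FromTiling.
Variable c : nat -> nat.
Hypothesis tc : tiling c.

Let c_lt h : h <= Np -> c h < d. Proof. by case: tc => + _ _; apply. Qed.

Definition good v : Prop := v = 0 \/ exists2 h, h <= Np & v = vtx (W + h) (c h).

Definition nxt v :=
  if v == 0 then vtx W (c 0)
  else if [&& 1 < v, W <= grp v, grp v <= W + Np & til v == c (grp v - W)] then
    if grp v == W + Np then 0 else vtx (grp v).+1 (c (grp v - W).+1)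
  else 1.

Lemma goodP v : good v \/ (v != 0 /\ nxt v = 1).
Proof.
rewrite /nxt; case: eqP => [->|/eqP v0]; first by left; left.
case: ifP => [/and4P[v1 le1 le2 /eqP E]|_]; last by right.
left; right; exists (grp v - W); first lia.
rewrite subnKC // -E /vtx /grp /til -divn_eq.
by case: v v0 v1 {le1 le2 E} => [|[|v]].
Qed.

Lemma nxt_vtx h : h <= Np ->
  nxt (vtx (W + h) (c h)) = if h == Np then 0 else vtx (W + h).+1 (c h.+1).
Proof.
move=> le; have lt := c_lt le; rewrite /nxt grp_vtx // til_vtx //.
by rewrite addKn eqxx leq_addr leq_add2l le /= eqn_add2l.
Qed.

Lemma good_nxt v : good v -> good (nxt v).
Proof.
case=> [->|[h le ->]]; first by right; exists 0; rewrite ?addn0.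
rewrite nxt_vtx //; case: eqP => [_|ne]; first by left.
by right; exists h.+1; rewrite ?addnS //; lia.
Qed.

Lemma good_neq1 v : good v -> v != 1.
Proof. by case=> [->|[h _ ->]]. Qed.

Lemma good_iter k v : good v -> good (iter k nxt v).
Proof. by move=> gv; elim: k => //= k; apply: good_nxt. Qed.

Lemma bad_iter k v : ~ good v -> iter k.+1 nxt v = 1.
Proof.
move=> nv; elim: k => [|k IHk]; first by case: (goodP v) => [//|[_]].
by rewrite iterS IHk /nxt.
Qed.

Lemma edge_nxt v : v < n_vertices -> edge v (nxt v).
Proof.
move=> lt; case: (goodP v) => [[->|[h le ->]]|[v0 ->]].
- by apply: EdgeStart; apply: c_lt.
- rewrite nxt_vtx //; case: eqP => [->|ne]; first by apply: EdgeWrap; apply: c_lt.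
  apply: EdgeNext; [lia|exact: c_lt|apply: c_lt; lia|].
  by case: tc => _ + _; apply; lia.
- by case: v lt v0 => [|[|v]] // lt _; [exact: EdgeSink | apply: EdgeExit].
Qed.

Lemma iter_nxt_lt k v : v < n_vertices -> iter k nxt v < n_vertices.
Proof. by move=> lt; elim: k => //= k /edge_nxt/edge_lt/andP[]. Qed.

Lemma rw_good i v : good i -> good v -> rw i v.
Proof.
move=> gi gv; rewrite /rw (negPf (good_neq1 gv)).
case: gv => [->|[h leh ->]] //; case: gi => [->|[h' leh' ->]] //=.
have lt := c_lt leh; have lt' := c_lt leh'.
rewrite !grp_vtx // !til_vtx //; case: eqP => // E.
have := tc; case=> _ _ /(_ h leh).
by have -> : (h < W) = false by [lia]; have -> : h - W = h' by lia.
Qed.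

Lemma rw_forced i v : forced i -> good v -> rw i v.
Proof.
move=> fi gv; rewrite /rw (negPf (good_neq1 gv)).
case/orP: fi => [/eqP -> | /and3P[i1 lt /eqP E]]; first by rewrite orbT.
case: gv => [->|[h leh ->]] //=; rewrite [i < 2]ltnNge i1 /=.
have ltc := c_lt leh; rewrite grp_vtx // til_vtx //; case: eqP => // Eh.
have := tc; case=> _ _ /(_ h leh).
have Eh' : h = grp i by lia.
by rewrite Eh' lt E.
Qed.

(** From a good vertex the run stays among good vertices, whose owners never lose there. From a bad
    one it is in the sink after one step, where only the start player loses; vertex 0 is good, so
    that run does not meet it. *)
Lemma rw_visited i v k k' : iter k nxt v = i -> rw i (iter k'.+1 nxt v).
Proof.
case: (pselect (good v)) => [gv <-|bv].
  by apply: rw_good; apply: good_iter.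
rewrite bad_iter // /rw /= => <-; case: k => [|k]; last by rewrite bad_iter.
by apply: contra_not_neq bv => /= E; left.
Qed.

Lemma play_of_nxt next v :
  (forall k, play_of next v k = iter k nxt v ->
     next (hist_of next v k) = nxt (iter k nxt v)) ->
  forall k, play_of next v k = iter k nxt v.
Proof. by move=> Hn; elim=> //= k IHk; rewrite play_ofS Hn. Qed.

Definition sigma : profile := fun _ h => nxt (last 0 h).

Lemma residual_play s v k : play_of (residual_next g_instance sigma s) v k = iter k nxt v.
Proof.
apply: play_of_nxt => {}k E; rewrite /residual_next /sigma last_cat.
by rewrite last_hist_of E.
Qed.

Lemma profile_play v k : play_of (profile_next g_instance sigma) v k = iter k nxt v.
Proof.
by apply: play_of_nxt => {}k E; rewrite /profile_next /sigma last_hist_of E.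
Qed.

(** Player [i] owns the vertex [i] and no other, so he can change only a play that reaches it. *)
Lemma deviation_play s v i tau k : v < n_vertices -> (forall k, iter k nxt v != i) ->
  play_of (deviation_next g_instance sigma s i tau) v k = iter k nxt v.
Proof.
move=> lt ni; apply: play_of_nxt => {}k E.
rewrite /deviation_next last_hist_of E own_id ?iter_nxt_lt // (negPf (ni k)).
by rewrite /residual_next /sigma last_cat last_hist_of E.
Qed.

Lemma tiling_threshold : threshold_yes g_instance.
Proof.
exists sigma; split; [|split].
- move=> i _ s hs _ /=; apply/edgeP.
  have lt : last 0 s < n_vertices by apply: hist_last_lt hs.
  exact: edge_nxt.
- move=> s hs i lti tau _.
  have lt : last 0 s < n_vertices by apply: hist_last_lt hs.
  rewrite /= rmorph0 adde0.
  case: (pselect (exists k, iter k nxt (last 0 s) = i)) => [[k Ek]|/forallNP ne].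
    apply: le_trans (payoff_le1 _ _) _; apply: payoff_ge1 => k'.
    rewrite !residual_play /rbit lti (rw_visited _ Ek) !andbT.
    by apply/edgeP; apply: edge_nxt; apply: iter_nxt_lt.
  rewrite le_eqVlt; apply/orP; left; apply/eqP; rewrite !mean_payoffE; congr mean_inf.
  apply/funext => k; rewrite !residual_play !deviation_play // => k'; exact/eqP.
- move=> j ltj; cbn [i_x i_y i_v0 g_instance].
  rewrite nth_nseq (ltj : j < n_vertices) rmorph1 payoff_le1 andbT.
  rewrite (nth_map 0) ?size_iota // nth_iota // add0n ratr_nat.
  case: (boolP (forced j)) => [fj|_]; last exact: payoff_ge0.
  apply: payoff_ge1 => k; rewrite !profile_play /rbit ltj (rw_forced fj) ?andbT.
    by apply/edgeP; apply: edge_nxt; apply: iter_nxt_lt.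
  by apply: good_iter; left.
Qed.

End FromTiling.

(** * From equilibria to tilings *)

Section ToTiling.
Variable sg : profile.
Hypothesis valid_sg : valid_profile g_instance (i_v0 g_instance) sg.
Hypothesis spe_sg : is_eps_SPE g_instance (i_eps g_instance) sg.
Hypothesis thr_sg : forall j, j < n_vertices -> forced j ->
  (1 <= mean_payoff g_instance j (play_of (profile_next g_instance sg) 0))%E.

Let next := profile_next g_instance sg.
Let rho := play_of next 0.

Lemma valid_next h : is_hist g_instance 0 h ->
  edge (last 0 h) (sg (own g_instance (last 0 h)) h).
Proof.
move=> hh; have lt := hist_last_lt (ltn0Sn _) hh.
by apply/edgeP; apply: valid_sg => //=; rewrite own_id.
Qed.

Lemma rho_hist k : is_hist g_instance 0 (hist_of next 0 k).
Proof.
apply: hist_of_is_hist => {}k hk; apply/edgeP.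
by have := valid_next hk; rewrite last_hist_of /next /profile_next last_hist_of.
Qed.

Lemma rho_edge k : edge (rho k) (rho k.+1).
Proof.
rewrite /rho play_ofS; have := valid_next (rho_hist k).
by rewrite last_hist_of /next /profile_next last_hist_of.
Qed.

Lemma rho_lt k : rho k < n_vertices.
Proof. by have /edge_lt/andP[] := rho_edge k. Qed.

Lemma edge1 v : edge 1 v -> v = 1.
Proof. by move E: 1 => u e; case: e E. Qed.

Lemma rho_neq1 k0 : rho k0 != 1.
Proof.
apply/eqP => E.
have R1 k : rho (k0 + k) = 1.
  elim: k => [|k IHk]; first by rewrite addn0.
  by rewrite addnS; apply: edge1; rewrite -IHk; apply: rho_edge.
(* With more than [k0] steps after the sink is reached, over half of the rewards of the start player
   are 0, against [q = 2]. *)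
have [n0 Hn] := payoff_sparse (thr_sg (ltn0Sn _) isT) 2.
have := Hn (k0 + (k0 + n0).+1); rewrite big_split_ord /=.
set A := \sum_(i < k0) _; set A' := \sum_(i < (k0 + n0).+1) _.
have EA' : A' = (k0 + n0).+1.
  rewrite -[RHS]sum1_ord; apply: eq_bigr => i _.
  by rewrite -/next -/rho -(addnS k0 i) !R1 /rbit (_ : rw 0 1 = false) // !andbF.
by rewrite EA' => /(_ ltac:(lia)); lia.
Qed.

(** The length of a round: the start and [Np.+1] tiled cells. *)
Let P := Np.+2.

Lemma rho_start k : rho k = 0 -> exists2 a, a < d & rho k.+1 = vtx W a.
Proof.
move=> E; have := rho_edge k; have := rho_neq1 k.+1; rewrite E.
move: (rho k.+1) => v v1; move Eu: 0 => u e.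
case: e Eu v1 => // a lt _ _; by exists a.
Qed.

Lemma rho_step k h a : h <= Np -> a < d -> rho k = vtx (W + h) a ->
  if h == Np then rho k.+1 = 0
  else exists2 b, b < d & H a b /\ rho k.+1 = vtx (W + h.+1) b.
Proof.
move=> le lta E; have := rho_edge k; have := rho_neq1 k.+1; rewrite E.
move: (rho k.+1) => v v1; move Eu: (vtx _ _) => u e.
case: e Eu v1 => // [h' a' b' lh' la' lb' hab|a' la'] Eu _.
  have Eh : h = h'.
    by apply: (@addnI W); rewrite -(grp_vtx (W + h) lta) Eu grp_vtx.
  have Ea : a = a' by rewrite -(til_vtx (W + h) lta) Eu til_vtx.
  have -> : (h == Np) = false by rewrite Eh; lia.
  by exists b' => //; rewrite Ea Eh addnS.
have -> : h = Np by apply: (@addnI W); rewrite -(grp_vtx (W + h) lta) Eu grp_vtx.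
by rewrite eqxx.
Qed.

Lemma rho_round m : rho (m * P) = 0 /\
  forall h, h <= Np -> exists2 a, a < d & rho (m * P + h.+1) = vtx (W + h) a.
Proof.
have R k : rho k = 0 ->
    forall h, h <= Np -> exists2 a, a < d & rho (k + h.+1) = vtx (W + h) a.
  move=> E; elim=> [|h IHh] le.
    by rewrite addn1 addn0; apply: rho_start.
  have [a la Ea] := IHh (ltnW le).
  have := rho_step (ltnW le) la Ea; rewrite ltn_eqF // => -[b lb [_ Eb]].
  by exists b => //; rewrite addnS.
suff E : rho (m * P) = 0 by split=> //; apply: R.
elim: m => [|m IHm] //.
have [a la Ea] := R _ IHm Np (leqnn _).
by have := rho_step (leqnn _) la Ea; rewrite eqxx -addnS mulSnr.
Qed.

Lemma hist_cat s h : is_hist g_instance 0 s -> is_hist g_instance (last 0 s) h ->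
  is_hist g_instance 0 (take (size s).-1 s ++ h).
Proof.
case/lastP: s => // s x hs; rewrite last_rcons size_rcons /= -[in take _ _]cats1 take_size_cat //.
case: h => //= y h /andP[/eqP -> {y} px].
case: s hs => [|a s] /=; first by rewrite andbT => /eqP E; rewrite -E eqxx.
by rewrite rcons_path cat_path /= => /and3P[-> -> ->].
Qed.

Lemma residual_rho k j :
  play_of (residual_next g_instance sg (hist_of next 0 k)) (rho k) j = rho (k + j).
Proof.
set res := residual_next _ _ _.
have E : forall j, take k (hist_of next 0 k) ++ hist_of res (rho k) j = hist_of next 0 (k + j).
  elim=> [|{}j IHj] /=.
    have [h Eh] := hist_of_rcons next 0 k.
    have sh : size h = k.
      by have := size_hist_of next 0 k; rewrite Eh size_rcons => -[].
    by rewrite addn0 /= Eh -cats1 take_size_cat.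
  rewrite -rcons_cat IHj addnS /= ; congr rcons.
  have -> : res (hist_of res (rho k) j) = sg (own g_instance
      (last 0 (hist_of res (rho k) j))) (take k (hist_of next 0 k) ++ hist_of res (rho k) j).
    by rewrite {1}/res /residual_next size_hist_of.
  rewrite /next /profile_next -/(profile_next g_instance sg) -/next -IHj last_cat.
  by rewrite !last_hist_of.
rewrite /rho -[RHS](@last_hist_of _ _ _ 0) -E last_cat last_hist_of //.
Qed.

Lemma exit_sparse k : 1 < rho k -> sparse (fun n => ~~ rbit (rho k) (rho n) (rho n.+1)).
Proof.
move=> gt1; set i := rho k.
have lti : i < n_vertices by apply: rho_lt.
set s := hist_of next 0 k.
have ls : last 0 s = i by rewrite /s last_hist_of.
have hs : is_hist g_instance 0 s by apply: rho_hist.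
(* Since [i] controls the single vertex [i], always moving to the sink is a legal strategy for
   him. *)
have vt : valid_strategy g_instance i i (fun=> 1).
  move=> h hh; rewrite own_id ?hist_last_lt // => ->.
  by apply/edgeP; apply: EdgeExit; rewrite gt1.
have := spe_sg hs lti (tau := fun=> 1); rewrite ls => /(_ vt).
rewrite /= rmorph0 adde0 => le.
(* Subgame perfection speaks of the payoff from time [k] on; density 0 does not depend on the
   prefix. *)
apply: (@sparse_shift _ k).
have : (1 <= mean_payoff g_instance i (play_of (residual_next g_instance sg s) i))%E.
  apply: le_trans le; set dn := deviation_next _ _ _ _ _.
  have de h : is_hist g_instance i h -> is_edge g_instance (last 0 h) (dn h).
    move=> hh; have l0 : last 0 h = last i h by case: (h) hh.
    have lt := hist_last_lt lti hh; rewrite -l0 in lt.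
    rewrite /dn /deviation_next own_id //; case: eqP => [->|_].
      by apply/edgeP; apply: EdgeExit; rewrite gt1.
    have hc : is_hist g_instance 0 (take (size s).-1 s ++ h).
      by apply: hist_cat => //; rewrite ls.
    have := valid_next hc.
    have -> : last 0 (take (size s).-1 s ++ h) = last 0 h.
      by rewrite last_cat; case: (h) hh.
    by move/edgeP.
  have dh n : is_hist g_instance i (hist_of dn i n).
    by apply: hist_of_is_hist => m hm; rewrite -(last_hist_of _ _ _ 0); apply: de.
  (* The deviation takes effect at once and is final, the sink being absorbing; a tile player gets 1
     there at every step. *)
  have D1 n : play_of dn i n.+1 = 1.
    elim: n => [|n IHn].
      by rewrite play_ofS /= /dn /deviation_next /= own_id // eqxx.
    by apply: edge1; rewrite -{1}IHn; apply/edgeP; rewrite [X in is_edge _ _ X]play_ofS -(last_hist_of _ _ _ 0); apply: de.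
  apply: payoff_ge1 => n; rewrite /rbit lti D1 /rw /= -lt0n ltnW // !andbT.
  by rewrite -(D1 n) play_ofS -(last_hist_of _ _ _ 0); apply: de.
move/payoff_sparse; congr sparse; apply/funext => n.
by rewrite /s !residual_rho addnS.
Qed.

Lemma threshold_tiling : exists c, tiling c.
Proof.
pose happy i := forced i \/ exists2 k, rho k = i & 1 < i.
pose l := [seq i <- iota 0 n_vertices | `[< happy i >]].
have Hl i : i \in l -> sparse (fun n => ~~ rbit i (rho n) (rho n.+1)).
  rewrite mem_filter mem_iota add0n => /andP[/asboolP[fi|[k <- gt]] lt].
    by apply: payoff_sparse; apply: thr_sg.
  exact: exit_sparse.
(* Only finitely many players are concerned, so one block avoids the zeros of all of them; blocks of
   length [P] are aligned with the rounds of the play. *)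
have [m Hm] := @sparse_gap _ P (sparse_has Hl).
have [R0 Rh] := rho_round m.
pose c h := til (rho (m * P + h.+1)).
have cE h : h <= Np -> c h < d /\ rho (m * P + h.+1) = vtx (W + h) (c h).
  by move=> le; have [a la E] := Rh h le; rewrite /c E til_vtx.
have Hh i h : h <= Np -> i < n_vertices -> happy i -> rw i (vtx (W + h) (c h)).
  move=> le lt hi; have [_ Eh] := cE h le.
  (* Rewards look at targets: cell [h] is entered at time [m * P + h.+1], hence judged at time
     [m * P + h]. *)
  have tP : h < P by rewrite /P; lia.
  have := Hm h tP; rewrite -all_predC => /allP/(_ i); rewrite mem_filter mem_iota lt.
  have -> : `[< happy i >] by apply/asboolP.
  by move/(_ isT); rewrite /= negbK => /and3P[_ _]; rewrite -addnS Eh.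
exists c; split=> [h le|h lt|h le]; first by case: (cE h le).
  have [lc Ec] := cE h (ltnW lt); have [lc' Ec'] := cE h.+1 lt.
  have := rho_step (ltnW lt) lc Ec; rewrite ltn_eqF // => -[b lb [hb]].
  rewrite -addnS Ec' => E.
  by have -> : c h.+1 = b by rewrite -(til_vtx (W + h.+1) lc') E til_vtx.
have [lc Ec] := cE h le.
have step i : 1 < i -> grp i = h -> rw i (vtx (W + h) (c h)) -> V (til i) (c h).
  move=> i1 gi; rewrite /rw /= [i < 2]ltnNge i1 /= grp_vtx // gi addnC eqxx.
  by rewrite til_vtx.
case: ltnP => hW.
  have lw : nth 0 ws h < d by apply: (allP ws_lt); apply: mem_nth.
  rewrite -{1}(til_vtx h lw); apply: step; rewrite ?grp_vtx //.
  apply: Hh => //; first by apply: vtx_lt => //; lia.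
  by left; rewrite /forced grp_vtx // til_vtx // hW eqxx.
have le' : h - W <= Np by lia.
have [lc' Ec'] := cE _ le'; rewrite subnKC // in Ec'.
rewrite -{1}(til_vtx h lc'); apply: step; rewrite ?grp_vtx //.
apply: Hh => //; first by apply: vtx_lt => //; lia.
(* The owner of the tile chosen [W] cells earlier was visited in this very round, so his option to
   leave makes him content. *)
by right; exists (m * P + (h - W).+1).
Qed.

End ToTiling.

Theorem g_instance_threshold : threshold_yes g_instance <-> exists c, tiling c.
Proof.
split=> [[sg [vs [ss ts]]]|[c tc]]; last exact: tiling_threshold tc.
apply: threshold_tiling vs ss _ => j lt fj.
have /andP[+ _] := ts j lt; cbn [i_x i_v0 g_instance]; rewrite (nth_map 0) ?size_iota // nth_iota //.
by rewrite add0n fj ratr_nat.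
Qed.

End TilingGame.

(** * The tableau of a Turing machine as a tiling problem *)

Section Tableau.
Variable M : TM.
Local Notation Q := ('I_(nQ M).+1).

(* The extra state [None] starts on the blank to the left of the input. *)
Local Notation st := (option Q).

Definition act (q : st) (s : option bool) : st * option bool * move :=
  match q with
  | None => (Some ord0, s, MoveR)
  | Some q => if q == ord_max then (Some q, s, Stay)
              else let: (q', w, m) := delta q s in (Some q', w, m)
  end.

Definition aconf := (st * int * tape)%type.

Definition astep (c : aconf) : aconf :=
  let: (q, p, f) := c in
  let: (q', w, m) := act q (f p) in (q', (p + mvz m)%R, tset f p w).

(* Tape symbol, state if the head is here, and a mark for the guessed cells of
   the first row. *)
Local Notation letter := (option bool * option st * bool)%type.
Definition lsym (l : letter) := l.1.1.
Definition lhead (l : letter) := l.1.2.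
Definition lmark (l : letter) := l.2.
Definition blank : letter := (None, None, false).

Definition lact (l : letter) := omap (act^~ (lsym l)) (lhead l).

Definition next_letter (a b c : letter) : letter :=
  (if lact b is Some (_, w, _) then w else lsym b,
   if lact b is Some (q, _, Stay) then Some q else
   if lact a is Some (q, _, MoveR) then Some q else
   if lact c is Some (q, _, MoveL) then Some q else None,
   false).

Definition lett (mk : int -> bool) (c : aconf) (z : int) : letter :=
  (c.2 z, if z == c.1.2 then Some c.1.1 else None, mk z).

Lemma next_lett mk c z :
  next_letter (lett mk c (z - 1)%R) (lett mk c z) (lett mk c (z + 1)%R) =
  lett (fun=> false) (astep c) z.
Proof.
case: c => [[q p] f]; rewrite /next_letter /lact /lett /lsym /lhead /astep /=.
case E: (act q (f p)) => [[q' w] m] /=.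
case: (eqVneq z p) => [->|zp] /=.
  have -> : (p - 1 == p)%R = false by lia.
  have -> : (p + 1 == p)%R = false by lia.
  rewrite E /tset eqxx /=.
  case: m E => E /=.
  - by have -> : (p == p - 1)%R = false by lia.
  - by have -> : (p == p + 1)%R = false by lia.
  - by rewrite addr0 eqxx.
have -> : tset f p w z = f z by rewrite /tset (negPf zp).
case: (eqVneq (z - 1)%R p) => [E1|zp1] /=.
  have -> : (z + 1 == p)%R = false by lia.
  rewrite E1 E /=; congr (_, _, _).
  case: m E => E /=.
  - by have -> : (z == p - 1)%R = false by lia.
  - by have -> : (z == p + 1)%R by lia.
  - by rewrite addr0 (negPf zp).
case: (eqVneq (z + 1)%R p) => [E1|zp2] /=.
  rewrite E1 E /=; congr (_, _, _).
  case: m E => E /=.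
  - by have -> : (z == p - 1)%R by lia.
  - by have -> : (z == p + 1)%R = false by lia.
  - by rewrite addr0 (negPf zp).
congr (_, _, _); case: eqP => // Ez; exfalso.
by case: m E Ez => _ /= Ez; lia.
Qed.

(** A neighbour matters only through its head. This is used at the seam between rows, where the
    neighbours in the tiling are not those in the tableau but neither of them carries a head. *)
Lemma next_letter_eq a a' b c c' :
  a = a' \/ lhead a = None /\ lhead a' = None ->
  c = c' \/ lhead c = None /\ lhead c' = None ->
  next_letter a b c = next_letter a' b c'.
Proof.
move=> Ha Hc; have Ea : lact a = lact a' by rewrite /lact; case: Ha => [->|[-> ->]].
have Ec : lact c = lact c' by rewrite /lact; case: Hc => [->|[-> ->]].
by rewrite /next_letter Ea Ec.
Qed.

(** The left summand holds the windows, the right one the entries of the forced row: [Some l]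
    prescribes a letter, [None] admits any marked letter without a head. *)
Local Notation tile := (letter * letter * letter + option letter)%type.

Definition rejecting (l : letter) :=
  (lhead l == Some (Some ord_max)) && (lsym l != Some true).

(** The second clause makes the guessed cells a word followed by blanks. It is confined to marked
    cells, since a machine may well write beyond a blank later on. *)
Definition valid_triple (b c : letter) :=
  ~~ rejecting b && ~~ [&& lmark b, lmark c, lsym b == None & lsym c != None].

Definition allows (k : option letter) (l : letter) :=
  if k is Some l' then l == l' else lmark l && (lhead l == None).

Definition h_rel (t t' : tile) : bool :=
  match t, t' with
  | inl (_, b, c), inl (a', b', _) => (b == a') && (c == b')
  | _, _ => false
  end.

Definition v_rel (t t' : tile) : bool :=
  match t' with
  | inl (_, b', c') => valid_triple b' c' &&
      match t with
      | inl (a, b, c) => b' == next_letter a b c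
      | inr k => allows k b'
      end
  | inr _ => false
  end.

Definition pcode (x : seq bool) : seq bool := flatten [seq [:: true; b] | b <- x] ++ [:: false].

Lemma pair_wordsE x u : pair_words x u = pcode x ++ u.
Proof. by rewrite /pair_words /pcode -catA. Qed.

Lemma size_pcode x : size (pcode x) = (2 * size x).+1.
Proof. by rewrite /pcode size_cat addn1; elim: x => //= b x; lia. Qed.

(* Rows are laid out one after the other, so the right neighbour of the last
   cell of a row is the first cell of the next row.  The [2 * Z] blanks on both
   sides keep the head away from this seam. *)
Definition word (Z P : nat) (x : seq bool) : seq (option letter) :=
  nseq (2 * Z) (Some blank) ++ Some (None, Some None, false) ::
  [seq Some (Some b, None, false) | b <- pcode x] ++
  nseq P None ++ nseq (2 * Z) (Some blank).

Lemma contiguous (g : nat -> option bool) P :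
  (forall j, j.+1 < P -> g j = None -> g j.+1 = None) ->
  exists2 u, size u <= P & forall j, j < P -> g j = nth None (map Some u) j.
Proof.
elim: P => [|P IHP] Hg; first by exists [::].
case: IHP => [j lt|u le Hu]; first by apply: Hg; apply: ltnW.
case: (ltnP (size u) P) => lt.
  exists u; first exact: leqW.
  move=> j; rewrite ltnS leq_eqVlt => /predU1P[->|]; last exact: Hu.
  case: P Hg le Hu lt => // P Hg le Hu lt.
  rewrite nth_default ?size_map 1?ltnW //; apply: Hg => //.
  by rewrite Hu // nth_default // size_map.
have sz : size u = P by apply/eqP; rewrite eqn_leq le.
case E: (g P) => [b|].
  exists (rcons u b); first by rewrite size_rcons sz.
  move=> j; rewrite ltnS leq_eqVlt map_rcons nth_rcons size_map sz => /predU1P[->|ltj].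
    by rewrite ltnn eqxx.
  by rewrite ltj Hu.
exists u; first exact: leqW.
move=> j; rewrite ltnS leq_eqVlt => /predU1P[->|]; last exact: Hu.
by rewrite nth_default // size_map sz.
Qed.

(** * Correspondence between tilings and accepting runs *)

Section Run.
Variables (Z P : nat) (x : seq bool).
Let W := size (word Z P x).
Let n1 := size (pcode x).

Lemma size_word : size (word Z P x) = 4 * Z + 1 + (2 * size x).+1 + P.
Proof.
by rewrite /word size_cat size_nseq /= !size_cat size_map size_pcode !size_nseq; lia.
Qed.

Let WE : W = 4 * Z + 1 + n1 + P. Proof. by rewrite /W size_word /n1 size_pcode. Qed.

(** Index [2 * Z], where the head starts, becomes -1, so the input begins at coordinate 0. *)
Definition colz (i : nat) : int := (Posz i - Posz (2 * Z).+1)%R.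

Definition gmark (z : int) : bool :=
  (Posz (size (pcode x)) <= z)%R && (z < Posz (size (pcode x) + P))%R.

Definition row_mark (t : nat) (z : int) : bool := (t == 0) && gmark z.

Section Input.
Variable u : seq bool.
Hypothesis size_u : size u <= P.
Let y := pair_words x u.

Definition tape0 (y : seq bool) : tape :=
  fun z => match z with Posz n => nth None (map Some y) n | Negz _ => None end.

(** With the head left of the input, no letter combines an input bit with a head. The price is one
    extra step: the configuration of the machine at time [t] is row [t.+1]. *)
Definition conf0 : aconf := (None, (-1)%R, tape0 (pair_words x u)).

Lemma word_nth i : i < W -> nth None (word Z P x) i =
  if gmark (colz i) then None else Some (lett gmark conf0 (colz i)).
Proof.
rewrite WE => lt; rewrite /word nth_cat size_nseq nth_nseq.
have NM : forall z, gmark z = false -> lett gmark conf0 z =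
    (tape0 y z, if z == (-1)%R then Some None else None, false).
  by move=> z E; rewrite /lett E.
case: ltnP => h1.
  have Ez : colz i = Negz (2 * Z - i) by rewrite /colz; lia.
  have G : gmark (colz i) = false by rewrite /gmark Ez.
  rewrite G NM // Ez /= /blank.
  by have -> : (Negz (2 * Z - i) == -1)%R = false by lia.
case E: (i - 2 * Z) => [|j] /=.
  have Ez : colz i = Negz 0 by rewrite /colz; lia.
  by rewrite Ez NM.
have Ez : colz i = Posz j by rewrite /colz; lia.
rewrite nth_cat size_map -/n1; case: ltnP => h2.
  have G : gmark (colz i) = false by rewrite /gmark Ez -/n1; lia.
  rewrite G NM // Ez (nth_map false) // /y pair_wordsE /= map_cat nth_cat size_map -/n1 h2.
  by rewrite (nth_map false).
rewrite nth_cat size_nseq; case: ltnP => h3.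
  have -> : gmark (colz i) by rewrite /gmark Ez -/n1; lia.
  by rewrite nth_nseq h3.
have G : gmark (colz i) = false by rewrite /gmark Ez -/n1; lia.
rewrite G NM // Ez nth_nseq /blank.
have -> : j - n1 - P < 2 * Z by lia.
rewrite /= nth_default // size_map /y pair_wordsE size_cat -/n1.
by move: size_u; lia.
Qed.

Lemma gmark_lett z : gmark z ->
  lett gmark conf0 z = (nth None (map Some u) (`|z| - n1)%N, None, true).
Proof.
move=> gz; rewrite /lett gz; case: z gz => [n|n]; rewrite /gmark -/n1 //= => /andP[le lt].
rewrite pair_wordsE map_cat nth_cat size_map -/n1.
by have -> : (n < n1) = false by lia.
Qed.

Lemma run_represents t : exists q p f,
  iter t.+1 astep conf0 = (Some q, p, f) /\ represents (tm_run M y t) q p f.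
Proof.
elim: t => [|t [q [p [f [E R]]]]].
  exists ord0, 0%R, (tape0 y); split; last exact: represents_init.
  rewrite /conf0 /= -/y; congr (_, _, _).
  by apply/funext => z; rewrite /tset; case: eqP => // ->.
have -> : tm_run M y t.+1 = tm_step (tm_run M y t) by [].
rewrite iterS E; have := represents_step R.
case: (eqVneq q ord_max) => [Eq _|ne /(_ isT)].
  exists q, p, f; split; first by rewrite /= Eq eqxx addr0 tset_id.
  by rewrite /tm_step; case: (R) => -> _; rewrite Eq eqxx -Eq.
rewrite /= (negPf ne); case: (delta _ _) => [[q' w] m] R'.
by exists q', (p + mvz m)%R, (tset f p w).
Qed.

Lemma head_bound t : absz ((iter t astep conf0).1.2 + 1)%R <= t.
Proof.
elim: t => [|t IHt] //=; case: (iter t astep conf0) IHt => [[q p] f] /= IH.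
case: (act _ _) => [[q' w] m] /=; case: m => /=; lia.
Qed.

Lemma halted_stays (c : config M) t : cstate c = ord_max -> iter t (@tm_step M) c = c.
Proof. by move=> E; elim: t => //= t ->; rewrite /tm_step E eqxx. Qed.

Variables (Vf : seq bool -> bool) (t0 : nat).
Hypothesis t0Z : t0.+2 <= Z.
Hypothesis halt0 : cstate (tm_run M y t0) = ord_max.
Hypothesis out0 : tm_output (tm_run M y t0) = [:: Vf y].

(** A halted machine is frozen, so every halted row shows the configuration of time [t0], whose
    output starts under the head. *)
Lemma halted_symbol t q p f : iter t.+1 astep conf0 = (Some q, p, f) -> q = ord_max ->
  f p = Some (Vf y).
Proof.
move=> E Eq; have [q' [p' [f' [E' R]]]] := run_represents t.
move: E'; rewrite E => -[Eq' Ep Ef]; rewrite -{}Eq' -{}Ep -{}Ef Eq in R.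
have Er : tm_run M y t = tm_run M y t0.
  case: R => Ec _.
  case: (leqP t t0) => [le|/ltnW le].
    by have := halted_stays (t0 - t) Ec; rewrite /tm_run -iterD subnK.
  by have := halted_stays (t - t0) halt0; rewrite /tm_run -iterD subnK.
have : chead (tm_run M y t) = Some (Vf y).
  by rewrite Er; move: out0; rewrite /tm_output /=; case: (chead _) => // b [->].
by case: R => _ /(_ 0%R); rewrite addr0 => <-.
Qed.

Definition cell_letter (t i : nat) : letter :=
  lett (row_mark t) (iter t astep conf0) (colz i).

Lemma cell_letter0 i : cell_letter 0 i = lett gmark conf0 (colz i).
Proof. by rewrite /cell_letter; congr lett. Qed.

Lemma cell_next t i : 0 < i ->
  next_letter (cell_letter t i.-1) (cell_letter t i) (cell_letter t i.+1) =
  cell_letter t.+1 i.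
Proof.
move=> i0; rewrite /cell_letter.
have -> : colz i.-1 = (colz i - 1)%R by rewrite /colz; lia.
have -> : colz i.+1 = (colz i + 1)%R by rewrite /colz; lia.
by rewrite next_lett.
Qed.

Lemma cell_letter_head t i : t <= Z -> i < Z \/ 3 * Z < i ->
  lhead (cell_letter t i) = None.
Proof.
move=> le Hi; rewrite /cell_letter /lett /lhead /=; case: eqP => // E.
by have := head_bound t; rewrite -E /colz; lia.
Qed.

Lemma cell_not_rejecting t i : Vf y -> ~~ rejecting (cell_letter t i).
Proof.
move=> acc; rewrite /rejecting /cell_letter /lett /lhead /lsym /=.
case: (colz i =P _) => // E; case: t E => [//|t] E.
have [q [p [f [Ec R]]]] := run_represents t; rewrite Ec /= in E *.
rewrite negb_and negbK orbC; case: (eqVneq q ord_max) => [Eq|/negPf ne].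
  by rewrite E (halted_symbol Ec Eq) acc.
by rewrite orbC; apply/orP; left; apply/negP => /eqP[] /eqP; rewrite ne.
Qed.

Lemma accepting_tiles : Vf y -> exists ct : nat -> tile,
  (forall h, h < W * Z -> h_rel (ct h) (ct h.+1)) /\
  (forall h, h <= W * Z ->
     v_rel (if h < W then inr (nth None (word Z P x) h) else ct (h - W)) (ct h)).
Proof.
move=> acc; pose S h := cell_letter (h %/ W) (h %% W).
have W0 : 0 < W by rewrite WE; lia.
have W4 : 4 * Z < W by rewrite WE; lia.
have SE t i : i < W -> S (t * W + i) = cell_letter t i.
  by move=> lt; rewrite /S divnMDl // divn_small // addn0 modnMDl modn_small.
pose pre h := if h is h'.+1 then S h' else blank.
exists (fun h => inl (pre h, S h, S h.+1)); split=> [h _|h le] /=; first by rewrite !eqxx.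
have vt : valid_triple (S h) (S h.+1).
  rewrite /valid_triple cell_not_rejecting //=.
  apply/negP => /and4P[/andP[/eqP d1 g1] /andP[/eqP d2 g2]].
  have m1 : h %% W = h by rewrite {2}(divn_eq h W) d1.
  have m2 : h.+1 %% W = h.+1 by rewrite {2}(divn_eq h.+1 W) d2.
  rewrite m1 in g1; rewrite m2 in g2.
  rewrite /S d1 d2 m1 m2 !cell_letter0 !gmark_lett // /lsym /=.
  have E1 : `|colz h|%N - n1 = h - (2 * Z).+1 - n1 by move: g1; rewrite /gmark /colz; lia.
  have E2 : `|colz h.+1|%N - n1 = (h - (2 * Z).+1 - n1).+1 by move: g1; rewrite /gmark /colz -/n1; lia.
  rewrite E1 E2; set j := h - _ - n1 => /eqP nj.
  rewrite nth_default ?eqxx // size_map.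
  have := size_map Some u.
  case: (ltnP j (size u)) => lt; last by move=> _; lia.
  by rewrite (nth_map false) in nj.
rewrite vt /=; case: ltnP => hW.
  rewrite word_nth // /S divn_small // modn_small //.
  rewrite cell_letter0; case: ifP => [gz|_]; last by rewrite /= eqxx.
  by rewrite gmark_lett.
set h' := h - W.
have Eh : h = (h' %/ W).+1 * W + h' %% W by rewrite mulSn -addnA -divn_eq /h' subnKC.
set t := h' %/ W in Eh *; set i := h' %% W in Eh *.
have lti : i < W by rewrite ltn_mod.
have tZ : t < Z by rewrite -(ltn_pmul2r W0); move: le; rewrite Eh; nia.
have Eh' : h' = t * W + i by rewrite -divn_eq.
rewrite Eh SE //.
have -> : S h' = cell_letter t i by rewrite Eh' SE.
(* In the first cell of a row, the left neighbour in the tiling is the end of the preceding row, or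
   [blank] at the very beginning; the true neighbour may be substituted because neither carries a
   head. *)
case: (posnP i) => i0.
  have -> : S h'.+1 = cell_letter t i.+1 by rewrite Eh' -addnS SE //; lia.
  have ct0 : next_letter (lett (row_mark t) (iter t astep conf0) (colz i - 1)%R)
      (cell_letter t i) (cell_letter t i.+1) = cell_letter t.+1 i.
    rewrite /cell_letter; have -> : colz i.+1 = (colz i + 1)%R by rewrite /colz; lia.
    by rewrite next_lett.
  rewrite -ct0; apply/eqP; apply: next_letter_eq; [right|by left]; split.
    rewrite /lett /lhead /=; case: eqP => // E.
    by have := head_bound t; rewrite -E /colz i0; lia.
  rewrite Eh' i0 addn0; case: (t) tZ => [|t'] tZ //.
  have -> : t'.+1 * W = (t' * W + W.-1).+1 by rewrite mulSn; lia.
  by rewrite /= SE ?cell_letter_head //; lia.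
have -> : pre h' = cell_letter t i.-1.
  have -> : h' = (t * W + i.-1).+1 by rewrite Eh'; lia.
  by rewrite /= SE //; lia.
rewrite -cell_next //; apply/eqP; apply: next_letter_eq; first by left.
(* In the last cell of a row, the right neighbour in the tiling is the first cell of row [t.+1],
   again without a head. *)
case: (ltnP i.+1 W) => ltW.
  by left; rewrite Eh' -addnS SE.
right; split; first by rewrite cell_letter_head //; lia.
have -> : h'.+1 = t.+1 * W + 0 by rewrite Eh' mulSn; lia.
by rewrite SE // cell_letter_head //; lia.
Qed.

Section Cone.
Variable ct : nat -> tile.
Hypothesis Hh : forall h, h < W * Z -> h_rel (ct h) (ct h.+1).
Hypothesis Hv : forall h, h <= W * Z ->
  v_rel (if h < W then inr (nth None (word Z P x) h) else ct (h - W)) (ct h).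

Definition center (t : tile) : letter := if t is inl (_, b, _) then b else blank.
Hypothesis guess_u : forall h, h < W -> gmark (colz h) ->
  lsym (center (ct h)) = nth None (map Some u) (`|colz h| - n1)%N.

Lemma center_row0 i : i < W -> center (ct i) = cell_letter 0 i.
Proof.
move=> lt; have le : i <= W * Z by nia.
rewrite cell_letter0; have := Hv le; have := guess_u lt; rewrite lt word_nth //.
case: (ct i) => [[[a b] c]|] //= Hg /andP[_].
case: ifP => [gz|_] /=; last by move/eqP.
rewrite gmark_lett // -Hg //; case: b {Hg} => [[s q] m].
by rewrite /lmark /lhead /lsym /= => /andP[-> /eqP ->].
Qed.

Lemma center_next h : 0 < h -> h + W <= W * Z ->
  center (ct (h + W)) =
  next_letter (center (ct h.-1)) (center (ct h)) (center (ct h.+1)).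
Proof.
move=> h0 le; have W0 : 0 < W by rewrite WE; lia.
have := Hv le; rewrite ltnNge leq_addl /= addnK.
have := Hh (_ : h < W * Z); have := Hh (_ : h.-1 < W * Z).
rewrite prednK // => /(_ ltac:(lia)) + /(_ ltac:(lia)).
case: (ct h.-1) => [[[a0 b0] c0]|] //; case: (ct h) => [[[a1 b1] c1]|] //=.
case/andP=> /eqP -> _; case: (ct h.+1) => [[[a2 b2] c2]|] //= /andP[_ /eqP ->].
by case: (ct (h + W)) => [[[a3 b3] c3]|] //= /andP[_ /eqP].
Qed.

(** Windows across the seam see wrong neighbours and the left letter of the very first window is
    free. Such errors travel one cell per row, so a cone of correct letters remains; the blank
    margins are wide enough for it to contain the head. *)
Lemma center_cone t i : t < Z -> t <= i -> i + t < W ->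
  center (ct (t * W + i)) = cell_letter t i.
Proof.
elim: t i => [|t IHt] i ltZ le lt; first by apply: center_row0; rewrite addn0 in lt.
have -> : t.+1 * W + i = t * W + i + W by rewrite mulSn; lia.
rewrite center_next; [|lia|by rewrite (_ : t * W + i + W = t.+1 * W + i); nia].
have -> : (t * W + i).-1 = t * W + i.-1 by lia.
rewrite -addnS !IHt; try lia.
by rewrite cell_next //; lia.
Qed.

Lemma cone_accepts : Vf y.
Proof.
have [q [p [f [Ec R]]]] := run_represents t0.
have Eq : q = ord_max by case: R => <- _.
have := head_bound t0.+1; rewrite Ec /= => Hp.
pose i := absz (p + Posz (2 * Z).+1)%R.
have Ei : colz i = p by rewrite /colz /i; lia.
have W4 : 4 * Z < W by rewrite WE; lia.
have := @center_cone t0.+1 i _ _ _; rewrite /cell_letter Ei Ec /lett /= eqxx Eq => Hc.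
have {}Hc := Hc ltac:(lia) ltac:(lia) ltac:(lia).
have : ~~ rejecting (center (ct (t0.+1 * W + i))).
  have le : t0.+1 * W + i <= W * Z by nia.
  have := Hv le; case: (ct (t0.+1 * W + i)) => [[[a b] c]|] //=.
  by rewrite /valid_triple => /andP[/andP[+ _] _].
rewrite Hc /rejecting /lhead /lsym /= eqxx /= negbK (halted_symbol Ec Eq) => /eqP[].
by case: (Vf y).
Qed.

End Cone.
End Input.

Hypothesis Z1 : 0 < Z.
Variable Vf : seq bool -> bool.
Hypothesis Vf_run : forall u, size u <= P -> exists t, [/\ t.+2 <= Z,
  cstate (tm_run M (pair_words x u) t) = ord_max &
  tm_output (tm_run M (pair_words x u) t) = [:: Vf (pair_words x u)]].

Theorem tableau_tiling :
  (exists2 u, size u <= P & Vf (pair_words x u)) <->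
  exists ct : nat -> tile,
    (forall h, h < W * Z -> h_rel (ct h) (ct h.+1)) /\
    (forall h, h <= W * Z ->
       v_rel (if h < W then inr (nth None (word Z P x) h) else ct (h - W)) (ct h)).
Proof.
split=> [[u le acc]|[ct [Hh Hv]]].
  have [t [tZ ht ot]] := Vf_run le; exact: accepting_tiles le _ _ tZ ht ot acc.
have W0 : 0 < W by rewrite WE; lia.
have WZ : W <= W * Z by nia.
(* The witness is read off the guessed cells of the first row; [valid_triple] ensures that no symbol
   follows a blank there. *)
pose g j := lsym (center (ct ((2 * Z).+1 + n1 + j))).
have gm j : j < P -> gmark (colz ((2 * Z).+1 + n1 + j)) by rewrite /gmark /colz -/n1; lia.
have mk h : h < W -> gmark (colz h) -> lmark (center (ct h)).
  move=> lt gz; have := Hv h ltac:(lia); rewrite lt (@word_nth [::]) // gz /=.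
  by case: (ct h) => [[[a b] c]|] //= /andP[_ /andP[]].
have [j lt|u le Hu] := @contiguous g P.
  have := gm j (ltnW lt); have := gm _ lt; rewrite /g !addnS.
  move Eh : ((2 * Z).+1 + n1 + j) => h gz' gz.
  have lth : h.+1 < W by rewrite -Eh WE; lia.
  have g1 := mk h (ltnW lth) gz; have g2 := mk h.+1 lth gz'.
  have := Hv h ltac:(lia); have := Hh h ltac:(lia).
  move: g1 g2; case: (ct h) => [[[a b] c]|] //=; case: (ct h.+1) => [[[a' b'] c']|] //=.
  move=> mb mb' /andP[_ /eqP Ec] /andP[]; rewrite /valid_triple Ec mb mb' /=.
  move=> /andP[_ +] _ Eb; rewrite Eb /=.
  by rewrite negbK => /eqP.
exists u => //; have [t [tZ ht ot]] := Vf_run le.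
apply: (cone_accepts le tZ ht ot Hh Hv) => h lt gz.
have [lt1 lt2] : (2 * Z).+1 + n1 <= h /\ h < (2 * Z).+1 + n1 + P.
  by move: gz; rewrite /gmark /colz -/n1; lia.
have -> : (`|colz h| - n1)%N = h - ((2 * Z).+1 + n1) by rewrite /colz; lia.
rewrite -Hu; last lia.
by rewrite /g subnKC.
Qed.

End Run.

(** * Numbering the tiles *)

Definition n_tiles : nat := #|{: tile}|.
Definition nat_tile (i : nat) : tile := nth (inr None) (enum {: tile}) i.
Definition tile_nat (t : tile) : nat := index t (enum {: tile}).
Definition h_nat i j := h_rel (nat_tile i) (nat_tile j).
Definition v_nat i j := v_rel (nat_tile i) (nat_tile j).
Definition kind_nat (k : option letter) : nat := tile_nat (inr k).

Lemma tile_natK : cancel tile_nat nat_tile.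
Proof. by move=> t; rewrite /nat_tile nth_index ?mem_enum. Qed.

Lemma tile_nat_lt t : tile_nat t < n_tiles.
Proof. by rewrite /n_tiles cardE index_mem mem_enum. Qed.

Lemma tiling_nat w Np :
  (exists c, tiling n_tiles h_nat v_nat (map kind_nat w) Np c) <->
  exists ct : nat -> tile,
    (forall h, h < Np -> h_rel (ct h) (ct h.+1)) /\
    (forall h, h <= Np ->
       v_rel (if h < size w then inr (nth None w h) else ct (h - size w)) (ct h)).
Proof.
split=> [[c [_ Hh Hv]]|[ct [Hh Hv]]].
  exists (nat_tile \o c); split=> h le; first exact: Hh.
  have := Hv h le; rewrite size_map /v_nat; case: ltnP => lt //.
  by rewrite (nth_map None) // tile_natK.
exists (tile_nat \o ct); split=> h le /=.
- exact: tile_nat_lt.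
- by rewrite /h_nat !tile_natK; apply: Hh.
- rewrite size_map /v_nat tile_natK; have := Hv h le; case: ltnP => lt.
    by rewrite (nth_map None) // tile_natK.
  by rewrite tile_natK.
Qed.

End Tableau.

(** * Injectivity of the encoding *)

(** Codes are concatenated without separators, so injectivity has to be proved together with the
    position where a code ends. *)
Definition prefix_code (T : Type) (e : T -> seq bool) : Prop :=
  forall a b r r', e a ++ r = e b ++ r' -> a = b /\ r = r'.

Lemma bits_inj : injective bits.
Proof.
pose val := foldr (fun (b : bool) v => b + v.*2) 0.
have valK n : val (bits n) = n.
  elim/ltn_ind: n => -[|n] IHn //; rewrite bitsE // -[val _]/(odd n.+1 + (val (bits n.+1./2)).*2).
  by rewrite IHn ?odd_double_half //; lia.
exact: can_inj valK.
Qed.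

Lemma enc_nat_prefix : prefix_code enc_nat.
Proof.
move=> m n r r'; rewrite /enc_nat -/(bits m) -/(bits n) -!catA /=.
suff H l l' : flatten [seq [:: true; b] | b <- l] ++ false :: r =
    flatten [seq [:: true; b] | b <- l'] ++ false :: r' -> l = l' /\ r = r'.
  by move/H => [/bits_inj -> ->].
elim: l l' => [|b l IHl] [|b' l'] //=; first by case.
by case=> -> /IHl[-> ->].
Qed.

Lemma enc_int_prefix : prefix_code enc_int.
Proof. by move=> [m|m] [n|n] r r' //= [] /enc_nat_prefix[-> ->]. Qed.

Lemma enc_rat_prefix : prefix_code enc_rat.
Proof.
move=> a b r r'; rewrite /enc_rat -!catA => /enc_int_prefix[En] /enc_int_prefix[Ed ->].
by rewrite -(divq_num_den a) -(divq_num_den b) En Ed.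
Qed.

Lemma enc_seq_prefix (T : Type) (e : T -> seq bool) : prefix_code e -> prefix_code (enc_seq e).
Proof.
move=> He s s' r r'; rewrite /enc_seq -!catA /=.
elim: s s' => [|a s IHs] [|a' s'] //=; first by case.
by case; rewrite -!catA => /He[-> /IHs[-> ->]].
Qed.

(** The decision problem asks for some instance with the given code; injectivity identifies it with
    the one that was printed. *)
Lemma enc_instance_inj : injective enc_instance.
Proof.
case=> e p v o es rs v0 x y [e' p' v' o' es' rs' v0' x' y']; rewrite /enc_instance /=.
move/enc_rat_prefix => [->] /enc_nat_prefix[->] /enc_nat_prefix[->].
move/(enc_seq_prefix enc_nat_prefix) => [->].
have He : prefix_code (fun e : nat * nat => enc_nat e.1 ++ enc_nat e.2).
  move=> [a b] [a' b'] r r' /=.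
  rewrite -(catA (enc_nat a)) -(catA (enc_nat a')) => /enc_nat_prefix[->].
  by move/enc_nat_prefix=> [-> ->].
move/(enc_seq_prefix He) => [->] /(enc_seq_prefix (enc_seq_prefix enc_rat_prefix))[->].
move/enc_nat_prefix => [->] /(enc_seq_prefix enc_rat_prefix)[->].
rewrite -[enc_seq enc_rat y]cats0 -[enc_seq enc_rat y']cats0.
by move/(enc_seq_prefix enc_rat_prefix) => [-> _].
Qed.

(** * Printing the game *)

Lemma iota_blocks (T : Type) (F : nat -> seq T) d G :
  flatten [seq F j | j <- iota 2 (G * d)] =
  flatten [seq flatten [seq F (vtx d g a) | a <- iota 0 d] | g <- iota 0 G].
Proof.
elim: G => [|G IHG] //.
rewrite mulSnr iotaD -[in RHS]addn1 [in RHS]iotaD !map_cat !flatten_cat IHG; congr cat.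
rewrite /= cats0; congr flatten.
rewrite -[2 + G * d]addn0 iotaDl -map_comp; apply: eq_map => a /=.
by rewrite /vtx -addnA.
Qed.

Definition idx_loop r i p : prog := Seq (Repeat r (Seq p (Push i true))) (clear i).

Lemma emits_idx B r i p s (w : nat -> seq bool) :
  r != 0 -> i != 0 -> r != i -> s i = [::] -> size (s r) <= B ->
  (forall k, k < size (s r) ->
     emits B p (upd s i (nseq k true)) (w k) (upd s i (nseq k true))) ->
  emits B (idx_loop r i p) s (flatten [seq w k | k <- iota 0 (size (s r))]) s.
Proof.
move=> r0 i0 ri Ei leB Hp; rewrite -[flatten _]cats0.
have E0 : upd s i (nseq 0 true) = s by rewrite -[nseq 0 true]/[::] -Ei upd_id.
apply: (@emits_seq _ _ _ _ _ (upd s i (nseq (size (s r)) true))).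
  have := @emits_for_state B r (Seq p (Push i true)) (Seq p (Push i true))
    (fun k => upd s i (nseq k true)) w r0.
  rewrite E0; apply=> // k lt; rewrite if_same -[w k]cats0.
  apply: emits_seq (Hp k lt) _.
  have := @emits_push B i true (upd s i (nseq k true)) i0.
  by rewrite upd_eq upd_upd.
move=> o; have := @exec_clear B i (upd (upd s i (nseq (size (s r)) true)) 0 o).
rewrite upd_neq // upd_eq size_nseq => /(_ leB).
by rewrite [upd (upd _ 0 _) i _]updC 1?eq_sym // upd_upd -[[::]]/(nseq 0 true) E0.
Qed.

Definition tr (b : bool) : seq bool := true :: enc_rat (b%:R)%R.

Section Printer.
(* The witness length is bounded by [kp * n ^ kp + kp], the running time by
   [km * m ^ km + km]. *)
Variables (M : TM) (kp km : nat).
Let d := n_tiles M.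
Let H := @h_nat M.
Let V := @v_nat M.

(** In order: witness length, length of the word given to the verifier, number of rows, width, index
    of the last tiled cell, the same index counted from the first forced cell, number of tile
    vertices. Factors 1 and the order of summands follow the loops of [setup], so that [adds]
    produces these expressions literally; [1 + 1] in [size_Z] is the margin in [t.+2 <= Z]. *)
Definition size_P n := kp * n ^ kp + kp.
Definition size_M n := n * 2 + (1 + size_P n * 1).
Definition size_Z n := km * size_M n ^ km + km + (1 + 1).
Definition size_W n := size_Z n * 4 + (1 + (n * 2 + (1 + size_P n * 1))).
Definition size_N n := size_W n * (size_Z n * 1).
Definition size_R n := size_W n * 1 + size_N n * 1.
Definition size_E n := size_R n * d + d.

Definition max_size n :=
  n + size_P n + size_M n + size_Z n + size_W n + size_N n + size_R n + size_E n + 2.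

Definition rX := 4.
Definition rP := 5.
Definition rM := 6.
Definition rZ := 7.
Definition rW := 8.
Definition rN := 9.
Definition rE := 10.
Definition rI := 11.
Definition rH := 12.
Definition rR := 13.

Definition tick r := Push r true.
Definition ticks n r := iter n (Seq (tick r)) Skip.

Definition setup : prog :=
  Seq (For 0 (Push rX false) (Push rX true)) (Seq (clear 0)
 (Seq (poly_add rX kp rP)
 (Seq (Seq (Repeat rX (ticks 2 rM)) (Seq (tick rM) (Repeat rP (tick rM))))
 (Seq (Seq (poly_add rM km rZ) (Seq (tick rZ) (tick rZ)))
 (Seq (Seq (Repeat rZ (ticks 4 rW))
       (Seq (tick rW) (Seq (Repeat rX (ticks 2 rW)) (Seq (tick rW) (Repeat rP (tick rW))))))
 (Seq (Repeat rW (Repeat rZ (tick rN)))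
 (Seq (Seq (Repeat rW (tick rR)) (Repeat rN (tick rR)))
      (Seq (Repeat rR (ticks d rE)) (ticks d rE))))))))).

Section State.
Variables (x : seq bool).
Let n := size x.
Let B := max_size n.

Definition ready (s : regs) : Prop :=
  [/\ clean s, s rI = [::], s rX = x, s rP = nseq (size_P n) true & [/\
      s rZ = nseq (size_Z n) true, s rW = nseq (size_W n) true,
      s rN = nseq (size_N n) true & s rE = nseq (size_E n) true]].

Lemma setup_exec : exists s, [/\ ready s, s 0 = [::], s rH = [::],
  s rR = nseq (size_R n) true & exec B setup (input_regs x) s].
Proof.
pose s1 := upd (fun=> [::]) rX x.
pose s2 := upd s1 rP (nseq (size_P n) true).
pose s3 := upd s2 rM (nseq (size_M n) true).
pose s4 := upd s3 rZ (nseq (size_Z n) true).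
pose s5 := upd s4 rW (nseq (size_W n) true).
pose s6 := upd s5 rN (nseq (size_N n) true).
pose s7 := upd s6 rR (nseq (size_R n) true).
pose s8 := upd s7 rE (nseq (size_E n) true).
have tk r s : r != 0 -> adds B (tick r) r 1 s by apply: adds_push.
have tks m r s : r != 0 -> adds B (ticks m r) r m s.
  by move=> r0; rewrite -[X in adds _ _ _ X _](muln1 m); apply: adds_iter; apply: tk.
have fa r p dd c s l : s r = l -> r != 0 -> r != dd -> size l <= B -> adds B p dd c s ->
    adds B (Repeat r p) dd (size l * c) s.
  by move=> <-; apply: adds_repeat.
have fn r p dd c s m : s r = nseq m true -> r != 0 -> r != dd -> m <= B ->
    adds B p dd c s -> adds B (Repeat r p) dd (m * c) s.
  move=> E r0 rd le Ha; rewrite -[X in adds _ _ _ (X * _) _](size_nseq m true).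
  by apply: fa => //; rewrite size_nseq.
have E2 : emits B (poly_add rX kp rP) s1 [::] s2.
  by apply: adds_emits => //; apply: (@poly_add_adds B rX kp rP s1) => //; rewrite -/n /B /max_size; lia.
have E3 : emits B (Seq (Repeat rX (ticks 2 rM)) (Seq (tick rM) (Repeat rP (tick rM)))) s2 [::] s3.
  apply: adds_emits => //; apply: adds_seq.
    by apply: (fa rX _ _ _ _ x) => //; [rewrite -/n /B /max_size; lia | apply: tks].
  apply: adds_seq; first exact: tk.
  by apply: fn => //; [rewrite /B /max_size; lia | apply: tk].
have E4 : emits B (Seq (poly_add rM km rZ) (Seq (tick rZ) (tick rZ))) s3 [::] s4.
  apply: adds_emits => //; apply: adds_seq; last by apply: adds_seq; apply: tk.
  have := @poly_add_adds B rM km rZ s3 isT isT isT.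
  by rewrite (_ : s3 rM = nseq (size_M n) true) // size_nseq; apply; rewrite /B /max_size; lia.
have E5 : emits B (Seq (Repeat rZ (ticks 4 rW))
       (Seq (tick rW) (Seq (Repeat rX (ticks 2 rW)) (Seq (tick rW) (Repeat rP (tick rW))))))
    s4 [::] s5.
  apply: adds_emits => //; apply: adds_seq.
    by apply: fn => //; [rewrite /B /max_size; lia | apply: tks].
  apply: adds_seq; first exact: tk.
  apply: adds_seq.
    by apply: (fa rX _ _ _ _ x) => //; [rewrite -/n /B /max_size; lia | apply: tks].
  apply: adds_seq; first exact: tk.
  by apply: fn => //; [rewrite /B /max_size; lia | apply: tk].
have E6 : emits B (Repeat rW (Repeat rZ (tick rN))) s5 [::] s6.
  apply: adds_emits => //; apply: (fn) => //; first by rewrite /B /max_size; lia.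
  by apply: fn => //; [rewrite /B /max_size; lia | apply: tk].
have E7 : emits B (Seq (Repeat rW (tick rR)) (Repeat rN (tick rR))) s6 [::] s7.
  apply: adds_emits => //; apply: adds_seq.
    by apply: fn => //; [rewrite /B /max_size; lia | apply: tk].
  by apply: fn => //; [rewrite /B /max_size; lia | apply: tk].
have E8 : emits B (Seq (Repeat rR (ticks d rE)) (ticks d rE)) s7 [::] s8.
  apply: adds_emits => //; apply: adds_seq; last exact: tks.
  by apply: fn => //; [rewrite /B /max_size; lia | apply: tks].
have Hr : ready s8 by rewrite /ready /clean; do !split.
exists s8; split=> //.
have Es0 s : s 0 = [::] -> upd s 0 [::] = s by move=> E; rewrite -E upd_id.
exists (upd s1 0 (rev x)).
  have := @exec_move B 0 rX (input_regs x) isT.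
  rewrite /input_regs upd_eq upd_neq // revK cats0 size_rev updC //; apply.
  by rewrite -/n /B /max_size; lia.
exists s1.
  have := @exec_clear B 0 (upd s1 0 (rev x)); rewrite upd_eq upd_upd Es0 // size_rev; apply.
  by rewrite -/n /B /max_size; lia.
have := emits_seq E2 (emits_seq E3 (emits_seq E4 (emits_seq E5 (emits_seq E6 (emits_seq E7 E8))))).
by move/(_ [::]); rewrite /= !Es0.
Qed.


Local Notation P := (size_P n).
Local Notation Z := (size_Z n).
Local Notation Np := (size_N n).
Let ws := [seq kind_nat k | k <- word M Z P x].
Local Notation W := (size ws).
Local Notation nV := (n_vertices d ws Np).
Local Notation vt := (vtx d).

Definition game : instance := g_instance d H V ws Np.

Lemma size_wsE : W = size_W n.
Proof. by rewrite size_map size_word /size_W -/n; lia. Qed.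

Lemma n_itemsE : n_items d ws Np = size_E n.
Proof. by rewrite /n_items size_wsE /size_E /size_R !muln1 addnS mulSnr. Qed.

Lemma max_sizeP : [/\ n <= B, P <= B, Z <= B, size_W n <= B & [/\ Np <= B,
  size_R n <= B & 2 + size_E n <= B]].
Proof. by rewrite /B /max_size; split; [lia..|split; lia]. Qed.

Lemma n_tiles_gt0 : 0 < d.
Proof. exact: leq_ltn_trans (leq0n _) (tile_nat_lt (inr None)). Qed.

Lemma ws_lt : all (fun a => a < d) ws.
Proof. by apply/allP => a /mapP[k _ ->]; apply: tile_nat_lt. Qed.

Lemma vt_le g a : a < d -> g < W + Np.+1 -> vt g a <= B.
Proof.
move=> la lg; have := vtx_lt n_tiles_gt0 ws_lt la lg; rewrite /n_vertices n_itemsE => lt.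
by have [_ _ _ _ [_ _ le]] := max_sizeP; lia.
Qed.

Lemma ready_upd s r l : r \in [:: rI; rH; rR] -> (r == rI -> l = [::]) ->
  ready s -> ready (upd s r l).
Proof.
rewrite !inE => hr hl [[h1 h2 h3] h4 h5 h6 [h7 h8 h9 h10]].
rewrite /ready /clean /upd; case/or3P: hr hl => /eqP -> hl; do !split => //.
exact: hl.
Qed.

Lemma clean_upd (s : regs) r l : rC < r -> clean s -> clean (upd s r l).
Proof. by move=> lt [h1 h2 h3]; rewrite /clean !upd_neq //; move: lt; rewrite /rC /rT /rB; lia. Qed.

Lemma emits_numE c rs s v : clean s -> all (fun r => rC < r) rs ->
  v = c + sumn [seq size (s r) | r <- rs] -> v <= B ->
  emits B (num c rs) s (enc_nat v) s.
Proof. by move=> cs ars -> le; apply: emits_num. Qed.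

Lemma sumn_nseq_regs (s : regs) m r : sumn [seq size (s r') | r' <- nseq m r] = m * size (s r).
Proof. by rewrite map_nseq sumn_nseq mulnC. Qed.

Lemma emits_idx_ready r p s w : ready s -> r != 0 -> r != rI -> size (s r) <= B ->
  (forall k s', k < size (s r) -> clean s' -> s' rI = nseq k true ->
     s' rW = nseq (size_W n) true -> emits B p s' (w k) s') ->
  emits B (idx_loop r rI p) s (flatten [seq w k | k <- iota 0 (size (s r))]) s.
Proof.
move=> [cs h1 h2 h3 [h4 h5 h6 h7]] r0 ri le Hp; apply: emits_idx => // k lt.
by apply: Hp => //; apply: clean_upd.
Qed.

(** * Printing the owners and the edges *)

Definition print_owner : prog :=
  Seq (outs (true :: enc_nat 0 ++ true :: enc_nat 1))
 (Seq (idx_loop rE rI (Seq (outs [:: true]) (num 2 [:: rI]))) (outs [:: false])).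

Lemma emits_owner s : ready s ->
  emits B print_owner s (enc_seq enc_nat (iota 0 nV)) s.
Proof.
move=> rs; have [_ _ _ _ [_ _ _ hE]] := rs; have [_ _ _ _ [_ _ leE]] := max_sizeP.
have -> : enc_seq enc_nat (iota 0 nV) = (true :: enc_nat 0 ++ true :: enc_nat 1) ++
    flatten [seq [:: true] ++ enc_nat (2 + k) | k <- iota 0 (size (s rE))] ++ [:: false].
  rewrite /enc_seq /n_vertices n_itemsE hE size_nseq iotaD map_cat flatten_cat -catA.
  congr cat; congr cat; rewrite -[0 + 2]addn0 iotaDl -map_comp; congr flatten.
apply: emits_seq (emits_outs _ _ _) (emits_seq _ (emits_outs _ _ _)).
apply: emits_idx_ready => //; rewrite hE size_nseq; first lia.
move=> k s' lt cs sI _; apply: emits_seq (emits_outs _ _ _) _.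
by apply: emits_numE => //=; rewrite ?sI ?size_nseq; lia.
Qed.

Lemma flatten_map_allpairs (T1 T2 T3 T4 : Type) (F : T3 -> seq T4) (f : T1 -> T2 -> T3) s t :
  flatten [seq F e | e <- [seq f a b | a <- s, b <- t]] =
  flatten [seq flatten [seq F (f a b) | b <- t] | a <- s].
Proof.
elim: s => //= a s IHs; rewrite map_cat flatten_cat IHs; congr cat.
by rewrite -map_comp.
Qed.

(** Since [vtx (W + h) a] is [W * d + h * d + a + 2], it is printed by [num] with [d] copies of [rW]
    and of the register holding [h]; the next cell adds the constant [d]. *)
Definition print_edges : prog :=
  Seq (outs (true :: enc_nat 1 ++ enc_nat 1))
 (Seq (idx_loop rE rI (Seq (outs [:: true]) (Seq (num 2 [:: rI]) (outs (enc_nat 1)))))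
 (Seq (seqs [seq Seq (outs (true :: enc_nat 0)) (num (2 + a) (nseq d rW)) | a <- iota 0 d])
 (Seq (idx_loop rN rI (seqs [seq Seq (outs [:: true])
        (Seq (num (2 + p.1) (nseq d rW ++ nseq d rI))
             (num (2 + d + p.2) (nseq d rW ++ nseq d rI))) | p <- h_pairs d H]))
 (Seq (seqs [seq Seq (outs [:: true])
        (Seq (num (2 + a) (nseq d rW ++ nseq d rN)) (outs (enc_nat 0))) | a <- iota 0 d])
      (outs [:: false]))))).

Lemma all_rC m r : rC < r -> all (fun r => rC < r) (nseq m r).
Proof. by move=> lt; rewrite all_nseq lt orbT. Qed.

Lemma emits_edges s : ready s ->
  emits B print_edges s
    (enc_seq (fun e : nat * nat => enc_nat e.1 ++ enc_nat e.2) (g_edges d H ws Np)) s.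
Proof.
move=> rs; have [cs _ _ _ [_ hW hN hE]] := rs; have [_ _ _ _ [leN _ leE]] := max_sizeP.
rewrite /enc_seq /g_edges map_cons !map_cat.
rewrite -[flatten (_ :: _)]/((true :: enc_nat 1 ++ enc_nat 1) ++ flatten _).
rewrite !flatten_cat flatten_map_allpairs -!map_comp -4!catA.
apply: emits_seq (emits_outs _ _ _) _.
apply: emits_seq.
  have -> : iota 2 (n_items d ws Np) = [seq 2 + k | k <- iota 0 (size (s rE))].
    by rewrite hE size_nseq n_itemsE -iotaDl.
  rewrite -map_comp; apply: emits_idx_ready => //; rewrite hE size_nseq; first lia.
  move=> k s' lt cs' sI _; apply: emits_seq (emits_outs _ [:: true] _) _.
  apply: emits_seq (emits_outs _ _ _).
  by apply: emits_numE => //=; rewrite ?sI ?size_nseq; lia.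
apply: emits_seq.
  apply: emits_seqs => a; rewrite mem_iota => la.
  apply: emits_seq (emits_outs _ (true :: enc_nat 0) _) _.
  apply: emits_numE => //; first exact: all_rC.
    by rewrite sumn_nseq_regs hW size_nseq size_wsE /= /vtx; lia.
  by apply: vt_le => //; lia.
apply: emits_seq.
  have -> : iota 0 Np = iota 0 (size (s rN)) by rewrite hN size_nseq.
  apply: emits_idx_ready => //; rewrite hN size_nseq // => k s' lt cs' sI sW.
  apply: emits_seqs => -[a b]; rewrite mem_h_pairs => /and3P[la lb _].
  apply: emits_seq (emits_outs _ [:: true] _) _; apply: emits_seq.
    apply: emits_numE => //; first by rewrite all_cat !all_rC.
      by rewrite map_cat sumn_cat !sumn_nseq_regs sW sI !size_nseq size_wsE /= /vtx; lia.
    by apply: vt_le => //=; lia.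
  apply: emits_numE => //; first by rewrite all_cat !all_rC.
    by rewrite map_cat sumn_cat !sumn_nseq_regs sW sI !size_nseq size_wsE /= /vtx; lia.
  by apply: vt_le => //=; lia.
apply: emits_seq (emits_outs _ _ _).
apply: emits_seqs => a; rewrite mem_iota => la.
apply: emits_seq (emits_outs _ [:: true] _) _; apply: emits_seq (emits_outs _ _ _).
apply: emits_numE => //; first by rewrite all_cat !all_rC.
  by rewrite map_cat sumn_cat !sumn_nseq_regs hW hN !size_nseq size_wsE /= /vtx; lia.
by apply: vt_le => //=; lia.
Qed.


(** * Printing the rewards *)

Definition ones : seq bool := flatten (nseq d (tr true)).
Definition zeros : seq bool := flatten (nseq d (tr false)).

Lemma enc_bools (F : nat -> bool) : enc_seq enc_rat [seq ((F j)%:R)%R | j <- iota 0 nV] =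
  (tr (F 0) ++ tr (F 1)) ++
  flatten [seq flatten [seq tr (F (vt g a)) | a <- iota 0 d] | g <- iota 0 (W + Np.+1)] ++
  [:: false].
Proof.
by rewrite /enc_seq -map_comp /n_vertices iotaD map_cat flatten_cat iota_blocks -!catA.
Qed.

Lemma flatten_const (T T' : Type) (w : seq T) (l : seq T') :
  flatten [seq w | _ <- l] = flatten (nseq (size l) w).
Proof. by elim: l => //= a l ->. Qed.

Lemma flatten_nseqM (T : Type) (w : seq T) m m' :
  flatten (nseq m (flatten (nseq m' w))) = flatten (nseq (m * m') w).
Proof. by elim: m => //= m ->; rewrite mulSn nseqD flatten_cat. Qed.

Lemma flatten_ones : flatten (nseq (W + Np.+1) ones) = flatten (nseq (size_E n) (tr true)).
Proof. by rewrite flatten_nseqM -n_itemsE. Qed.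

Definition row_word v : seq bool :=
  true :: enc_seq enc_rat [seq ((rw d V ws j v)%:R)%R | j <- iota 0 nV].

Definition block_V b : seq bool := flatten [seq tr (V a b) | a <- iota 0 d].


Lemma blocks_const (F : nat -> bool) b g0 G :
  (forall g a, g0 <= g < g0 + G -> a < d -> F (vt g a) = b) ->
  flatten [seq flatten [seq tr (F (vt g a)) | a <- iota 0 d] | g <- iota g0 G] =
  flatten (nseq G (flatten (nseq d (tr b)))).
Proof.
move=> HF; rewrite -[X in nseq X _](size_iota g0 G) -flatten_const; congr flatten.
apply/eq_in_map => g; rewrite mem_iota => hg.
rewrite -[X in nseq X _](size_iota 0 d) -flatten_const; congr flatten.
by apply/eq_in_map => a; rewrite mem_iota => ha; rewrite HF.
Qed.

Lemma row_exit : row_word 1 =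
  (true :: tr false ++ tr true) ++ flatten (nseq (size_E n) (tr true)) ++ [:: false].
Proof.
rewrite /row_word enc_bools -cat_cons (@blocks_const (fun j => rw d V ws j 1) true) //.
by rewrite -[flatten (nseq d _)]/ones flatten_ones.
Qed.

Lemma row_wrap : row_word 0 =
  (true :: tr true ++ tr true) ++ flatten (nseq (size_E n) (tr true)) ++ [:: false].
Proof.
rewrite /row_word enc_bools -cat_cons (@blocks_const (fun j => rw d V ws j 0) true) //.
by rewrite -[flatten (nseq d _)]/ones flatten_ones.
Qed.

(** Only the owners of cell [h], which lies [W] cells before the target, can lose; the row is
    constant 1 apart from their block. *)
Lemma row_tile h b : h <= Np -> b < d -> row_word (vt (W + h) b) =
  (true :: tr true ++ tr true) ++ flatten (nseq h ones) ++ block_V b ++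
  flatten (nseq (size_R n - h) ones) ++ [:: false].
Proof.
move=> le lb; rewrite /row_word enc_bools -cat_cons; congr (_ ++ _).
have -> : W + Np.+1 = h + (1 + (size_R n - h)).
  by rewrite size_wsE /size_R; lia.
have off g a : g != h -> a < d -> rw d V ws (vt g a) (vt (W + h) b) = true.
  move=> ne la; rewrite /rw /= !grp_vtx ?n_tiles_gt0 ?ws_lt // addnC eqn_add2r.
  by rewrite eq_sym (negPf ne).
rewrite iotaD map_cat flatten_cat -catA; congr (_ ++ _).
  by rewrite (@blocks_const (fun j => rw d V ws j (vt (W + h) b)) true) // => g a hg la; apply: off => //; lia.
rewrite iotaD map_cat flatten_cat -catA; congr (_ ++ _).
  rewrite /= cats0 add0n /block_V; congr flatten; apply/eq_in_map => a.
  rewrite mem_iota => la; rewrite /rw /= !grp_vtx ?n_tiles_gt0 ?ws_lt //.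
  by rewrite addnC eqxx !til_vtx ?n_tiles_gt0 ?ws_lt.
congr (_ ++ _); rewrite (@blocks_const (fun j => rw d V ws j (vt (W + h) b)) true) // => g a hg la; apply: off => //; lia.
Qed.

Definition print_exit_row : prog :=
  Seq (outs (true :: tr false ++ tr true))
 (Seq (Repeat rE (outs (tr true))) (outs [:: false])).

Definition print_wrap_row : prog :=
  Seq (outs (true :: tr true ++ tr true))
 (Seq (Repeat rE (outs (tr true))) (outs [:: false])).

Definition print_row b : prog :=
  Seq (outs (true :: tr true ++ tr true))
 (Seq (Repeat rH (outs ones)) (Seq (outs (block_V b))
 (Seq (Repeat rR (outs ones)) (outs [:: false])))).

(** The order is that of [g_edges], each edge contributing the row of its target. Edges leaving
    tiled cell [h] enter cell [h.+1], so the counters advance before the rows are printed. *)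
Definition print_rewards : prog :=
  Seq print_exit_row
 (Seq (Repeat rE print_exit_row)
 (Seq (seqs [seq print_row b | b <- iota 0 d])
 (Seq (Repeat rN (Seq (Seq (Push rH true) (Case rR Skip Skip Skip))
                       (seqs [seq print_row p.2 | p <- h_pairs d H])))
 (Seq (seqs [seq print_wrap_row | _ <- iota 0 d]) (outs [:: false]))))).

Lemma emits_exit_row s : ready s -> emits B print_exit_row s (row_word 1) s.
Proof.
case=> _ _ _ _ [_ _ _ hE]; have [_ _ _ _ [_ _ leE]] := max_sizeP; rewrite row_exit.
apply: emits_seq (emits_outs _ _ _) (emits_seq _ (emits_outs _ _ _)).
have -> : size_E n = size (s rE) by rewrite hE size_nseq.
by apply: emits_repeat (emits_outs _ _ _) => //; rewrite hE size_nseq; lia.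
Qed.

Lemma emits_wrap_row s : ready s -> emits B print_wrap_row s (row_word 0) s.
Proof.
case=> _ _ _ _ [_ _ _ hE]; have [_ _ _ _ [_ _ leE]] := max_sizeP; rewrite row_wrap.
apply: emits_seq (emits_outs _ _ _) (emits_seq _ (emits_outs _ _ _)).
have -> : size_E n = size (s rE) by rewrite hE size_nseq.
by apply: emits_repeat (emits_outs _ _ _) => //; rewrite hE size_nseq; lia.
Qed.

(** The two counters hold the numbers of constant blocks before and after the block of cell [h]. *)
Definition at_row (s : regs) h : regs :=
  upd (upd s rH (nseq h true)) rR (nseq (size_R n - h) true).

Lemma ready_at_row s h : ready s -> ready (at_row s h).
Proof. by move=> rs; apply: ready_upd => //; apply: ready_upd. Qed.

Lemma emits_row s h b : h <= Np -> b < d ->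
  emits B (print_row b) (at_row s h) (row_word (vt (W + h) b)) (at_row s h).
Proof.
move=> le lb; have [_ _ _ _ [leN leR _]] := max_sizeP; rewrite row_tile //.
have EH : at_row s h rH = nseq h true by [].
have ER : at_row s h rR = nseq (size_R n - h) true by [].
apply: emits_seq (emits_outs _ _ _) (emits_seq _ (emits_seq (emits_outs _ _ _)
  (emits_seq _ (emits_outs _ _ _)))).
  rewrite -[X in nseq X _](size_nseq h true) -EH.
  by apply: emits_repeat (emits_outs _ _ _) => //; rewrite EH size_nseq; lia.
rewrite -[X in nseq X _](size_nseq (size_R n - h) true) -ER.
by apply: emits_repeat (emits_outs _ _ _) => //; rewrite ER size_nseq; lia.
Qed.

Lemma emits_rewards s : ready s -> emits B print_rewards (at_row s 0)
  (enc_seq (enc_seq enc_rat) (i_rew game)) (at_row s Np).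
Proof.
move=> rs; have rs0 := ready_at_row 0 rs; have [leN0 _ _ _ [leN _ leE]] := max_sizeP.
have [_ _ _ _ [_ _ hN0 hE0]] := rs0.
rewrite -[i_rew game]/[seq _ | e <- g_edges d H ws Np] /enc_seq -map_comp /g_edges.
rewrite map_cons !map_cat -[flatten (_ :: _)]/(row_word 1 ++ flatten _).
rewrite !flatten_cat flatten_map_allpairs -!map_comp -4!catA.
apply: emits_seq; first exact: emits_exit_row.
apply: emits_seq.
  rewrite (eq_map (_ : _ =1 fun=> row_word 1)) // flatten_const size_iota n_itemsE.
  have -> : size_E n = size (at_row s 0 rE) by rewrite hE0 size_nseq.
  apply: emits_repeat => //; first by rewrite hE0 size_nseq; lia.
  exact: emits_exit_row.
apply: emits_seq.
  apply: emits_seqs => b; rewrite mem_iota => lb; rewrite -[X in vt X _](addn0 W).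
  exact: emits_row.
apply: emits_seq.
  have hN : size (at_row s 0 rN) = Np by rewrite hN0 size_nseq.
  have := @emits_for_state B rN _ _ (at_row s) _ isT; rewrite hN; apply=> // k lt.
  rewrite if_same -[X in emits _ _ _ X _]cat0s.
  apply: (@emits_seq _ _ _ _ _ (at_row s k.+1)).
    move=> o; exists (upd (upd (at_row s k) rH (nseq k.+1 true)) 0 o).
      by rewrite /= [upd (at_row s k) 0 o rH]upd_neq // updC.
    have E : size_R n - k = (size_R n - k.+1).+1 by rewrite /size_R; lia.
    have ER : upd (upd (at_row s k) rH (nseq k.+1 true)) 0 o rR =
        true :: nseq (size_R n - k.+1) true.
      by rewrite !upd_neq // /at_row upd_eq E.
    rewrite /= ER /= updC //; congr upd; rewrite /at_row [in RHS]updC // upd_upd.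
    by rewrite [in RHS]updC // upd_upd.
  apply: emits_seqs => -[a b]; rewrite mem_h_pairs => /and3P[_ lb _].
  by rewrite -addnS; apply: emits_row.
apply: emits_seq (emits_outs _ _ _).
apply: emits_seqs => a _; apply: emits_wrap_row; exact: ready_at_row.
Qed.


(** * Printing the thresholds *)

Definition block (k : nat) : seq bool := flatten [seq tr (a == k) | a <- iota 0 d].
Local Notation kind k := (kind_nat (k : option (option bool * option (option 'I_(nQ M).+1) * bool))).
Definition block_blank := block (kind (Some (None, None, false))).
Definition block_start := block (kind (Some (None, Some None, false))).
Definition block_bit b := block (kind (Some (Some b, None, false))).
Definition block_guess := block (kind None).

Definition print_blanks : prog := Repeat rZ (outs (block_blank ++ block_blank)).

(** The blocks follow [word]: an input bit [b] contributes the two symbols [true] and [b] of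
    [pcode], and blanks come in pairs because the margin is [2 * Z] while the register holds [Z].
    The final zeros are the thresholds of the tiled cells. *)
Definition print_x : prog :=
  Seq (outs (tr true ++ tr false))
 (Seq print_blanks
 (Seq (outs block_start)
 (Seq (For rX (outs (block_bit true ++ block_bit false))
              (outs (block_bit true ++ block_bit true)))
 (Seq (outs (block_bit false))
 (Seq (Repeat rP (outs block_guess))
 (Seq print_blanks
 (Seq (Repeat rN (outs zeros)) (outs (zeros ++ [:: false]))))))))).

Lemma blocks_ws : flatten [seq block k | k <- ws] =
  flatten (nseq Z (block_blank ++ block_blank)) ++ block_start ++
  flatten [seq if b then block_bit true ++ block_bit true
               else block_bit true ++ block_bit false | b <- x] ++
  block_bit false ++ flatten (nseq P block_guess) ++
  flatten (nseq Z (block_blank ++ block_blank)).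
Proof.
have bl : flatten (nseq (2 * Z) block_blank) =
    flatten (nseq Z (block_blank ++ block_blank)).
  by rewrite mulnC -flatten_nseqM /= cats0.
rewrite /ws -map_comp /word map_cat flatten_cat map_nseq bl; congr (_ ++ _).
rewrite map_cons -[flatten (_ :: _)]/(block_start ++ flatten _); congr (_ ++ _).
rewrite !map_cat !flatten_cat !map_nseq bl -!map_comp -!catA.
congr (_ ++ _); elim: (x) => //= b l ->.
by rewrite catA; congr (_ ++ _); case: b.
Qed.

Lemma emits_blanks s : ready s ->
  emits B print_blanks s (flatten (nseq Z (block_blank ++ block_blank))) s.
Proof.
case=> _ _ _ _ [hZ _ _ _]; have [_ _ leZ _ _] := max_sizeP.
have -> : Z = size (s rZ) by rewrite hZ size_nseq.
by apply: emits_repeat (emits_outs _ _ _) => //; rewrite hZ size_nseq.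
Qed.

Lemma emits_x s : ready s -> emits B print_x s (enc_seq enc_rat (i_x game)) s.
Proof.
move=> rs; have [_ _ hX hP [hZ _ hN _]] := rs; have [leX leP _ _ [leN _ _]] := max_sizeP.
rewrite -[i_x game]/[seq _ | j <- iota 0 nV] enc_bools.
apply: emits_seq (emits_outs _ _ _) _.
rewrite iotaD map_cat flatten_cat.
have -> : flatten [seq flatten [seq tr (forced d ws (vt g a)) | a <- iota 0 d]
    | g <- iota 0 W] = flatten [seq block k | k <- ws].
  rewrite -[in RHS](mkseq_nth 0 ws) /mkseq -map_comp; congr flatten.
  apply/eq_in_map => g; rewrite mem_iota => lg; congr flatten.
  apply/eq_in_map => a; rewrite mem_iota => la.
  rewrite /forced /= grp_vtx ?n_tiles_gt0 ?ws_lt // til_vtx ?n_tiles_gt0 ?ws_lt //.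
  by rewrite (lg : g < W).
rewrite (@blocks_const (forced d ws) false); last first.
  move=> g a /andP[lg _] la; rewrite /forced /= grp_vtx ?n_tiles_gt0 ?ws_lt //.
  by rewrite [g < _]ltnNge lg.
rewrite -/zeros -addn1 nseqD flatten_cat -[flatten (nseq 1 _)]/(zeros ++ [::]) cats0.
rewrite blocks_ws -!catA.
apply: emits_seq; first exact: emits_blanks.
apply: emits_seq (emits_outs _ _ _) _.
apply: emits_seq.
  have := @emits_for B rX _ _ s _ _ isT _ (emits_outs _ _ _) (emits_outs _ _ _).
  by rewrite hX; apply.
apply: emits_seq (emits_outs _ _ _) _.
apply: emits_seq.
  have -> : P = size (s rP) by rewrite hP size_nseq.
  by apply: emits_repeat (emits_outs _ _ _) => //; rewrite hP size_nseq.
apply: emits_seq; first exact: emits_blanks.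
apply: emits_seq (emits_outs _ _ _).
have -> : Np = size (s rN) by rewrite hN size_nseq.
by apply: emits_repeat (emits_outs _ _ _) => //; rewrite hN size_nseq.
Qed.

Definition print_y : prog :=
  Seq (outs (tr true ++ tr true)) (Seq (Repeat rE (outs (tr true))) (outs [:: false])).

Lemma emits_y s : ready s -> emits B print_y s (enc_seq enc_rat (i_y game)) s.
Proof.
case=> _ _ _ _ [_ _ _ hE]; have [_ _ _ _ [_ _ leE]] := max_sizeP.
have -> : enc_seq enc_rat (i_y game) =
    (tr true ++ tr true) ++ flatten (nseq (size_E n) (tr true)) ++ [:: false].
  rewrite -[i_y game]/(nseq nV 1%R) /enc_seq map_nseq /n_vertices n_itemsE nseqD.
  by rewrite flatten_cat -!catA.
apply: emits_seq (emits_outs _ _ _) (emits_seq _ (emits_outs _ _ _)).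
have -> : size_E n = size (s rE) by rewrite hE size_nseq.
by apply: emits_repeat (emits_outs _ _ _) => //; rewrite hE size_nseq; lia.
Qed.

Definition print_game : prog :=
  Seq (outs (enc_rat 0))
 (Seq (num 2 [:: rE]) (Seq (num 2 [:: rE])
 (Seq print_owner
 (Seq print_edges
 (Seq print_rewards
 (Seq (outs (enc_nat 0)) (Seq print_x print_y))))))).

Lemma print_game_exec : exists2 s,
  exec B (Seq setup print_game) (input_regs x) s & s 0 = rev (enc_instance game).
Proof.
have [s [rs s0 sH sR Hs]] := setup_exec.
have Es : s = at_row s 0.
  by rewrite /at_row subn0 -sR -[nseq 0 true]/[::] -sH !upd_id.
have [cs _ _ _ [_ _ _ hE]] := rs; have [_ _ _ _ [_ _ leE]] := max_sizeP.
have En : emits B (num 2 [:: rE]) s (enc_nat nV) s.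
  apply: emits_numE => //=; rewrite /n_vertices n_itemsE //.
  by rewrite hE size_nseq addn0.
exists (upd (at_row s Np) 0 (rev (enc_instance game))); last by rewrite upd_eq.
exists s => //; have rN := ready_at_row Np rs.
have Er := emits_rewards rs; rewrite -Es in Er.
have := emits_seq (emits_outs B (enc_rat 0) s) (emits_seq En (emits_seq En
  (emits_seq (emits_owner rs) (emits_seq (emits_edges rs) (emits_seq Er
  (emits_seq (emits_outs B (enc_nat 0) _) (emits_seq (emits_x rN) (emits_y rN)))))))).
by move/(_ [::]); rewrite cats0 -s0 upd_id.
Qed.

End State.

Lemma max_size_poly : poly_bounded max_size.
Proof.
have Hc := poly_bounded_const; have Hi := poly_bounded_id.
have HP : poly_bounded size_P.
  by apply: poly_boundedD => //; apply: poly_boundedM => //; apply: poly_boundedX.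
have HM : poly_bounded size_M.
  exact: (poly_boundedD (poly_boundedM Hi (Hc 2))
    (poly_boundedD (Hc 1) (poly_boundedM HP (Hc 1)))).
have HZ : poly_bounded size_Z.
  apply: poly_boundedD (Hc _); apply: poly_boundedD => //; apply: poly_boundedM => //.
  exact: poly_boundedX.
have HW : poly_bounded size_W.
  exact: (poly_boundedD (poly_boundedM HZ (Hc 4)) (poly_boundedD (Hc 1) HM)).
have HN : poly_bounded size_N.
  by apply: poly_boundedM => //; apply: poly_boundedM.
have HR : poly_bounded size_R.
  by apply: poly_boundedD; apply: poly_boundedM.
have HE : poly_bounded size_E.
  by apply: poly_boundedD => //; apply: poly_boundedM.
exact: (poly_boundedD (poly_boundedD (poly_boundedD (poly_boundedD (poly_boundedD
  (poly_boundedD (poly_boundedD (poly_boundedD Hi HP) HM) HZ) HW) HN) HR) HE) (Hc 2)).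
Qed.

Theorem game_poly_time : poly_time_computable (fun x => enc_instance (game x)).
Proof.
apply: (reg_program_poly_time (p := Seq setup print_game) max_size_poly) => x.
exact: print_game_exec.
Qed.

End Printer.

(** * Correctness of the reduction and NP-hardness *)

Lemma game_correct (M : TM) (kp km : nat) (Vf : seq bool -> bool) (x : seq bool) :
  (forall w, exists t, (t <= km * size w ^ km + km)%N /\
     cstate (tm_run M w t) = ord_max /\ tm_output (tm_run M w t) = [:: Vf w]) ->
  threshold_yes (game M kp km x) <->
  exists u, (size u <= kp * size x ^ kp + kp)%N /\ Vf (pair_words x u).
Proof.
move=> HM; set n := size x.
have run u : size u <= size_P kp n -> exists t, [/\ t.+2 <= size_Z kp km n,
    cstate (tm_run M (pair_words x u) t) = ord_max &
    tm_output (tm_run M (pair_words x u) t) = [:: Vf (pair_words x u)]].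
  move=> le; have [t [lt [h1 h2]]] := HM (pair_words x u); exists t; split=> //.
  have sz : size (pair_words x u) <= size_M kp n.
    by rewrite pair_wordsE size_cat size_pcode -/n /size_M; lia.
  have : size (pair_words x u) ^ km <= size_M kp n ^ km.
    by case: (km) => // k; rewrite leq_exp2r.
  by rewrite /size_Z; move: lt; nia.
have Z0 : 0 < size_Z kp km n by rewrite /size_Z; lia.
have := tableau_tiling Z0 run.
have -> : size (word M (size_Z kp km n) (size_P kp n) x) * size_Z kp km n =
    size_N kp km n.
  by rewrite size_word /size_N /size_W -/n muln1; congr muln; lia.
move=> H1; have H2 := tiling_nat (word M (size_Z kp km n) (size_P kp n) x) (size_N kp km n).
have H3 := g_instance_threshold (h_nat M) (v_nat M) (size_N kp km n)
  (n_tiles_gt0 M) (ws_lt M kp km x).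
rewrite /game; split.
  by move/H3/H2/H1 => [u]; exists u.
by case=> u [le acc]; apply/H3/H2/H1; exists u.
Qed.

Theorem mainTheorem11 :
  NP_hard eps_SPE_threshold_problem /\ NP_hard SPE_threshold_problem.
Proof.
have red L' : in_NP L' -> exists f : seq bool -> instance,
    [/\ poly_time_computable (enc_instance \o f), forall x, wf_instance (f x),
        forall x, i_eps (f x) = 0%R & forall x, L' x <-> threshold_yes (f x)].
  case=> Vf [kp [[M [km HM]] HL]]; exists (game M kp km); split=> [|x|x|x].
  - exact: game_poly_time.
  - exact: g_instance_wf (n_tiles_gt0 M) (ws_lt M kp km x).
  - by [].
  - by rewrite HL; apply: iff_sym; apply: game_correct HM.
(* One reduction serves both problems, since all its instances have tolerance 0. *)
split=> L' /red[f [pf wf ef tf]]; exists (enc_instance \o f); split=> // x; rewrite tf.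
  split=> [ty|[I [_ [/enc_instance_inj -> //]]]].
  by exists (f x).
split=> [ty|[I [_ [_ [/enc_instance_inj -> //]]]]].
by exists (f x).
Qed.
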